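(* Let $K$ be a compact Abelian group with $\dim K<\infty$ and $C=c(K)$. The following are equivalent: (a) $C$ is locally essential in $K$; (b) there is a $\delta$-subgroup $N$ of $K$ such that $L:=N\cap C$ is locally essential in $N$; (c) there exist a $\delta$-subgroup $H$ of $C$, a totally disconnected compact Abelian group $N$ and a closed essential subgroup $L$ of $N$ such that (c$_1$) there is a topological isomorphism $j:L\to H$, and (c$_2$) the quotient group $(N\times C)/\Gamma_j$, where $\Gamma_j=\{(x,j(x)):x\in L\}$ is the graph of $j$, is topologically isomorphic to an open subgroup of $K$.
   Context: Groups are Abelian and Hausdorff; $c(K)$ is the connected component of $0$; $\dim$ is covering dimension. A subgroup $S$ of a topological Abelian group $L$ is essential if it meets non-trivially every non-trivial closed subgroup of $L$, and locally essential if there is a neighbourhood $V$ of $0$ such that $S$ meets non-trivially every non-trivial closed subgroup of $L$ contained in $V$. A $\delta$-subgroup of a compact Abelian group $M$ is a closed totally disconnected subgroup $N$ such that $M/N$ is topologically isomorphic to a power of the circle group $\mathbb T$. *)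

(* Defs.v *)
From HB Require Import structures.
From mathcomp Require Import all_boot all_order all_algebra.
From mathcomp Require Import all_classical all_reals all_analysis.
From mathcomp Require Import Rstruct Rstruct_topology.

Set Implicit Arguments.
Unset Strict Implicit.
Unset Printing Implicit Defensive.

Import Order.TTheory GRing.Theory Num.Theory.
Local Open Scope classical_set_scope.
Local Open Scope ring_scope.

Definition subgroup {G : zmodType} (A : set G) : Prop :=
  A 0 /\ forall x y, A x -> A y -> A (x - y).

Definition ropen {T : topologicalType} (A U : set T) : Prop :=
  exists W : set T, open W /\ U = W `&` A.

Definition covering_dim_le (T : topologicalType) (n : nat) : Prop :=
  forall (I : finType) (U : I -> set T),
    (forall i, open (U i)) -> \bigcup_i U i = setT ->
    exists (J : finType) (V : J -> set T),
      [/\ (forall j, open (V j)),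
          \bigcup_j V j = setT,
          (forall j, exists i, V j `<=` U i) &
          (forall x : T, (#|[set j : J | `[< V j x >] ]| <= n.+1)%N)].

Definition finite_dim (T : topologicalType) : Prop :=
  exists n : nat, covering_dim_le T n.

Definition conn0 (G : topologicalZmodType) : set G :=
  connected_component setT 0.
Arguments conn0 G : clear implicits.

Definition essential_in {G : topologicalZmodType} (S L : set G) : Prop :=
  forall X : set G, X `<=` L -> subgroup X -> closed X -> X <> [set 0] ->
    exists x, [/\ X x, S x & x != 0].

(** [S] is locally essential in the closed subgroup [L]: there is a
    neighbourhood [V] of 0 (in [G], hence [V `&` L] is one in [L]) such that
    [S] meets non-trivially every non-trivial closed subgroup of [L]
    contained in [V]. *)
Definition locally_essential_in {G : topologicalZmodType} (S L : set G) : Prop :=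
  exists V : set G, nbhs 0 V /\
    forall X : set G, X `<=` L -> X `<=` V -> subgroup X -> closed X ->
      X <> [set 0] -> exists x, [/\ X x, S x & x != 0].

(** The circle group T, realised as the unit circle of R^2 with complex
    multiplication; powers T^I carry the product topology. *)
Definition circle (z : (Rdefinitions.R * Rdefinitions.R)%type) : Prop := z.1 ^+ 2 + z.2 ^+ 2 = 1.
Definition cmul (z w : (Rdefinitions.R * Rdefinitions.R)%type) : (Rdefinitions.R * Rdefinitions.R)%type :=
  (z.1 * w.1 - z.2 * w.2, z.1 * w.2 + z.2 * w.1).
Definition cone : (Rdefinitions.R * Rdefinitions.R)%type := (1, 0).

Definition circle_power (I : Type) : set {ptws I -> (Rdefinitions.R * Rdefinitions.R)%type} :=
  [set g | forall i, circle (g i)].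
Arguments circle_power I : clear implicits.

(** [f] induces a topological isomorphism [M/N ~= T^I]: on [M], [f] is a
    continuous homomorphism into [T^I], onto [T^I], with kernel [N], and
    open onto its image (relative topologies).  This is the standard
    (first isomorphism theorem) description of [M/N ~= T^I]. *)
Definition quotient_iso_circle_power {G : topologicalZmodType} (M N : set G)
    (I : Type) (f : G -> {ptws I -> (Rdefinitions.R * Rdefinitions.R)%type}) : Prop :=
  [/\ (forall x, M x -> circle_power I (f x)) /\
      (forall x y, M x -> M y -> f (x + y) = (fun i => cmul (f x i) (f y i))),
      {within M, continuous f},
      f @` M = circle_power I,
      (forall x, M x -> (f x = fun _ => cone) <-> N x) &
      (forall U, ropen M U -> ropen (circle_power I) (f @` U))].
Arguments quotient_iso_circle_power {G} M N I f.

Definition delta_subgroup {G : topologicalZmodType} (M N : set G) : Prop :=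
  [/\ N `<=` M, subgroup N, closed N, totally_disconnected N &
      exists (I : Type) (f : G -> {ptws I -> (Rdefinitions.R * Rdefinitions.R)%type}),
        quotient_iso_circle_power M N I f].

Definition top_iso_on {G1 G2 : topologicalZmodType} (L : set G1) (H : set G2)
    (j : G1 -> G2) : Prop :=
  [/\ (forall x y, L x -> L y -> j (x + y) = j x + j y),
      {in L &, injective j},
      j @` L = H,
      {within L, continuous j} &
      (forall U, ropen L U -> ropen H (j @` U))].

Definition graph_on {G1 G2 : Type} (L : set G1) (j : G1 -> G2) : set (G1 * G2) :=
  [set p | L p.1 /\ p.2 = j p.1].

(** [phi] induces a topological isomorphism [(A)/B ~= Y], where [A], [B] are
    subgroups of [N * K] and [Y] a subgroup of [K]: [phi] is a homomorphism
    on [A], continuous on [A], maps [A] onto [Y], has kernel [B] in [A], and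
    is open from [A] onto [Y] (relative topologies).  This is the standard
    (first isomorphism theorem) description of [A/B ~= Y]. *)
Definition quotient_iso_prod {N K : topologicalZmodType}
    (A B : set (N * K)%type) (Y : set K) (phi : (N * K)%type -> K) : Prop :=
  [/\ (forall p q, A p -> A q -> phi (p + q) = phi p + phi q),
      {within A, continuous phi},
      phi @` A = Y,
      (forall p, A p -> phi p = 0 <-> B p) &
      (forall U, ropen A U -> ropen Y (phi @` U))].

(* Main.v *)
Require Import Defs.
From HB Require Import structures.
From mathcomp Require Import all_boot all_order all_fingroup all_algebra.
From mathcomp Require Import all_classical all_reals all_analysis.
From mathcomp Require Import Rstruct Rstruct_topology.
From mathcomp Require Import ring lra zify.

Set Implicit Arguments.
Unset Strict Implicit.
Unset Printing Implicit Defensive.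

Import Order.TTheory GRing.Theory Num.Theory.
Import numFieldNormedType.Exports.
Local Open Scope classical_set_scope.
Local Open Scope ring_scope.

(** Characters separate the points of a compact group K; this is obtained from
    an invariant mean by running the power method in the convolution algebra of
    even real functions, whose minimal idempotents are the functions
    [e 0 * re (chi x)].  A family of r characters that is independent on a closed
    subgroup maps it onto the torus T^r, and Kuhn's cubical form of Sperner's
    lemma, applied to a grid of small steps lifted from the torus, gives
    r <= dim K.  Hence a maximal family independent on C = c(K) is finite; its
    joint kernel N is totally disconnected because every character of K has a
    multiple in the span of the family on C, so N is a delta-subgroup and (a)
    gives (b).  Adjoining finitely many characters with joint kernel inside a
    given neighbourhood makes N small and keeps N + C open; Euclid's algorithm
    turns the enlarged family into one that is independent on C with the same
    kernel there, which gives (c).  Conversely, T^r has no small subgroups, so a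
    small closed subgroup of K lies in N, respectively in the image of N. *)

(** The mean is defined on all bounded functions, so its existence is the amenability of Abelian
    groups and involves no measure. The price is that it is only finitely additive: two means are
    interchanged only for integrands that are uniformly continuous in one variable. On even real
    functions convolution operators are symmetric, so Cauchy-Schwarz takes the place of complex
    spectral theory. In return, a minimal idempotent yields only the cosine of a character; the sine
    is rebuilt from d'Alembert's functional equation. The dimension hypothesis concerns covers of K
    itself. Cover and grid therefore both live in K, and no comparison of the dimensions of K, its
    subgroups and its quotients enters. This is why an independent family must be shown to be open:
    a small step on the torus has to lift to a small step in K. Characters of the connected group C
    form a torsion-free group, which is what allows Euclid's algorithm to discard a character. In
    (c), lifts through the quotient map are determined only modulo the graph of j, so the absence of
    small subgroups is needed for sequences that are multiples of their first term only modulo a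
    kernel. *)

Local Notation RR := Rdefinitions.R.

(** * Neighbourhoods and compactness in topological groups *)

Section TopologicalGroups.
Variable G : topologicalZmodType.
Implicit Types (U V W D : set G) (x y z : G).

Lemma nbhs_addl x U : nbhs x U -> nbhs 0 [set u | U (x + u)].
Proof.
move=> xU; have := @add_continuous G (x, 0) U.
rewrite /= addr0 => /(_ xU) [[A B] /= [xA zB] AB].
by apply: filterS zB => u Bu; apply: (AB (x, u)); split => //=; exact: nbhs_singleton.
Qed.

Lemma nbhs_subl x U : nbhs 0 U -> nbhs x [set u | U (u - x)].
Proof.
move=> zU; have := @sub_continuous G (x, x) U.
rewrite /= subrr => /(_ zU) [[A B] /= [xA xB] AB].
by apply: filterS xA => u Au; apply: (AB (u, x)); split => //=; exact: nbhs_singleton.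
Qed.

Lemma nbhs_addlE x U : nbhs x U <-> nbhs 0 [set u | U (x + u)].
Proof.
split=> [|/nbhs_subl]; first exact: nbhs_addl.
by move=> /(_ x); apply: filterS => u /=; rewrite subrKC.
Qed.

Lemma translation_continuous y : continuous (fun x => x + y).
Proof.
move=> x; apply: (@continuous_comp _ _ _ (fun x => (x, y)) (fun p : G * G => p.1 + p.2)).
  by apply: (@cvg_pair _ _ _ _ (nbhs _) (nbhs _)); [exact: cvg_id|exact: cvg_cst].
exact: add_continuous.
Qed.

Lemma nbhs0_half U : nbhs 0 U ->
  exists V, [/\ nbhs 0 V, (forall x, V x -> V (- x)),
    (forall x y, V x -> V y -> U (x + y)) & V `<=` U].
Proof.
move=> zU; have := @sub_continuous G (0, 0) U.
rewrite /= subrr => /(_ zU) [[A B] /= [zA zB] AB].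
have zN : nbhs 0 [set x | (A `&` B) (- x)].
  by apply: (@opp_continuous G 0 (A `&` B)); rewrite /= oppr0; exact: filterI.
exists ((A `&` B) `&` [set x | (A `&` B) (- x)]); split.
- by apply: filterI => //; exact: filterI.
- by move=> x [? ?]; split => //=; rewrite opprK.
- move=> x y [[Ax _] _] [_ [_ By]]; rewrite -[y]opprK.
  exact: (AB (x, - y)).
- move=> x [[Ax _] _]; rewrite -[x]subr0; apply: (AB (x, 0)); split => //=.
  exact: nbhs_singleton.
Qed.

(** A Lebesgue number: [y + W] lies in [x + U x] for some nearby [x] in [D], in general not for
    [x = y]. Near-covering compactness is applied with the shrinking neighbourhood [W] itself as
    parameter. *)
Lemma compact_lebesgue D (U : G -> set G) : compact D ->
  (forall x, D x -> nbhs 0 (U x)) ->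
  exists W, nbhs 0 W /\
    forall y, D y -> exists2 x, D x & forall w, W w -> U x (y + w - x).
Proof.
move=> cD DU.
pose F : set_system (set G) :=
  filter_from (nbhs 0) (fun W => [set W' | W' `<=` W]).
have FF : Filter F.
  apply: filter_from_filter; first by exists setT; exact: filterT.
  move=> A B zA zB; exists (A `&` B); first exact: filterI.
  by move=> W WAB; split=> w /WAB[].
pose P (W : set G) (y : G) := exists2 x, D x & forall w, W w -> U x (y + w - x).
have /(_ _ F P FF) := (@compact_near_coveringP _ D).1 cD.
have : forall x, D x -> \forall x' \near x & i \near F, P i x'.
  move=> x Dx; have [V [zV _ VU _]] := nbhs0_half (DU x Dx).
  exists ([set u | V (u - x)], [set W' | W' `<=` V]) => /=.
    by split; [exact: nbhs_subl|exists V].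
  move=> [y W] /= [Vyx WV]; exists x => // w Ww.
  by rewrite addrAC; apply: VU => //; exact: WV.
by move=> h /(_ h) [W zW /(_ W (@subset_refl _ W)) WP]; exists W.
Qed.

Lemma compact_fin_translates D V : compact D -> nbhs 0 V ->
  exists s : seq G, forall x, D x -> exists y, [/\ y \in s, D y & V (x - y)].
Proof.
move=> cD zV.
pose F : set_system (seq G) :=
  filter_from setT (fun s : seq G => [set s' : seq G | {subset s <= s'}]).
have FF : Filter F.
  apply: filter_from_filter; first by exists [::].
  move=> s t _ _; exists (s ++ t) => // u su; split=> x xs; apply: su.
    by rewrite mem_cat xs.
  by rewrite mem_cat xs orbT.
pose P (s : seq G) (x : G) := exists y, [/\ y \in s, D y & V (x - y)].
have /(_ _ F P FF) := (@compact_near_coveringP _ D).1 cD.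
have : forall x, D x -> \forall x' \near x & i \near F, P i x'.
  move=> x Dx; exists ([set u | V (u - x)], [set s' : seq G | {subset [:: x] <= s'}]).
    by split; [exact: nbhs_subl|exists [:: x]].
  by move=> [y s] /= [Vyx sx]; exists x; split => //; apply: sx; rewrite inE.
by move=> h /(_ h) [s _ /(_ s (fun x h => h)) sP]; exists s.
Qed.

End TopologicalGroups.

Lemma compact_fin_cover (T : topologicalType) (I : eqType) (A : set T)
    (O : I -> set T) : compact A ->
  (forall x, A x -> exists i, nbhs x (O i)) ->
  exists s : seq I, forall x, A x -> exists2 i, i \in s & O i x.
Proof.
move=> cA AO.
pose F : set_system (seq I) :=
  filter_from setT (fun s : seq I => [set s' : seq I | {subset s <= s'}]).
have FF : Filter F.
  apply: filter_from_filter; first by exists [::].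
  move=> s t _ _; exists (s ++ t) => // u su; split=> x xs; apply: su.
    by rewrite mem_cat xs.
  by rewrite mem_cat xs orbT.
pose P (s : seq I) (x : T) := exists2 i, i \in s & O i x.
have /(_ _ F P FF) := (@compact_near_coveringP _ A).1 cA.
have : forall x, A x -> \forall x' \near x & i \near F, P i x'.
  move=> x Ax; have [i xO] := AO x Ax.
  exists (O i, [set s' : seq I | {subset [:: i] <= s'}]).
    by split=> //; exists [:: i].
  by move=> [y s] /= [Oy si]; exists i => //; apply: si; rewrite inE.
by move=> h /(_ h) [s _ /(_ s (fun x h => h)) sP]; exists s.
Qed.

(** * Invariant means *)

Definition bounded_fun (T : Type) (R : realType) (f : T -> R) :=
  exists B : R, forall x, `|f x| <= B.

Section BoundedFun.
Variables (T : Type) (R : realType).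
Implicit Types f g : T -> R.

Lemma bounded_cst (c : R) : bounded_fun (fun _ : T => c).
Proof. by exists `|c|. Qed.

Lemma boundedD f g : bounded_fun f -> bounded_fun g ->
  bounded_fun (fun x => f x + g x).
Proof.
move=> [A fA] [B gB]; exists (A + B) => x.
by apply: le_trans (ler_normD _ _) _; apply: lerD.
Qed.

Lemma boundedM f g : bounded_fun f -> bounded_fun g ->
  bounded_fun (fun x => f x * g x).
Proof.
move=> [A fA] [B gB]; exists (A * B) => x.
by rewrite normrM; apply: ler_pM.
Qed.

Lemma boundedZ c f : bounded_fun f -> bounded_fun (fun x => c * f x).
Proof. exact: boundedM (bounded_cst c). Qed.

Lemma bounded_comp (S : Type) (h : S -> T) f :
  bounded_fun f -> bounded_fun (fun x => f (h x)).
Proof. by move=> [A fA]; exists A => x. Qed.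

Lemma bounded_sum (I : Type) (s : seq I) (F : I -> T -> R) :
  (forall i, bounded_fun (F i)) -> bounded_fun (fun x => \sum_(i <- s) F i x).
Proof.
move=> bF; elim: s => [|i s IHs].
  by exists 0 => x; rewrite big_nil normr0.
have [B FB] := boundedD (bF i) IHs.
by exists B => x; rewrite big_cons.
Qed.

End BoundedFun.

(** A total functional whose laws are required on bounded functions only, so that no class of
    measurable functions has to be carried along. *)
Record invariant_mean (G : zmodType) (R : realType) (m : (G -> R) -> R) : Prop :=
  InvariantMean {
    meanD : forall f g, bounded_fun f -> bounded_fun g ->
      m (fun x => f x + g x) = m f + m g ;
    meanZ : forall c f, bounded_fun f -> m (fun x => c * f x) = c * m f ;
    ler_mean : forall f g, bounded_fun f -> bounded_fun g ->
      (forall x, f x <= g x) -> m f <= m g ;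
    mean1 : m (fun _ => 1) = 1 ;
    mean_shift : forall a f, bounded_fun f -> m (fun x => f (x + a)) = m f ;
    mean_opp : forall f, bounded_fun f -> m (fun x => f (- x)) = m f }.

Section Averages.
Variables (G : zmodType) (R : realType).
Implicit Types (f : G -> R) (s : seq G) (M : nat).

(** A Følner average: the mean of [f] over the translates of [x] by the sums of [k_i] times the i-th
    element of [s], each [k_i] running from 0 to [M]. *)
Fixpoint avg s M f : G -> R :=
  if s is g :: s' then
    fun x => M.+1%:R^-1 * \sum_(k < M.+1) avg s' M f (x + g *+ k)
  else f.

Lemma avgD s M f g x :
  avg s M (fun x => f x + g x) x = avg s M f x + avg s M g x.
Proof.
elim: s x => [//|a s IHs] x /=; rewrite -mulrDr -big_split /=.
by congr (_ * _); apply: eq_bigr => k _; exact: IHs.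
Qed.

Lemma avgZ s M c f x : avg s M (fun x => c * f x) x = c * avg s M f x.
Proof.
elim: s x => [//|a s IHs] x /=; rewrite [RHS]mulrCA [in RHS]mulr_sumr.
by congr (_ * _); apply: eq_bigr => k _; exact: IHs.
Qed.

Lemma ler_avg s M f g x : (forall x, f x <= g x) -> avg s M f x <= avg s M g x.
Proof.
move=> fg; elim: s x => [//|a s IHs] x /=.
by rewrite ler_pM2l ?invr_gt0 ?ltr0n//; apply: ler_sum => k _; exact: IHs.
Qed.

Lemma avg_cst s M c x : avg s M (fun _ => c) x = c.
Proof.
elim: s x => [//|a s IHs] x /=; under eq_bigr do rewrite IHs.
by rewrite sumr_const card_ord -[c *+ _]mulr_natl mulrA mulVf ?mul1r// pnatr_eq0.
Qed.

Lemma avg_le s M f B x : (forall x, `|f x| <= B) -> `|avg s M f x| <= B.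
Proof.
move=> fB; rewrite ler_norml -[X in X <= _](avg_cst s M _ x).
rewrite -[X in _ && (_ <= X)](avg_cst s M B x).
by apply/andP; split; apply: ler_avg => y; move: (fB y); rewrite ler_norml => /andP[].
Qed.

Lemma avg_shift s M a f x : avg s M (fun x => f (x + a)) x = avg s M f (x + a).
Proof.
elim: s x => [//|b s IHs] x /=; congr (_ * _); apply: eq_bigr => k _.
by rewrite IHs addrAC.
Qed.

(** In the direction [a] the difference telescopes to two boundary terms, each at most [B];
    averaging in the other directions preserves the bound. *)
Lemma avg_invariant s M f B a x : a \in s -> (forall x, `|f x| <= B) ->
  `|avg s M f (x + a) - avg s M f x| <= 2 * B / M.+1%:R.
Proof.
move=> + fB; elim: s x => [//|b s IHs] x; have M0 : (0 : R) < M.+1%:R by rewrite ltr0n.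
rewrite inE; case: (eqVneq a b) => [<- _|_ /= as_] /=.
  rewrite -mulrBr normrM ger0_norm; last by rewrite invr_ge0 ltW.
  rewrite mulrC.
  rewrite ler_pM2r ?invr_gt0// -sumrB.
  have -> : \sum_(i < M.+1) (avg s M f (x + a + a *+ i) - avg s M f (x + a *+ i))
      = avg s M f (x + a *+ M.+1) - avg s M f x.
    rewrite (eq_bigr (fun i : 'I_M.+1 =>
       avg s M f (x + a *+ i.+1) - avg s M f (x + a *+ i))); last first.
      by move=> i _; rewrite -addrA -mulrS.
    rewrite -(big_mkord xpredT (fun i =>
       avg s M f (x + a *+ i.+1) - avg s M f (x + a *+ i))) telescope_sumr//.
    by rewrite mulr0n addr0.
  apply: le_trans (ler_normB _ _) _; rewrite mulr_natl mulr2n.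
  by apply: lerD; exact: avg_le.
rewrite -mulrBr normrM ger0_norm; last by rewrite invr_ge0 ltW.
rewrite -sumrB ler_pdivrMl//.
apply: le_trans (ler_norm_sum _ _ _) _.
apply: (@le_trans _ _ (\sum_(i < M.+1) 2 * B / M.+1%:R)).
  by apply: ler_sum => i _; rewrite addrAC; exact: IHs.
by rewrite sumr_const card_ord -[_ *+ M.+1]mulr_natl.
Qed.

Lemma invariant_mean_exists : exists m : (G -> R) -> R, invariant_mean m.
Proof.
(* The mean is the limit of the averages along an ultrafilter on which every element eventually
   belongs to the list of directions and the box side tends to infinity. *)
pose base : set_system (seq G * nat) :=
  filter_from setT (fun p : seq G * nat =>
    [set q : seq G * nat | {subset p.1 <= q.1} /\ (p.2 <= q.2)%N]).
have FF : ProperFilter base.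
  apply: filter_from_proper.
    apply: filter_from_filter; first by exists ([::], 0%N).
    move=> [s M] [t N] _ _; exists (s ++ t, maxn M N) => // -[u P] /= [su].
    rewrite geq_max => /andP[MP NP]; split; split=> //= x xs; apply: su.
      by rewrite mem_cat xs.
    by rewrite mem_cat xs orbT.
  by move=> p _; exists p; split=> /=.
have [U [UU bU]] := ultraFilterLemma FF.
pose ev f (p : seq G * nat) := avg p.1 p.2 f 0.
have UT (P : set (seq G * nat)) : (forall p, P p) -> U P.
  by move=> HP; apply: filterS (@filterT _ U _) => p _.
have evc f : bounded_fun f -> cvg (ev f @ U).
  move=> [B fB]; have segc := @segment_compact R (- B) B.
  have [ | l [_ Ul]] := segc (ev f @ U) _.
    apply: (UT (ev f @^-1` `[- B, B])) => p /=.
    by rewrite in_itv /= -ler_norml; exact: avg_le.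
  apply/cvg_ex; exists l => V lV.
  have [//|UnV] := in_ultra_setVsetC (ev f @^-1` V) UU.
  by have [x []] := Ul (~` V) V UnV lV.
pose m f := lim (ev f @ U).
have mD f g : bounded_fun f -> bounded_fun g ->
    m (fun x => f x + g x) = m f + m g.
  move=> bf bg; apply: cvg_lim => //.
  have -> : ev (fun x => f x + g x) = ev f \+ ev g.
    by apply/funext => p; rewrite /ev avgD.
  by apply: cvgD; exact: evc.
have mZ c f : bounded_fun f -> m (fun x => c * f x) = c * m f.
  move=> bf; apply: cvg_lim => //.
  have -> : ev (fun x => c * f x) = (fun p => c * ev f p).
    by apply/funext => p; rewrite /ev avgZ.
  by apply: cvgM; [exact: cvg_cst|exact: evc].
have m_le f g : bounded_fun f -> bounded_fun g ->
    (forall x, f x <= g x) -> m f <= m g.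
  move=> bf bg fg; rewrite -subr_ge0 -mulN1r -mZ// addrC -mD//; last exact: boundedZ.
  apply: limr_ge.
    by apply: evc; apply: boundedD => //; exact: boundedZ.
  apply: UT => p; rewrite /ev -[0](avg_cst p.1 p.2 _ 0); apply: ler_avg => x.
  by rewrite mulN1r addrC subr_ge0.
have m1 : m (fun _ => 1) = 1.
  apply: cvg_lim => //; have -> : ev (fun _ => 1) = fun _ => 1.
    by apply/funext => p; rewrite /ev avg_cst.
  exact: cvg_cst.
have mS a f : bounded_fun f -> m (fun x => f (x + a)) = m f.
  move=> bf; have [B fB] := bf.
  have bfa := bounded_comp (fun x => x + a) bf.
  apply/eqP; rewrite -subr_eq0 -normr_le0; apply/ler_addgt0Pl => e e0; rewrite addr0.
  have mB : m (fun x => f (x + a)) - m f = lim ((ev (fun x => f (x + a)) \- ev f) @ U).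
    by apply/esym/cvg_lim => //; apply: cvgB; exact: evc.
  rewrite mB -lim_norm; last by apply: is_cvgB; exact: evc.
  have B0 : 0 <= B by apply: le_trans (fB 0).
  apply: limr_le; first by apply: is_cvg_norm; apply: is_cvgB; exact: evc.
  pose N := Num.truncn (2 * B / e).
  apply: bU; exists ([:: a], N) => // -[s M] /= [sa NM].
  rewrite /ev /= avg_shift; apply: le_trans (avg_invariant _ _ (a := a) _ fB) _.
    by apply: sa; rewrite inE.
  rewrite ler_pdivrMr ?ltr0n// [e * _]mulrC -ler_pdivrMr//.
  have NM1 : (N.+1%:R : R) <= M.+1%:R by rewrite ler_nat.
  by apply: le_trans NM1; apply: ltW; exact: truncnS_gt.
(* Averaging with the reflected mean adds invariance under negation and keeps invariance under
   translations. *)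
exists (fun f => 2^-1 * (m f + m (fun x => f (- x)))).
have bN f : bounded_fun f -> bounded_fun (fun x => f (- x)).
  exact: bounded_comp.
split.
- by move=> f g bf bg; rewrite !mD//; [ring|exact: bN|exact: bN].
- by move=> c f bf; rewrite !mZ//; [ring|exact: bN].
- move=> f g bf bg fg; rewrite ler_pM2l ?invr_gt0//.
  by apply: lerD; apply: m_le => //; exact: bN.
- by rewrite m1; field.
- move=> a f bf; congr (_ * (_ + _)); first exact: mS.
  rewrite -[RHS](mS (- a)); last exact: bN.
  by congr m; apply/funext => x; rewrite opprD opprK.
- move=> f bf; rewrite addrC; congr (_ * (_ + _)).
  by congr m; apply/funext => x; rewrite opprK.
Qed.

End Averages.

(** * Convolution *)

(** Log-convexity makes the ratios [q n] of consecutive terms increase, submultiplicativity bounds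
    them by [u 0], and [l] is their supremum. From [u k * q k ^+ n.+1 <= u (k + n).+1 <= u k * u n]
    one gets [q k ^+ n.+1 <= u n] for every [k], hence the lower bound on [u n]. *)
Lemma growth_rate (R : realType) (u : nat -> R) :
  (forall n, 0 < u n) -> (forall n m, u (n + m).+1 <= u n * u m) ->
  (forall n, u n.+1 ^+ 2 <= u n * u n.+2) ->
  exists l, [/\ 0 < l, forall n, l ^+ n.+1 <= u n & forall n, u n.+1 <= l * u n].
Proof.
move=> u0 uM uC; pose q n := u n.+1 / u n.
have q0 n : 0 < q n by rewrite divr_gt0.
have qS n : q n <= q n.+1.
  by rewrite /q ler_pdivrMr// mulrAC ler_pdivlMr// -expr2 mulrC.
have qle n k : q n <= q (n + k)%N.
  by elim: k => [|k IHk]; rewrite ?addn0// addnS; exact: le_trans IHk (qS _).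
have qub n : q n <= u 0%N.
  by rewrite /q ler_pdivrMr// mulrC -[n in u n.+1]addn0.
have qhs : has_sup (range q).
  by split; [exists (q 0%N), 0%N|exists (u 0%N) => _ [n _ <-]].
pose l := sup (range q).
have ql n : q n <= l by apply: sup_upper_bound => //; exists n.
have uX n k : u n * q n ^+ k <= u (n + k)%N.
  elim: k => [|k IHk]; first by rewrite mulr1 addn0.
  rewrite addnS exprSr mulrA; apply: (@le_trans _ _ (u (n + k)%N * q n)).
    by rewrite ler_pM2r.
  by rewrite mulrC -ler_pdivlMr//; exact: qle.
exists l; split => [|n|n]; first exact: lt_le_trans (q0 0%N) (ql _).
- have qn k : q k ^+ n.+1 <= u n.
    rewrite -(ler_pM2l (u0 k)); apply: le_trans (uX _ _) _.
    by rewrite addnS.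
  have lcv : (fun x : R => x ^+ n.+1) x @[x --> l] --> l ^+ n.+1.
    exact: exprn_continuous.
  rewrite leNgt; apply/negP => un.
  have /= := lcv _ (lt_nbhsr un).
  rewrite -nbhs_ballE => -[e /= e0 le].
  have [_ [k _ <-] lk] := sup_adherent e0 qhs.
  have : u n < q k ^+ n.+1; last by rewrite ltNge qn.
  by apply: le; rewrite -ball_normE /= ger0_norm ?subr_ge0//; move: lk; rewrite -/l; lra.
- by rewrite -ler_pdivrMr//; exact: ql.
Qed.

Section UniformlyContinuousFunctions.
Variables (G : topologicalZmodType) (R : realType).
Hypothesis cG : compact [set: G].
Implicit Types (f g h : G -> R) (x y a : G).

Definition ucont f := forall e : R, 0 < e ->
  exists U : set G, nbhs 0 U /\ forall x u, U u -> `|f (x + u) - f x| < e.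

Lemma ucont_bounded f : ucont f -> bounded_fun f.
Proof.
move=> /(_ 1 ltr01)[U [zU fU]].
have [s sG] := compact_fin_translates cG zU.
exists (1 + \sum_(y <- s) `|f y|) => x.
have [y [ys _ Uxy]] := sG x Logic.I.
have := fU y _ Uxy; rewrite subrKC => fxy.
rewrite -[f x](subrK (f y)); apply: le_trans (ler_normD _ _) _.
apply: lerD; first exact: ltW.
by rewrite (big_rem y)//= lerDl sumr_ge0.
Qed.

Lemma ucont_continuous f : ucont f -> continuous f.
Proof.
move=> uf x; apply/cvgrPdist_lt => e e0; have [U [zU fU]] := uf e e0.
have := nbhs_subl x zU; apply: filterS => y /= Uyx.
by have := fU x _ Uyx; rewrite subrKC distrC.
Qed.

Lemma continuous_ucont f : continuous f -> ucont f.
Proof.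
move=> cf e e0; have e20 : 0 < e / 2 by rewrite divr_gt0.
have [x _|W [zW WP]] := @compact_lebesgue G [set: G]
    (fun x => [set u | `|f (x + u) - f x| < e / 2]) cG.
  have /cvgrPdist_lt/(_ _ e20) := cf x => /nbhs_addl.
  by apply: filterS => u /=; rewrite distrC.
exists W; split=> // x u Wu; have [y _ yP] := WP x Logic.I.
have := yP u Wu; have := yP 0 (nbhs_singleton zW).
rewrite /= addr0 !subrKC => h1 h2.
have -> : f (x + u) - f x = (f (x + u) - f y) - (f x - f y) by ring.
by apply: le_lt_trans (ler_normB _ _) _; rewrite (splitr e) ltrD.
Qed.

Lemma ucontD f g : ucont f -> ucont g -> ucont (fun x => f x + g x).
Proof.
by move=> uf ug; apply: continuous_ucont => x; apply: cvgD; exact: ucont_continuous.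
Qed.

Lemma ucontM f g : ucont f -> ucont g -> ucont (fun x => f x * g x).
Proof.
by move=> uf ug; apply: continuous_ucont => x; apply: cvgM; exact: ucont_continuous.
Qed.

Lemma ucont_cst (c : R) : ucont (fun _ => c).
Proof. by apply: continuous_ucont => x; exact: cvg_cst. Qed.

Lemma ucontZ c f : ucont f -> ucont (fun x => c * f x).
Proof. exact: ucontM (ucont_cst c). Qed.

Lemma ucont_shift a f : ucont f -> ucont (fun x => f (x + a)).
Proof.
move=> uf e e0; have [U [zU fU]] := uf e e0.
by exists U; split=> // x u Uu; rewrite addrAC; exact: fU.
Qed.

Lemma ucont_unif f : (forall e, 0 < e -> exists g, ucont g /\
  forall x, `|f x - g x| <= e) -> ucont f.
Proof.
move=> fP e e0; have e30 : 0 < e / 3 by rewrite divr_gt0.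
have [g [ug fg]] := fP _ e30; have [U [zU gU]] := ug _ e30.
exists U; split=> // x u Uu.
have -> : f (x + u) - f x =
  (f (x + u) - g (x + u)) + (g (x + u) - g x) - (f x - g x) by ring.
apply: le_lt_trans (ler_normB _ _) _.
have := ler_normD (f (x + u) - g (x + u)) (g (x + u) - g x).
have := fg (x + u); have := fg x; have := gU x u Uu; lra.
Qed.

End UniformlyContinuousFunctions.

Section Convolution.
Variables (G : topologicalZmodType) (R : realType).
Hypothesis cG : compact [set: G].
Variables (m : (G -> R) -> R) (mP : invariant_mean m).
Implicit Types (f g h : G -> R) (x y a : G).

Lemma mean_cst c : m (fun _ => c) = c.
Proof.
rewrite -[RHS]mulr1 -[X in _ = c * X](mean1 mP) -(meanZ mP); last exact: bounded_cst.
by congr m; apply/funext => x; rewrite mulr1.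
Qed.

Lemma meanB f g : bounded_fun f -> bounded_fun g ->
  m (fun x => f x - g x) = m f - m g.
Proof.
move=> bf bg; rewrite -mulN1r -(meanZ mP)// -(meanD mP)//; last exact: boundedZ.
by congr m; apply/funext => x; rewrite mulN1r.
Qed.

Lemma mean_ge0 f : bounded_fun f -> (forall x, 0 <= f x) -> 0 <= m f.
Proof. by move=> bf f0; rewrite -(mean_cst 0) (ler_mean mP)//; exact: bounded_cst. Qed.

Lemma mean_norm_le f B : (forall x, `|f x| <= B) -> `|m f| <= B.
Proof.
move=> fB; have bf : bounded_fun f by exists B.
rewrite ler_norml -[X in X <= _](mean_cst (- B)) -[X in _ && (_ <= X)](mean_cst B).
by apply/andP; split; apply: (ler_mean mP) => //; try exact: bounded_cst;
  move=> x; move: (fB x); rewrite ler_norml => /andP[].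
Qed.

Lemma mean_sum (I : Type) (s : seq I) (F : I -> G -> R) :
  (forall i, bounded_fun (F i)) ->
  m (fun x => \sum_(i <- s) F i x) = \sum_(i <- s) m (F i).
Proof.
move=> bF; elim: s => [|i s IHs].
  rewrite big_nil -[RHS]mean_cst; congr m; apply/funext => x; exact: big_nil.
rewrite big_cons -IHs -(meanD mP)//; last exact: bounded_sum.
by congr m; apply/funext => x; rewrite big_cons.
Qed.

Lemma mean_refl x f : bounded_fun f -> m (fun y => f (x - y)) = m f.
Proof.
move=> bf; rewrite -(mean_shift mP x bf).
rewrite -[RHS](mean_opp mP (bounded_comp (fun y => y + x) bf)).
by congr m; apply/funext => y; rewrite addrC.
Qed.

(** By compactness finitely many translates of [f] have a sum that is at least [f x / 2] everywhere,
    and each of them has the same mean as [f]. *)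
Lemma mean_gt0 f x : ucont f -> (forall y, 0 <= f y) -> f x != 0 -> 0 < m f.
Proof.
move=> uf f0 fx; have bf := ucont_bounded cG uf.
have fx0 : 0 < f x by rewrite lt0r fx f0.
have fx20 : 0 < f x / 2 by rewrite divr_gt0.
have [U [zU fU]] := uf _ fx20.
have [s sG] := compact_fin_translates cG zU.
have : f x / 2 <= (size s)%:R * m f.
  have -> : (size s)%:R * m f = m (fun y => \sum_(z <- s) f (y + (x - z))).
    rewrite mean_sum; last by move=> z; exact: bounded_comp.
    under eq_bigr do rewrite (mean_shift mP _ bf).
    by rewrite big_const_seq count_predT iter_addr_0 mulr_natl.
  rewrite -[X in X <= _]mean_cst; apply: (ler_mean mP).
  - exact: bounded_cst.
  - by apply: bounded_sum => z; exact: bounded_comp.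
  - move=> y; have [z [zs _ Uyz]] := sG y Logic.I.
    rewrite (big_rem z)//= -[X in X <= _]addr0; apply: lerD; last exact: sumr_ge0.
    have := fU x _ Uyz; rewrite addrCA => /ltW.
    rewrite ler_norml => /andP[+ _]; lra.
move=> fm; rewrite lt0r mean_ge0// andbT; apply/eqP => mf0.
by move: fm; rewrite mf0 mulr0 leNgt fx20.
Qed.

Lemma mean_CS f g : bounded_fun f -> bounded_fun g ->
  m (fun x => f x * g x) ^+ 2 <= m (fun x => f x ^+ 2) * m (fun x => g x ^+ 2).
Proof.
move=> bf bg; have bf2 := boundedM bf bf; have bg2 := boundedM bg bg.
have bfg := boundedM bf bg.
have exp2 k : (fun x => k x ^+ 2) = (fun x => k x * k x) :> (G -> R).
  by apply/funext => x; rewrite expr2.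
rewrite !exp2.
set a := m (fun x => f x * f x); set b := m (fun x => g x * g x).
set c := m _; have quad s t : 0 <= s ^+ 2 * a + 2 * s * t * c + t ^+ 2 * b.
  have -> : s ^+ 2 * a + 2 * s * t * c + t ^+ 2 * b =
      m (fun x => (s * f x + t * g x) ^+ 2).
    rewrite -!(meanZ mP)// -!(meanD mP)//; do ?[exact: boundedZ|apply: boundedD].
    by congr m; apply/funext => x; ring.
  apply: mean_ge0 => [|x]; last exact: sqr_ge0.
  by rewrite exp2; apply: boundedM; apply: boundedD; exact: boundedZ.
have a0 : 0 <= a by have := quad 1 0; lra.
have [a00|an0] := eqVneq a 0.
  (* For [a = 0] the form is linear in [s]; at [s = - (b + 1) / 2], [t = c] it equals [- c ^+ 2],
     which forces [c = 0]. *)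
  have := quad (- (b + 1)) c; have := quad (- (b + 1) / 2 ) c.
  rewrite a00 mul0r; nra.
have := quad c (- a).
have -> : c ^+ 2 * a + 2 * c * - a * c + (- a) ^+ 2 * b = a * (a * b - c ^+ 2) by ring.
by rewrite pmulr_rge0 ?subr_ge0// lt0r an0.
Qed.

(* Replacing the first variable by its class in a finite partition into small
   sets turns the iterated means into finite sums, which commute. *)
Lemma mean_fubini (F : G -> G -> R) B : (forall y z, `|F y z| <= B) ->
  (forall e : R, 0 < e -> exists U : set G, nbhs 0 U /\
     forall y u z, U u -> `|F (y + u) z - F y z| <= e) ->
  m (fun y => m (F y)) = m (fun z => m (F ^~ z)).
Proof.
move=> FB uF; apply/eqP; rewrite -subr_eq0 -normr_le0.
apply/ler_addgt0Pl => e e0; rewrite addr0.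
have e20 : 0 < e / 2 by rewrite divr_gt0.
have [U [zU FU]] := uF _ e20.
have [s sG] := compact_fin_translates cG zU.
have /choice[r rP] : forall y, exists z, z \in s /\ U (y - z).
  by move=> y; have [z [zs _ Uyz]] := sG y Logic.I; exists z.
pose d (x y : G) : R := (x == r y)%:R.
have bd x : bounded_fun (d x) by exists 1 => y; rewrite /d; case: eqP; rewrite ?normr1 ?normr0.
pose F' y z := F (r y) z.
have FF' y z : `|F y z - F' y z| <= e / 2.
  by have [_ Uyr] := rP y; have := FU (r y) _ z Uyr; rewrite subrKC.
have F'E y z : F' y z = \sum_(x <- undup s) F x z * d x y.
  rewrite (bigD1_seq (r y)) ?undup_uniq ?mem_undup ?(rP y).1//=.
  rewrite /d eqxx mulr1 big1 ?addr0// => x /negbTE xr; by rewrite xr mulr0.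
have bF y : bounded_fun (F y) by exists B.
have bFz z : bounded_fun (F ^~ z) by exists B.
have bm1 : bounded_fun (fun y => m (F y)) by exists B => y; exact: mean_norm_le.
have bm2 : bounded_fun (fun z => m (F ^~ z)) by exists B => y; exact: mean_norm_le.
have bF' y : bounded_fun (F' y) by exists B => z; exact: FB.
have bF'z z : bounded_fun (F' ^~ z) by exists B => y; exact: FB.
have bm1' : bounded_fun (fun y => m (F' y)).
  by exists B => y; apply: mean_norm_le => z; exact: FB.
have bm2' : bounded_fun (fun z => m (F' ^~ z)).
  by exists B => y; apply: mean_norm_le => z; exact: FB.
have E : m (fun y => m (F' y)) = m (fun z => m (F' ^~ z)).
  transitivity (\sum_(x <- undup s) m (F x) * m (d x)).
    transitivity (m (fun y => \sum_(x <- undup s) m (F x) * d x y)).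
      congr m; apply/funext => y.
      under eq_bigr do rewrite mulrC -(meanZ mP)//.
      rewrite -mean_sum; last by move=> x; exact: boundedZ.
      congr m; apply/funext => z; rewrite F'E.
      by apply: eq_bigr => x _; rewrite mulrC.
    by rewrite mean_sum => [|x]; [under eq_bigr do rewrite (meanZ mP)//|exact: boundedZ].
  transitivity (m (fun z => \sum_(x <- undup s) m (d x) * F x z)); last first.
    congr m; apply/funext => z.
    under eq_bigr do rewrite mulrC -(meanZ mP)//.
    rewrite -mean_sum; last by move=> x; exact: boundedZ.
    by congr m; apply/funext => y; rewrite F'E.
  rewrite mean_sum => [|x]; last exact: boundedZ.
  by apply: eq_bigr => x _; rewrite (meanZ mP)// mulrC.
have -> : m (fun y => m (F y)) - m (fun z => m (F ^~ z)) =
  m (fun y => m (fun z => F y z - F' y z)) - m (fun z => m (fun y => F y z - F' y z)).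
  under [in RHS]eq_fun do rewrite meanB//.
  under [X in _ = _ - m X]eq_fun do rewrite meanB//.
  rewrite !meanB// E; ring.
apply: le_trans (ler_normB _ _) _; rewrite (splitr e).
by apply: lerD; apply: mean_norm_le => y; apply: mean_norm_le => z.
Qed.

Definition conv f g x : R := m (fun y => f y * g (x - y)).

(** Evenness makes the value of a convolution at 0 an inner product ([conv0]), so that convolution
    by an even function is a symmetric operator. *)
Definition even_ucont f := ucont f /\ forall x, f (- x) = f x.

Lemma conv_norm_le f g A B x : (forall y, `|f y| <= A) -> (forall y, `|g y| <= B) ->
  `|conv f g x| <= A * B.
Proof.
by move=> fA gB; apply: mean_norm_le => y; rewrite normrM; apply: ler_pM.
Qed.

Lemma convC f g : bounded_fun f -> bounded_fun g -> conv f g = conv g f.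
Proof.
move=> bf bg; apply/funext => x; rewrite /conv -[LHS](mean_refl x).
  by congr m; apply/funext => y; rewrite subKr mulrC.
by apply: boundedM => //; exact: bounded_comp.
Qed.

Lemma convDr f g h : bounded_fun f -> bounded_fun g -> bounded_fun h ->
  conv f (fun x => g x + h x) = fun x => conv f g x + conv f h x.
Proof.
move=> bf bg bh; apply/funext => x; rewrite /conv -(meanD mP).
- by congr m; apply/funext => y; rewrite mulrDr.
- by apply: boundedM => //; exact: bounded_comp.
- by apply: boundedM => //; exact: bounded_comp.
Qed.

Lemma convZr c f g : bounded_fun f -> bounded_fun g ->
  conv f (fun x => c * g x) = fun x => c * conv f g x.
Proof.
move=> bf bg; apply/funext => x; rewrite /conv -(meanZ mP).
  by congr m; apply/funext => y; rewrite mulrCA.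
by apply: boundedM => //; exact: bounded_comp.
Qed.

Lemma conv_shift f g a : conv f (fun x => g (x + a)) = fun x => conv f g (x + a).
Proof.
by apply/funext => x; rewrite /conv; congr m; apply/funext => y; rewrite addrAC.
Qed.

Lemma conv_ucont f g : ucont f -> ucont g -> ucont (conv f g).
Proof.
move=> uf ug; have bf := ucont_bounded cG uf; have bg := ucont_bounded cG ug.
have [B fB] := bf.
have B0 : 0 <= B by apply: le_trans (fB 0).
move=> e e0; have eB0 : 0 < e / (B + 1) by rewrite divr_gt0// ltr_wpDl.
have [U [zU gU]] := ug _ eB0; exists U; split=> // x u Uu.
rewrite /conv -meanB; try by apply: boundedM => //; exact: bounded_comp.
apply: (@le_lt_trans _ _ (B * (e / (B + 1)))).
  apply: mean_norm_le => y; rewrite -mulrBr normrM; apply: ler_pM => //.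
  by rewrite addrAC ltW// gU.
rewrite mulrA ltr_pdivrMr ?ltr_wpDl//; nra.
Qed.

Lemma conv_even f g : even_ucont f -> even_ucont g -> even_ucont (conv f g).
Proof.
move=> [uf ef] [ug eg]; split; first exact: conv_ucont.
move=> x; rewrite /conv -(mean_opp mP).
  by congr m; apply/funext => y; rewrite ef -eg opprB opprK addrC.
by apply: boundedM; [|apply: bounded_comp]; exact: ucont_bounded.
Qed.

Lemma convA f g h : ucont f -> ucont g -> ucont h ->
  conv f (conv g h) = conv (conv f g) h.
Proof.
move=> uf ug uh; apply/funext => x.
have [A fA] := ucont_bounded cG uf; have [B gB] := ucont_bounded cG ug.
have [C hC] := ucont_bounded cG uh.
have bf : bounded_fun f by exists A.
have bg : bounded_fun g by exists B.
have bh : bounded_fun h by exists C.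
pose F y z := f y * g (z - y) * h (x - z).
have [A0 B0 C0] : [/\ 0 <= A, 0 <= B & 0 <= C].
  by split; [apply: le_trans (fA 0)|apply: le_trans (gB 0)|apply: le_trans (hC 0)].
transitivity (m (fun y => m (F y))).
  rewrite /conv; congr m; apply/funext => y.
  rewrite -(mean_shift mP (- y)); last by apply: boundedM => //; exact: bounded_comp.
  rewrite -(meanZ mP); last by apply: boundedM; exact: bounded_comp.
  by congr m; apply/funext => z; rewrite mulrA opprB addrA subrK.
rewrite (@mean_fubini _ (A * B * C)).
- rewrite /conv; congr m; apply/funext => z.
  rewrite mulrC -(meanZ mP); last by apply: boundedM => //; exact: bounded_comp.
  by congr m; apply/funext => y; rewrite mulrC.
- by move=> y z; rewrite !normrM; apply: ler_pM => //; apply: ler_pM.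
- move=> e e0; pose K := (A + B) * C + 1.
  have K0 : 0 < K by rewrite ltr_wpDl// mulr_ge0// addr_ge0.
  have eK0 : 0 < e / K by rewrite divr_gt0.
  have [U [zU fU]] := uf _ eK0; have [V [zV gV]] := ug _ eK0.
  have [W [zW WN _ WV]] := nbhs0_half zV.
  exists (U `&` W); split; first exact: filterI.
  move=> y u z [Uu Wu]; rewrite /F -mulrBl normrM.
  have fu := ltW (fU y u Uu); have gu := ltW (gV (z - y) _ (WV _ (WN _ Wu))).
  have -> : f (y + u) * g (z - (y + u)) - f y * g (z - y) =
     (f (y + u) - f y) * g (z - y - u) + f y * (g (z - y - u) - g (z - y)).
    by rewrite opprD addrA; ring.
  apply: (@le_trans _ _ ((e / K * B + A * (e / K)) * C)).
    apply: ler_pM => //; apply: le_trans (ler_normD _ _) _.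
    by rewrite !normrM; apply: lerD; apply: ler_pM.
  have -> : (e / K * B + A * (e / K)) * C = e * ((A + B) * C) / K by ring.
  by rewrite ler_pdivrMr// ler_pM2l// lerDl.
Qed.

Lemma conv0 f g : (forall x, g (- x) = g x) -> conv f g 0 = m (fun y => f y * g y).
Proof.
by move=> eg; rewrite /conv; congr m; apply/funext => y; rewrite sub0r eg.
Qed.

Lemma conv_CS f g x : bounded_fun f -> bounded_fun g ->
  conv f g x ^+ 2 <= m (fun y => f y ^+ 2) * m (fun y => g y ^+ 2).
Proof.
move=> bf bg; rewrite -[m (fun y => g y ^+ 2)](mean_refl x).
  by apply: mean_CS => //; exact: bounded_comp.
by under eq_fun do rewrite expr2; exact: boundedM.
Qed.

End Convolution.

(** * Power method and minimal idempotents *)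

Lemma uniform_cauchy_limit (R : realType) (T : Type) (F : nat -> T -> R) :
  (forall e : R, 0 < e -> exists N : nat, forall n k (x : T), (N <= n)%N -> (N <= k)%N ->
     `|F n x - F k x| <= e) ->
  exists f : T -> R, forall e : R, 0 < e ->
    exists N : nat, forall n (x : T), (N <= n)%N -> `|F n x - f x| <= e.
Proof.
move=> FC.
have cF x : cvg (F n x @[n --> \oo]).
  apply/cauchy_cvgP/cauchy_exP => e e0.
  have e20 : 0 < e / 2 by rewrite divr_gt0.
  have [N NP] := FC _ e20.
  exists (F N x); exists N => // n /= Nn; rewrite -ball_normE /=.
  apply: le_lt_trans (NP N n x (leqnn _) Nn) _.
  by rewrite ltr_pdivrMr// ltr_pMr// ltr1n.
exists (fun x => lim (F n x @[n --> \oo])) => e e0; have [N NP] := FC e e0.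
exists N => n x Nn; apply/ler_addgt0Pl => d d0.
have /cvgrPdist_lt/(_ _ d0)[M _ MP] := cF x.
have := MP (maxn M N) (leq_maxl _ _); have := NP n (maxn M N) x Nn (leq_maxr _ _).
set l := lim _ => h1 h2.
have -> : F n x - l = (F n x - F (maxn M N) x) - (l - F (maxn M N) x) by ring.
by apply: le_trans (ler_normB _ _) _; rewrite addrC; apply: lerD => //; exact: ltW.
Qed.

Section PeterWeyl.
Variables (G : topologicalZmodType) (R : realType).
Hypothesis cG : compact [set: G].
Variables (m : (G -> R) -> R) (mP : invariant_mean m).
Implicit Types (f g h e : G -> R) (x y a : G).
Local Notation "f ** g" := (conv m f g) (at level 40, left associativity).

Let bu f : ucont f -> bounded_fun f := ucont_bounded cG (f := f).

Lemma even_ucontZ c f : even_ucont f -> even_ucont (fun x => c * f x).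
Proof. by move=> [uf ef]; split=> [|x]; [exact: ucontZ|rewrite ef]. Qed.

Lemma even_ucontD f g : even_ucont f -> even_ucont g ->
  even_ucont (fun x => f x + g x).
Proof. by move=> [uf ef] [ug eg]; split=> [|x]; [exact: ucontD|rewrite ef eg]. Qed.

(** Exponents are shifted by one, [cpow g n] being the (n+1)-st power: the convolution algebra need
    not have a unit to start from. *)
Fixpoint cpow g n : G -> R := if n is n'.+1 then g ** cpow g n' else g.

Lemma cpow_even g n : even_ucont g -> even_ucont (cpow g n).
Proof. by move=> gg; elim: n => [//|n IHn] /=; exact: conv_even. Qed.

Lemma cpowD g n k : ucont g -> cpow g n ** cpow g k = cpow g (n + k).+1.
Proof.
move=> ug; have up j : ucont (cpow g j) by elim: j => [//|j IHj] /=; exact: conv_ucont.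
by elim: n => [//|n IHn]; rewrite addSn /= -convA// IHn.
Qed.

Section PowerMethod.
Variable g : G -> R.
Hypotheses (gg : even_ucont g) (g0 : exists x, g x != 0).

Local Notation P := (cpow g).
Let Pe n : even_ucont (P n) := cpow_even n gg.
Let Pu n : ucont (P n) := (Pe n).1.
Let u n := P n.*2.+1 0.

Let inner i j : m (fun x => P i x * P j x) = P (i + j).+1 0.
Proof. by rewrite -(conv0 m (P i) (Pe j).2) cpowD//; exact: gg.1. Qed.

Let uE n : u n = m (fun x => P n x ^+ 2).
Proof. by under eq_fun do rewrite expr2; rewrite inner addnn. Qed.

(** An even power is the convolution square of [P n], so Cauchy-Schwarz bounds it by the squared
    norm of [P n]. *)
Let P_sup n x : `|P n.*2.+1 x| <= u n.
Proof.
have un0 : 0 <= u n.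
  by rewrite uE mean_ge0//; [under eq_fun do rewrite expr2; apply: boundedM; exact: bu|
    move=> y; exact: sqr_ge0].
rewrite -ler_sqr ?nnegrE// -normrX ger0_norm ?sqr_ge0//.
rewrite -addnn -cpowD; last exact: gg.1.
by apply: le_trans (conv_CS mP _ (bu (Pu n)) (bu (Pu n))) _; rewrite -uE expr2.
Qed.

Let CSu i j k : (i + j = k.*2)%N -> u k ^+ 2 <= u i * u j.
Proof.
move=> ijk; rewrite (uE i) (uE j).
have <- : m (fun x => P i x * P j x) = u k by rewrite inner ijk.
by apply: (mean_CS mP); exact: bu.
Qed.

(** A symmetric operator is not nilpotent: if [P n.+1] vanishes, then so does the squared norm of
    [P n], which is also the inner product of [P n.+1] and [P n.-1]. For [n = 0] that norm is
    [P 1 0] itself. *)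
Let P0 n : exists x, P n x != 0.
Proof.
have cont_pos f : ucont f -> (exists x, f x != 0) -> 0 < m (fun x => f x ^+ 2).
  move=> uf [x fx]; apply: (mean_gt0 cG mP (x := x)).
  - by under eq_fun do rewrite expr2; exact: ucontM.
  - by move=> y; exact: sqr_ge0.
  - by rewrite sqrf_eq0.
have odd_pow k : (exists x, P k x != 0) -> u k != 0.
  by move=> /(cont_pos _ (Pu k)); rewrite -uE => /lt0r_neq0.
elim: n {-2}n (leqnn n) => [[|//]//|n IHn] k; rewrite leq_eqVlt => /predU1P[->|/IHn//].
apply: contrapT => /forallNP Pz.
have z x : P n.+1 x = 0 by apply/eqP; rewrite -[_ == 0]negbK; apply/negP/Pz.
have [x Px] := IHn n (leqnn n); have := odd_pow n (ex_intro _ x Px); apply/negP/negPn/eqP.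
have [n0|n0] := posnP n.
  by move: z; rewrite /u n0 /= => z; exact: z.
rewrite uE.
have -> : (fun x => P n x ^+ 2) = (fun x => P n x * P n x) by apply/funext => y; rewrite expr2.
rewrite inner (_ : (n + n = n.+1 + n.-1)%N); last by rewrite addSn -addnS prednK.
rewrite -inner.
rewrite (_ : (fun x => _) = fun _ => 0); first exact: mean_cst.
by apply/funext => y; rewrite z mul0r.
Qed.

Let u_gt0 n : 0 < u n.
Proof.
rewrite uE; have [x Px] := P0 n; apply: (mean_gt0 cG mP (x := x)).
- by under eq_fun do rewrite expr2; exact: ucontM.
- by move=> y; exact: sqr_ge0.
- by rewrite sqrf_eq0.
Qed.

Let uM n k : u (n + k).+1 <= u n * u k.
Proof.
have -> : u (n + k).+1 = m (fun x => P n.*2.+1 x * P k.*2.+1 x).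
  by rewrite inner /u doubleS doubleD addSn addnS.
apply: le_trans (ler_norm _) _; apply: (mean_norm_le mP) => x.
by rewrite normrM; apply: ler_pM => //; exact: P_sup.
Qed.

(* With [u n] the squared L2-norm of the (n+1)-st power of [g], which is
   submultiplicative and log-convex, [h] is the limit of [(g ** g)^n / l^n]. *)
Lemma power_method : exists h (l : R), [/\ 0 < l, even_ucont h, 1 <= h 0,
  h ** h = h & g ** g ** h = fun x => l * h x].
Proof.
have [l [l0 lu ul]] := growth_rate u_gt0 uM (fun n => CSu (i := n) (j := n.+2) (k := n.+1)
  ltac:(by rewrite !addnS doubleS addnn)).
(* All inner products of the normalised powers [H n], [H k] have the form [d (n + k).+1]. As [d]
   decreases and stays above 1, they converge to a common limit [D], and so [H] is Cauchy in the
   L2-norm. *)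
pose d n := u n / l ^+ n.+1.
have lX n : 0 < l ^+ n by rewrite exprn_gt0.
have d1 n : 1 <= d n by rewrite ler_pdivlMr// mul1r.
have dS n : d n.+1 <= d n.
  by rewrite /d ler_pdivrMr// [l ^+ n.+2]exprS mulrCA mulrA [l * _]mulrA mulfVK ?ul// lt0r_neq0.
have dle n k : (n <= k)%N -> d k <= d n.
  by move=> /subnK <-; elim: (k - n)%N => [//|j IHj]; rewrite addSn; exact: le_trans (dS _) IHj.
have dhi : has_inf (range d).
  by split; [exists (d 0%N), 0%N|exists 1 => _ [n _ <-]].
pose D := inf (range d).
have Dd n : D <= d n by apply: ge_inf; [exact: dhi.2|exists n].
have dD (e : R) : 0 < e -> exists N, forall n, (N <= n)%N -> d n <= D + e.
  move=> e0; have [_ [N _ <-] dN] := inf_adherent e0 dhi.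
  by exists N => n Nn; apply: le_trans (dle _ _ Nn) (ltW dN).
pose H n x := (l ^+ n.+1)^-1 * P n.*2.+1 x.
have He n : even_ucont (H n) by exact: even_ucontZ.
have bH n : bounded_fun (H n) by apply: bu; exact: (He n).1.
have HH n k : H n ** H k = H (n + k).+1.
  have bP j : bounded_fun (P j) by exact: bu.
  have -> : H n ** H k = fun x => (l ^+ k.+1)^-1 * (H n ** P k.*2.+1) x by exact: convZr.
  rewrite (convC mP)//.
  have -> : P k.*2.+1 ** H n = fun x => (l ^+ n.+1)^-1 * (P k.*2.+1 ** P n.*2.+1) x.
    exact: convZr.
  rewrite cpowD; last exact: gg.1.
  have -> : (k.*2.+1 + n.*2.+1).+1 = (n + k).+1.*2.+1.
    by rewrite doubleS doubleD addSn addnS addnC.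
  apply/funext => x; rewrite mulrA -invfM -exprD.
  by have -> : (k.+1 + n.+1)%N = (n + k).+2 by rewrite addSn addnS addnC.
have Hinner n k : m (fun x => H n x * H k x) = d (n + k).+1.
  rewrite -(conv0 m (H n) (He k).2) HH /H /d.
  by rewrite mulrC.
have HB n k : m (fun x => (H n x - H k x) ^+ 2) =
    d (n + n).+1 - 2 * d (n + k).+1 + d (k + k).+1.
  have bHH i j : bounded_fun (fun x => H i x * H j x) by exact: boundedM.
  rewrite -!Hinner -mulNr -(meanZ mP)// -(meanD mP)//; last exact: boundedZ.
  rewrite -(meanD mP)//; last by apply: boundedD => //; exact: boundedZ.
  by congr m; apply/funext => x; ring.
(* Convolving with [G2] shifts the sequence by one, up to the factor [l], and by Cauchy-Schwarz it
   turns L2-convergence into uniform convergence. *)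
pose G2 := g ** g.
have G2e : even_ucont G2 by exact: conv_even.
have bG : bounded_fun G2 := bu G2e.1.
have bG2 : bounded_fun (fun x => G2 x ^+ 2).
  by under eq_fun do rewrite expr2; exact: boundedM.
have GH n : G2 ** H n = fun x => l * H n.+1 x.
  have -> : G2 ** H n = fun x => (l ^+ n.+1)^-1 * (G2 ** P n.*2.+1) x.
    by apply: convZr => //; exact: bu.
  rewrite /G2 (_ : g ** g = P 1)// cpowD; last exact: gg.1.
  apply/funext => x; rewrite /H [l ^+ n.+2]exprS invfM mulrA mulrA divff ?lt0r_neq0// mul1r.
  by rewrite doubleS add1n.
have [h hP] : exists h, forall e : R, 0 < e ->
    exists N : nat, forall n x, (N <= n)%N -> `|H n x - h x| <= e.
  apply: uniform_cauchy_limit => e e0.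
  pose A := m (fun x => G2 x ^+ 2).
  have A0 : 0 <= A.
    by apply: (mean_ge0 mP) => // x; exact: sqr_ge0.
  (* Chosen so that [A * (2 * e') <= (l * e) ^+ 2], where [2 * e'] bounds the squared L2-distance of
     two late terms; [A + 1] avoids a zero denominator. *)
  pose e' := (l * e) ^+ 2 / (2 * (A + 1)).
  have A10 : 0 < A + 1 by rewrite ltr_wpDl.
  have e'0 : 0 < e' by rewrite divr_gt0 ?exprn_gt0 ?mulr_gt0.
  have [N NP] := dD _ e'0; exists N.+1 => -[//|n] [//|k] x /ltnSE Nn /ltnSE Nk.
  have cs : (l * (H n.+1 x - H k.+1 x)) ^+ 2 <= (l * e) ^+ 2.
    have -> : l * (H n.+1 x - H k.+1 x) = conv m G2 (fun y => H n y + -1 * H k y) x.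
      rewrite convDr//; last exact: boundedZ.
      by rewrite (convZr mP (-1) bG (bH k)) !GH; ring.
    apply: le_trans (conv_CS mP _ _ _) _.
    - exact: bG.
    - by apply: boundedD => //; exact: boundedZ.
    have -> : (fun y => (H n y + -1 * H k y) ^+ 2) = fun y => (H n y - H k y) ^+ 2.
      by apply/funext => y; rewrite mulN1r.
    rewrite HB -/A.
    have h1 : d (n + n).+1 <= D + e' by apply: NP; rewrite ltnW// ltnS (leq_trans Nn)// leq_addr.
    have h2 : d (k + k).+1 <= D + e' by apply: NP; rewrite ltnW// ltnS (leq_trans Nk)// leq_addr.
    have h3 := Dd (n + k).+1.
    have -> : (l * e) ^+ 2 = (A + 1) * (2 * e') by rewrite /e'; field; rewrite lt0r_neq0.
    apply: le_trans (_ : A * (2 * e') <= _).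
      by apply: ler_wpM2l => //; lra.
    by rewrite [leRHS]mulrDl mul1r lerDl mulr_ge0// ltW.
  have le0 : 0 <= l * e by rewrite mulr_ge0// ltW.
  rewrite -(ler_pM2l l0) -{1}(ger0_norm (ltW l0)) -normrM.
  by rewrite -ler_sqr ?nnegrE// -normrX ger0_norm ?sqr_ge0.
have hu : ucont h.
  apply: ucont_unif => e /hP[N NP]; exists (H N); split; first exact: (He N).1.
  by move=> x; rewrite distrC; exact: NP.
have he : even_ucont h.
  split=> // x; apply/eqP; rewrite -subr_eq0 -normr_le0; apply/ler_addgt0Pl => e e0.
  have e20 : 0 < e / 2 by rewrite divr_gt0.
  have [N NP] := hP _ e20.
  have -> : h (- x) - h x = (H N x - h x) - (H N (- x) - h (- x)).
    by rewrite (He N).2; ring.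
  rewrite addr0 (splitr e); apply: le_trans (ler_normB _ _) _.
  by apply: lerD; exact: NP.
have bh := bu hu.
have eq_lim (a b : R) (F : R) : 0 <= F ->
    (forall e : R, 0 < e -> `|a - b| <= F * e) -> a = b.
  move=> F0 abF; apply/eqP; rewrite -subr_eq0 -normr_le0; apply/ler_addgt0Pl => e e0.
  have F1 : 0 < F + 1 by rewrite ltr_wpDl.
  have eF : 0 < e / (F + 1) by rewrite divr_gt0.
  rewrite addr0; apply: le_trans (abF _ eF) _.
  by rewrite mulrA ler_pdivrMr//; nra.
have conv_lim f : bounded_fun f -> exists2 F : R, 0 <= F & forall e : R, 0 < e ->
    exists N, forall n x, (N <= n)%N -> `|(f ** H n) x - (f ** h) x| <= F * e.
  move=> bf; have [F fF] := bf; have F0 : 0 <= F by apply: le_trans (fF 0).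
  exists F => // e /hP[N NP]; exists N => n x Nn.
  have -> : (f ** H n) x - (f ** h) x = (f ** (fun y => H n y + -1 * h y)) x.
    by rewrite convDr//; [rewrite (convZr mP (-1) bf bh); ring|exact: boundedZ].
  by apply: (conv_norm_le mP) => // y; rewrite mulN1r; exact: NP.
have Hnh n : H n ** h = h.
  apply/funext => x; have [F F0 FP] := conv_lim _ (bH n).
  apply: (eq_lim _ _ (F + 1)); first by rewrite addr_ge0.
  move=> e e0; have [N NP] := FP _ e0; have [N' NP'] := hP _ e0.
  pose k := maxn N N'.
  have h1 := NP k x (leq_maxl _ _).
  have h2 : `|H (n + k).+1 x - h x| <= e.
    by apply: NP'; apply: leq_trans (leq_maxr N N') _; rewrite ltnW// ltnS leq_addl.
  move: h1 h2; rewrite HH => h1 h2.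
  have -> : (H n ** h) x - h x = (H (n + k).+1 x - h x) - (H (n + k).+1 x - (H n ** h) x).
    by ring.
  apply: le_trans (ler_normB _ _) _; rewrite mulrDl mul1r addrC.
  exact: lerD.
exists h, l; split => //.
- apply/ler_addgt0Pl => e /hP[N NP].
  have := NP N 0 (leqnn _); rewrite ler_norml => /andP[_].
  have -> : H N 0 = d N by rewrite /H /d mulrC.
  by have := d1 N; lra.
- apply/funext => x; have [F F0 FP] := conv_lim _ bh.
  apply: (eq_lim _ _ F) => //.
  move=> e /FP[N NP]; have := NP N x (leqnn _).
  by rewrite (convC mP bh (bH N)) Hnh distrC.
- apply/funext => x; have [F F0 FP] := conv_lim _ bG.
  apply: (eq_lim _ _ (F + l)); first by rewrite addr_ge0// ltW.
  move=> e e0; have [N NP] := FP _ e0; have [N' NP'] := hP _ e0.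
  pose k := maxn N N'.
  have h1 := NP k x (leq_maxl _ _).
  have h2 : `|H k.+1 x - h x| <= e.
    by apply: NP'; apply: leq_trans (leq_maxr N N') _.
  move: h1; rewrite GH => h1.
  have -> : (G2 ** h) x - l * h x =
     l * (H k.+1 x - h x) - (l * H k.+1 x - (G2 ** h) x) by ring.
  apply: le_trans (ler_normB _ _) _; rewrite mulrDl addrC.
  by apply: lerD => //; rewrite normrM (ger0_norm (ltW l0)) ler_pM2l.
Qed.

End PowerMethod.

Definition idem e := even_ucont e /\ e ** e = e.

(** Here [e 0] is the squared norm of [e], while Cauchy-Schwarz bounds [e y ^+ 2] by [e 0 ^+ 2];
    taking means gives [e 0 <= e 0 ^+ 2]. *)
Lemma idem_ge1 e : idem e -> (exists x, e x != 0) -> 1 <= e 0.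
Proof.
move=> [[ue ee] ide] [x ex]; have be := bu ue.
have e0E : e 0 = m (fun y => e y ^+ 2).
  by rewrite -[in LHS]ide (conv0 m e ee); congr m; apply/funext => y; rewrite expr2.
have e0 : 0 < e 0.
  rewrite e0E; apply: (mean_gt0 cG mP (x := x)).
  - by under eq_fun do rewrite expr2; exact: ucontM.
  - by move=> y; exact: sqr_ge0.
  - by rewrite sqrf_eq0.
have : e 0 <= e 0 ^+ 2.
  rewrite {1}e0E; apply: le_trans (ler_norm _) _; apply: (mean_norm_le mP) => y.
  rewrite ger0_norm ?sqr_ge0//.
  have : e y ^+ 2 <= e 0 * e 0.
    by rewrite -{1}ide; apply: le_trans (conv_CS mP _ be be) _; rewrite -e0E.
  by rewrite -expr2.
by rewrite expr2 ler_pMl.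
Qed.

Lemma idem_le e x : idem e -> e x ^+ 2 <= e 0 ^+ 2.
Proof.
move=> [[ue ee] ide]; have be := bu ue.
have e0E : e 0 = m (fun y => e y ^+ 2).
  by rewrite -[in LHS]ide (conv0 m e ee); congr m; apply/funext => y; rewrite expr2.
by rewrite -{1}ide; apply: le_trans (conv_CS mP _ be be) _; rewrite -e0E expr2.
Qed.

(* [e 0] is the dimension of the space [e ** C(G)]; it drops by at least one
   along a strict inclusion of idempotents, so minimal idempotents exist. *)
Lemma minimal_idem h : idem h -> 1 <= h 0 -> exists e, [/\ idem e, 1 <= e 0,
  e ** h = e & forall e', idem e' -> e' ** e = e' -> (exists x, e' x != 0) -> e' = e].
Proof.
move=> idh h1.
pose S := [set r : R | exists e, [/\ idem e, 1 <= e 0, e ** h = e & r = e 0]].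
have Si : has_inf S.
  split; first by exists (h 0), h; split => //; exact: idh.2.
  by exists 1 => _ [e [_ e1 _ ->]].
(* The infimum need not be attained: coming within 1 of it suffices, because a different nonzero
   [e'] below [e] leaves the idempotent [e - e'], whose value at 0 is at least 1, and then [e' 0]
   falls below the infimum. *)
have [_ [e [ie e1 eh ->]] eS] := inf_adherent (ltr01 : (0 : R) < 1) Si.
exists e; split => // e' ie' e'e e'0.
have [[ue ee] ide] := ie; have [[ue' ee'] ide'] := ie'.
have e'1 := idem_ge1 ie' e'0.
have be := bu ue; have be' := bu ue'.
have e'S : inf S <= e' 0.
  apply: ge_inf; first exact: Si.2.
  by exists e'; split => //; rewrite -e'e -(convA cG mP)//; [rewrite eh|exact: idh.1.1].
pose k x := e x + -1 * e' x.
have ke : even_ucont k by apply: even_ucontD => //; exact: even_ucontZ.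
have bk := bu ke.1.
have ik : idem k.
  split => //; rewrite /k convDr//; last exact: boundedZ.
  rewrite convZr//.
  rewrite !(convC mP (f := fun x => e x + -1 * e' x))//.
  rewrite !convDr//; try exact: boundedZ.
  rewrite !convZr// (convC mP (f := e) (g := e'))// e'e ide ide'.
  by apply/funext => x; ring.
have [[x kx]|/forallNP kz] := pselect (exists x, k x != 0).
  have k1 := idem_ge1 ik (ex_intro _ x kx).
  have : inf S + 1 <= e 0.
    by apply: le_trans (lerD e'S k1) _; rewrite /k mulN1r subrKC.
  by rewrite leNgt eS.
by apply/funext => x; have /negP := kz x; rewrite negbK /k mulN1r subr_eq0 => /eqP.
Qed.

(** The idempotent that the power method extracts from [g] lies below [e], hence equals [e], and so
    [g ** g = l e]. With [r] the square root of [l], the function [(e - g / r) / 2] is an idempotent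
    below [e]; it is 0 or [e], that is, [g] is [r e] or [- r e]. *)
Lemma minimal_idem_scalar e : idem e -> 1 <= e 0 ->
  (forall e', idem e' -> e' ** e = e' -> (exists x, e' x != 0) -> e' = e) ->
  forall g, even_ucont g -> g ** e = g -> exists c, g = fun x => c * e x.
Proof.
move=> ie e1 emin g gg ge; have [[ue ee] ide] := ie; have be := bu ue; have bg := bu gg.1.
have [g0|/forallNP gz] := pselect (exists x, g x != 0); last first.
  exists 0; apply/funext => x; have /negP := gz x; rewrite negbK => /eqP ->.
  by rewrite mul0r.
have [h [l [l0 he h1 hh gh]]] := power_method gg g0.
have ugg : ucont (g ** g) by apply: conv_ucont => //; exact: gg.1.
have ggE : g ** g ** e = g ** g by rewrite -(convA cG mP)//; [rewrite ge|exact: gg.1|exact: gg.1].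
have bh := bu he.1.
have heE : h = e.
  apply: emin => //; last by exists 0; rewrite gt_eqF// (lt_le_trans _ h1).
  have hE : h = fun x => l^-1 * (g ** g ** h) x.
    by apply/funext => x; rewrite gh mulrA mulVf ?mul1r// gt_eqF.
  rewrite (convC mP)// {1}hE convZr//; last first.
    by apply: bu; apply: conv_ucont => //; exact: he.1.
  rewrite (convA cG mP)//; last exact: he.1.
  by rewrite (convC mP (f := e)) ?ggE -?hE//; exact: bu.
have ggl : g ** g = fun x => l * e x by rewrite -ggE -heE gh.
pose r := Num.sqrt l.
have r0 : 0 < r by rewrite sqrtr_gt0.
have rr : r * r = l by rewrite -expr2 sqr_sqrtr// ltW.
pose k x := 2^-1 * e x + (- (2 * r)^-1) * g x.
have ke : even_ucont k by apply: even_ucontD; exact: even_ucontZ.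
have kE : k ** e = k.
  rewrite (convC mP)//; last exact: bu ke.1.
  rewrite convDr//; try exact: boundedZ.
  by rewrite !convZr// (convC mP (f := e) (g := g))// ge ide.
have ik : idem k.
  split=> //; rewrite {2}/k convDr//; try exact: boundedZ; try exact: bu ke.1.
  rewrite !convZr//; try exact: bu ke.1.
  rewrite kE (convC mP (f := k) (g := g))//; last exact: bu ke.1.
  rewrite convDr//; try exact: boundedZ.
  rewrite !convZr// ge ggl.
  apply/funext => x; rewrite /k -rr; field; rewrite gt_eqF//.
have [kn0|/forallNP kz] := pselect (exists x, k x != 0).
  exists (- r); apply/funext => x.
  have := congr1 (fun f => f x) (emin _ ik kE kn0); rewrite /k => kx.
  have -> : g x = (2 * r) * (2^-1 * e x - (2^-1 * e x + - (2 * r)^-1 * g x)).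
    by field; rewrite gt_eqF.
  by rewrite kx; field.
exists r; apply/funext => x; have /negP := kz x; rewrite negbK /k => /eqP kx.
have -> : g x = (2 * r) * (2^-1 * e x - (2^-1 * e x + - (2 * r)^-1 * g x)).
  by field; rewrite gt_eqF.
by rewrite kx; field.
Qed.

Lemma convB_shift f g a : ucont f -> ucont g ->
  f ** (fun x => g (x + a) + g (x - a)) = fun x => (f ** g) (x + a) + (f ** g) (x - a).
Proof.
move=> uf ug; have bg := bu ug.
rewrite (convDr mP (bu uf) (bounded_comp (fun x => x + a) bg) (bounded_comp (fun x => x - a) bg)).
by rewrite (conv_shift m f g a) (conv_shift m f g (- a)).
Qed.

Lemma even_shift g a : even_ucont g -> even_ucont (fun x => g (x + a) + g (x - a)).
Proof.
move=> [ug eg]; split; first by apply: ucontD => //; exact: ucont_shift.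
by move=> x; rewrite -eg opprD opprK -[g (- x - a)]eg opprD !opprK addrC.
Qed.

(** The symmetrised translate of a minimal idempotent [e] stays in the ideal of [e], so it is a
    multiple of [e]; this is d'Alembert's equation for [c = e / e 0], the future real part of a
    character. *)
Theorem dalembert_separate a : hausdorff_space G -> a != 0 ->
  exists c : G -> R, [/\ continuous c, c 0 = 1, c a != 1, forall x, c x ^+ 2 <= 1 &
    forall x y, c (x + y) + c (x - y) = 2 * c x * c y].
Proof.
move=> hG a0.
have [f [fe f0 fa]] : exists f, [/\ even_ucont f, f 0 = 1 & f a = 0].
  have clA : closed [set a; - a].
    by apply: closedU; apply: accessible_closed_set1; exact: hausdorff_accessible.
  have cl0 : closed [set (0 : G)].
    by apply: accessible_closed_set1; exact: hausdorff_accessible.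
  have nG := compact_normal hG cG.
  have dis : [set a; - a] `&` [set 0] = set0.
    rewrite -subset0 => x [+ /= x0]; rewrite x0 => -[/= e|/= e].
      by move: a0; rewrite -e eqxx.
    by move: a0; rewrite -(opprK a) -e oppr0 eqxx.
  have sep := (@normal_uniform_separator G nG _ _ clA cl0 dis).
  have cv := @Urysohn_continuous G R [set a; - a] [set 0].
  pose v := @Urysohn G R [set a; - a] [set 0].
  have v0 : v 0 = 1 by have := Urysohn_sub1 (R := R) sep; apply; exists 0.
  have va : v a = 0 by have := Urysohn_sub0 (R := R) sep; apply; exists a => //; left.
  have vNa : v (- a) = 0 by have := Urysohn_sub0 (R := R) sep; apply; exists (- a) => //; right.
  exists (fun x => 2^-1 * (v x + v (- x))); split.
  - split; last by move=> x; rewrite opprK addrC.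
    apply: continuous_ucont => // x; apply: cvgM; first exact: cvg_cst.
    apply: cvgD; first exact: cv.
    by apply: (@continuous_comp _ _ _ -%R v); [exact: opp_continuous|exact: cv].
  - by rewrite oppr0 v0; field.
  - by rewrite va vNa addr0 mulr0.
(* This function detects [a]: it equals 1 at 0, but it is annihilated by any [e] whose symmetrised
   translate by [a] is [2 e]. *)
pose g x := f x + (- 2^-1) * (f (x + a) + f (x - a)).
have ge : even_ucont g.
  by apply: even_ucontD => //; apply: even_ucontZ; exact: even_shift.
have bf := bu fe.1; have bg := bu ge.1.
have [|h [l [l0 he h1 hh gh]]] := power_method ge.
  exists 0; rewrite /g add0r sub0r fe.2 fa f0 addr0 mulr0 addr0; exact: oner_neq0.
have [e [ie e1 eh emin]] := minimal_idem (conj he hh) h1.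
have [[ue ee] ide] := ie; have be := bu ue; have bh := bu he.1.
have e0 : e 0 != 0 by rewrite gt_eqF// (lt_le_trans _ e1).
have shiftE x y : e (y + x) + e (y - x) = 2 * (e x / e 0) * e y.
  pose k y := e (y + x) + e (y - x).
  have ke : even_ucont k by exact: even_shift.
  have kE : k ** e = k.
    rewrite (convC mP)//; last exact: bu ke.1.
    by rewrite convB_shift// ide.
  have [c kc] := minimal_idem_scalar ie e1 emin ke kE.
  have k0 : 2 * e x = c * e 0.
    by have := congr1 (fun f => f 0) kc; rewrite /k add0r sub0r ee => <-; ring.
  have := congr1 (fun f => f y) kc; rewrite /k => ->.
  by rewrite mulrA k0 mulfK.
exists (fun x => e x / e 0); split.
- move=> x; apply: cvgM; last exact: cvg_cst.
  exact: ucont_continuous.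
- by rewrite divff.
(* If [c a = 1], then [e ** g = 0], whereas convolving [g ** g ** h = l h] with [e] gives [l e],
   which is not 0. *)
- apply/eqP => ea1.
  have ug := ge.1; have uf := fe.1; have uh := he.1.
  have eg0 : e ** g = fun _ => 0.
    rewrite /g convDr//; last first.
      by apply: boundedZ; apply: boundedD; exact: bounded_comp.
    rewrite convZr//; last by apply: boundedD; exact: bounded_comp.
    rewrite convB_shift// (convC mP be bf).
    have S x : (f ** e) (x + a) + (f ** e) (x - a) = 2 * (f ** e) x.
      have := congr1 (fun f => f x) (convB_shift a uf ue) => /= <-.
      have := congr1 (fun f => f x) (convZr mP 2 bf be) => /= <-.
      by congr conv; apply/funext => y; rewrite shiftE ea1 mulr1.
    by apply/funext => x; rewrite S; field.
  have := congr1 (fun f => conv m e f 0) gh.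
  rewrite convZr// (convA cG mP)//; last by apply: conv_ucont.
  rewrite (convA cG mP)// eg0 eh => /esym.
  have -> : (fun=> 0) ** g ** h = fun _ => 0.
    have z k : (fun _ => 0) ** k = fun _ => 0.
      by apply/funext => x; rewrite /conv; under eq_fun do rewrite mul0r; exact: mean_cst.
    by rewrite !z.
  by move=> /eqP; rewrite mulf_eq0 (negbTE e0) orbF gt_eqF.
- move=> x; rewrite exprMn exprVn ler_pdivrMr ?mul1r; first exact: idem_le.
  by rewrite exprn_gt0// (lt_le_trans _ e1).
- by move=> x y; rewrite -mulrDl shiftE; field.
Qed.

End PeterWeyl.

(** * The circle group *)

(** Only the group structure is attached to this type; continuity of maps into it is always
    expressed through [re], [im] or [cval]. *)
Definition circ := {z : RR * RR | circle z}.

HB.instance Definition _ := gen_eqMixin circ.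
HB.instance Definition _ := gen_choiceMixin circ.

Definition cval (z : circ) : RR * RR := sval z.
Definition re (z : circ) : RR := (cval z).1.
Definition im (z : circ) : RR := (cval z).2.

Lemma circP (z : circ) : re z ^+ 2 + im z ^+ 2 = 1.
Proof. exact: (svalP z). Qed.

Lemma cval_inj : injective cval.
Proof. by move=> [z zP] [w wP] /= zw; apply/eq_exist. Qed.

Lemma circ_eq (z w : circ) : re z = re w -> im z = im w -> z = w.
Proof.
by move=> rzw izw; apply: cval_inj; rewrite [cval z]surjective_pairing
  [cval w]surjective_pairing; congr pair.
Qed.

Lemma cone_circle : circle cone.
Proof. by rewrite /circle /= expr0n expr1n addr0. Qed.

Lemma cmul_circle (z w : circ) : circle (cmul (cval z) (cval w)).
Proof.
have := circP z; have := circP w; rewrite /re /im /circle /=.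
move: (cval z) (cval w) => [a b] [c d] /= h1 h2.
have -> : (a * c - b * d) ^+ 2 + (a * d + b * c) ^+ 2 =
  (a ^+ 2 + b ^+ 2) * (c ^+ 2 + d ^+ 2) by ring.
by rewrite h1 h2 mulr1.
Qed.

Lemma conj_circle (z : circ) : circle (re z, - im z).
Proof. by have := circP z; rewrite /circle /= sqrrN. Qed.

Definition circ0 : circ := exist _ _ cone_circle.
Definition circ_add (z w : circ) : circ := exist _ _ (cmul_circle z w).
Definition circ_opp (z : circ) : circ := exist _ _ (conj_circle z).

Lemma circ_addA : associative circ_add.
Proof. by move=> x y z; apply: circ_eq; rewrite /re /im /=; ring. Qed.

Lemma circ_addC : commutative circ_add.
Proof. by move=> x y; apply: circ_eq; rewrite /re /im /=; ring. Qed.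

Lemma circ_add0 : left_id circ0 circ_add.
Proof. by move=> x; apply: circ_eq; rewrite /re /im /=; ring. Qed.

Lemma circ_addN : left_inverse circ0 circ_opp circ_add.
Proof.
move=> x; have := circP x; rewrite /re /im => xP.
by apply: circ_eq; rewrite /re /im /=; rewrite /re /im; [rewrite -xP|]; ring.
Qed.

HB.instance Definition _ :=
  GRing.isZmodule.Build circ circ_addA circ_addC circ_add0 circ_addN.

Lemma reD (z w : circ) : re (z + w) = re z * re w - im z * im w.
Proof. by []. Qed.

Lemma imD (z w : circ) : im (z + w) = re z * im w + im z * re w.
Proof. by []. Qed.

Lemma re0 : re 0 = 1. Proof. by []. Qed.

Lemma re_le1 (z : circ) : re z <= 1.
Proof. by have := circP z; nra. Qed.

Lemma re1P (z : circ) : re z = 1 -> z = 0.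
Proof.
move=> z1; apply: circ_eq => //; have := circP z.
rewrite z1 expr1n => iz; have /eqP : im z ^+ 2 = 0 by lra.
by rewrite sqrf_eq0 => /eqP.
Qed.

Section Angle.

Lemma angle_circle (t : RR) : circle (cos (pi * 2 * t), sin (pi * 2 * t)).
Proof. exact: cos2Dsin2. Qed.

Definition angle (t : RR) : circ := exist _ _ (angle_circle t).

Lemma angleD s t : angle (s + t) = angle s + angle t.
Proof.
apply: circ_eq; rewrite ?reD ?imD /re /im /= mulrDr; first exact: trigo.cosD.
by rewrite trigo.sinD addrC.
Qed.

Lemma angle0 : angle 0 = 0.
Proof. by apply: circ_eq; rewrite /re /im /= mulr0 ?cos0 ?sin0. Qed.

Lemma angleN t : angle (- t) = - angle t.
Proof. by apply/eqP; rewrite -addr_eq0 -angleD addNr angle0. Qed.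

Lemma angleMn t n : angle (t *+ n) = angle t *+ n.
Proof. by elim: n => [|n IHn]; rewrite ?angle0// !mulrS angleD IHn. Qed.

Lemma angleMz t (k : int) : angle (t *~ k) = angle t *~ k.
Proof. by case: k => n; rewrite ?NegzE ?mulrNz ?angleN -?pmulrn angleMn. Qed.

Lemma angle1 : angle 1 = 0.
Proof.
by apply: circ_eq; rewrite /re /im /= mulr1 mulr_natr ?cos2pi ?sin2pi.
Qed.

Lemma angle_int (k : int) : angle k%:~R = 0.
Proof. by rewrite angleMz angle1 mul0rz. Qed.

Lemma angle_eq0 t : angle t = 0 -> exists k : int, t = k%:~R.
Proof.
move=> at0; exists (Num.floor t); pose s := t - (Num.floor t)%:~R.
have s0 : 0 <= s by rewrite subr_ge0 floor_le_tmp.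
have s1 : s < 1 by rewrite ltrBlDr addrC -intrD1 floorD1_gt.
have as0 : angle s = 0 by rewrite angleD angleN at0 angle_int subr0.
suff : s = 0 by move=> /eqP; rewrite subr_eq0 => /eqP.
apply/eqP; rewrite eq_le s0 andbT leNgt; apply/negP => s_gt0.
have pis : sin (pi * s) > 0.
  by rewrite sin_gt0_pi// mulr_gt0 ?pi_gt0//= gtr_pMr ?pi_gt0.
have := congr1 re as0; rewrite re0 /re /=.
have -> : pi * 2 * s = (pi * s) *+ 2 by rewrite mulrAC mulr_natr.
by rewrite cos_mulr2n cos2sin2; nra.
Qed.

Lemma angle_surj (z : circ) : exists t, [/\ -2^-1 <= t, t <= 2^-1 & z = angle t].
Proof.
have rez : -1 <= re z <= 1 by have := circP z; nra.
pose s := acos (re z); have pi0 := @pi_gt0 RR.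
have cs : cos s = re z by apply: acosK; rewrite in_itv.
have ss : sin s = `|im z|.
  by rewrite sin_acos// -(circP z) addrAC subrr add0r sqrtr_sqr.
have s0 : 0 <= s by exact: acos_ge0.
have spi : s <= pi by exact: acos_lepi.
have pi20 : 0 < pi * 2 :> RR by rewrite mulr_gt0.
have t0 : 0 <= s / (pi * 2) by rewrite divr_ge0// ltW.
have t2 : s / (pi * 2) <= 2^-1.
  by rewrite ler_pdivrMr// mulrCA mulVf ?mulr1.
have tE : pi * 2 * (s / (pi * 2)) = s by rewrite mulrC divfK// gt_eqF.
have [i0|i0] := lerP 0 (im z).
  exists (s / (pi * 2)); split=> //; first lra.
  by apply: circ_eq; rewrite /re /im /= tE ?cs// ss ger0_norm.
exists (- (s / (pi * 2))); split; [lra|lra|].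
apply: circ_eq; rewrite /re /im /= mulrN tE ?cosN ?sinN ?cs//.
by rewrite ss ltr0_norm// opprK.
Qed.

Lemma angle_continuous : continuous (fun t => cval (angle t)).
Proof.
have cm : continuous (fun t : RR => pi * 2 * t).
  by move=> t; apply: cvgM; [exact: cvg_cst|exact: cvg_id].
move=> t; apply: (@cvg_pair _ _ _ _ (nbhs _) (nbhs _)) => /=.
  exact: (continuous_comp (cm t) (@continuous_cos _ _)).
exact: (continuous_comp (cm t) (@continuous_sin _ _)).
Qed.

Lemma re_angle_lt (d t : RR) : 0 < d -> d <= `|t| -> `|t| <= 2^-1 ->
  re (angle t) <= re (angle d).
Proof.
move=> d0 dt t2; have pi0 := @pi_gt0 RR.
have -> : re (angle t) = cos (pi * 2 * `|t|).
  by rewrite /re /= -cos_norm normrM ger0_norm// mulr_ge0// ltW.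
have in_pi (s : RR) : 0 <= s -> s <= 2^-1 -> pi * 2 * s \in `[0, pi].
  move=> s0 s2; rewrite in_itv /= !mulr_ge0 ?(ltW pi0)//=.
  by rewrite -mulrA ler_piMr ?(ltW pi0)//; lra.
rewrite /re /= leNgt ltr_cos ?in_pi//; [|exact: ltW|exact: le_trans t2].
by rewrite -leNgt ler_pM2l ?mulr_gt0.
Qed.

Lemma angle_small (d : RR) : 0 < d -> exists e : RR, 0 < e /\
  forall z, 1 - e < re z -> exists t, `|t| < d /\ z = angle t.
Proof.
wlog d2 : d / d <= 4^-1.
  move=> wl d0; have [||e [e0 eP]] := wl (Num.min d 4^-1).
  - by rewrite ge_min lexx orbT.
  - by rewrite lt_min d0 invr_gt0 ltr0n.
  exists e; split=> // z /eP[t [td ->]]; exists t; split=> //.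
  by apply: lt_le_trans td _; rewrite ge_min lexx.
move=> d0; exists (1 - re (angle d)); split.
  rewrite subr_gt0 lt_neqAle re_le1 andbT; apply/eqP => /re1P/angle_eq0[k dk].
  move: d0 d2; rewrite dk ltr0z => k0 k4.
  have : (k%:~R : RR) < 1%:~R by apply: le_lt_trans k4 _; lra.
  by rewrite ltr_int; move: k0; case: k {dk k4} => // -[].
move=> z; have [t [t1 t2 ->]] := angle_surj z.
rewrite opprB addrC subrK => zt; exists t; split=> //.
rewrite ltNge; apply/negP => dt; move: zt; rewrite ltNge re_angle_lt//.
by rewrite ler_norml t1 t2.
Qed.

(* [1 - re z] at least doubles under [z |-> z *+ 2] as long as [0 <= re z]. *)
Lemma circ_NSS (z : circ) : (forall n, 0 < re (z *+ n)) -> z = 0.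
Proof.
move=> zn; have re2 w : re (w *+ 2) = 2 * re w ^+ 2 - 1.
  by rewrite mulr2n reD; have := circP w; nra.
have key n : 2 ^+ n * (1 - re z) <= 1 - re (z *+ (2 ^ n)%N).
  elim: n => [|n IHn]; first by rewrite expr0 mul1r.
  rewrite expnSr mulrnA re2 exprS -mulrA.
  have := zn (2 ^ n)%N; have := re_le1 (z *+ (2 ^ n)%N); nra.
apply: re1P; apply/eqP; rewrite eq_le re_le1 leNgt; apply/negP => z1.
have z10 : 0 < 1 - re z by rewrite subr_gt0.
pose n := Num.truncn (1 - re z)^-1.
have nP : (1 - re z)^-1 < n.+1%:R by exact: truncnS_gt.
have := key n.+1; rewrite leNgt => /negP; apply.
apply: (@lt_trans _ _ 1); first by rewrite ltrBlDr ltrDl.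
rewrite -ltr_pdivrMr// div1r; apply: lt_trans nP _.
by rewrite -natrX ltr_nat ltn_expl.
Qed.

End Angle.

(** * Characters *)

Section Subgroups.
Variables (G : zmodType) (D : set G).
Hypothesis sD : subgroup D.

Lemma subgroupB x y : D x -> D y -> D (x - y). Proof. exact: sD.2. Qed.

Lemma subgroupN x : D x -> D (- x).
Proof. by move=> Dx; rewrite -sub0r; apply: subgroupB => //; exact: sD.1. Qed.

Lemma subgroupD x y : D x -> D y -> D (x + y).
Proof. by move=> Dx Dy; rewrite -[y]opprK; apply: subgroupB => //; exact: subgroupN. Qed.

Lemma subgroupMn x n : D x -> D (x *+ n).
Proof.
by move=> Dx; elim: n => [|n IHn]; [exact: sD.1|rewrite mulrS; exact: subgroupD].
Qed.

Lemma subgroupMz x (k : int) : D x -> D (x *~ k).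
Proof.
move=> Dx; case: k => n; first by rewrite -pmulrn; exact: subgroupMn.
by rewrite NegzE mulrNz; apply: subgroupN; rewrite -pmulrn; exact: subgroupMn.
Qed.

Lemma subgroup_sum (I : Type) (s : seq I) (F : I -> G) :
  (forall i, D (F i)) -> D (\sum_(i <- s) F i).
Proof.
move=> DF; elim: s => [|i s IHs]; rewrite ?big_nil ?big_cons; first exact: sD.1.
exact: subgroupD.
Qed.

End Subgroups.

Section RealContinuity.
Variables (R : realType) (T : topologicalType).
Implicit Types f g : T -> R.

Lemma continuous_add f g : continuous f -> continuous g ->
  continuous (fun x => f x + g x).
Proof. by move=> cf cg x; apply: cvgD; [exact: cf|exact: cg]. Qed.

Lemma continuous_sub f g : continuous f -> continuous g ->
  continuous (fun x => f x - g x).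
Proof. by move=> cf cg x; apply: cvgB; [exact: cf|exact: cg]. Qed.

Lemma continuous_mul f g : continuous f -> continuous g ->
  continuous (fun x => f x * g x).
Proof. by move=> cf cg x; apply: cvgM; [exact: cf|exact: cg]. Qed.

Lemma continuous_neg f : continuous f -> continuous (fun x => - f x).
Proof. by move=> cf x; apply: cvgN; exact: cf. Qed.

Lemma continuous_near f x (e : R) : continuous f -> 0 < e ->
  nbhs x [set y | `|f y - f x| < e].
Proof.
move=> cf e0; have /cvgrPdist_lt/(_ _ e0) := cf x.
by apply: filterS => y; rewrite distrC.
Qed.

Lemma closed_eq_preimage f (a : R) : continuous f -> closed [set x | f x = a].
Proof.
move=> cf; apply: (@closed_comp _ _ f [set a]) => [x _|]; first exact: cf.
exact: closed_eq.
Qed.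

Lemma closed_le_preimage f (a : R) : continuous f -> closed [set x | f x <= a].
Proof.
move=> cf; apply: (@closed_comp _ _ f [set y | y <= a]) => [x _|]; first exact: cf.
exact: closed_le.
Qed.

Lemma nbhs_real (x : R) (U : set R) : nbhs x U ->
  exists e : R, 0 < e /\ forall y, `|y - x| < e -> U y.
Proof.
rewrite -nbhs_ballE => -[e /= e0 eU]; exists e; split=> // y yx.
by apply: eU; rewrite -ball_normE /= distrC.
Qed.

Lemma inv_natr_small (e : R) : 0 < e -> exists n : nat, n.+1%:R^-1 < e.
Proof.
move=> e0; exists (Num.truncn e^-1); rewrite -[ltRHS]invrK ltf_pV2 ?posrE ?invr_gt0//.
exact: truncnS_gt.
Qed.

End RealContinuity.

Lemma hausdorff_prod (S T : topologicalType) :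
  hausdorff_space S -> hausdorff_space T -> hausdorff_space (S * T)%type.
Proof.
move=> hS hT [p1 p2] [q1 q2] pq; congr pair.
  apply: hS => A B pA qB.
  have [[x y] [/= Ax Bx]] := pq (A `*` setT) (B `*` setT)
    ltac:(by exists (A, setT) => //=; split=> //; exact: filterT)
    ltac:(by exists (B, setT) => //=; split=> //; exact: filterT).
  by exists x; split; [exact: Ax.1|exact: Bx.1].
apply: hT => A B pA qB.
have [[x y] [/= Ax Bx]] := pq (setT `*` A) (setT `*` B)
  ltac:(by exists (setT, A) => //=; split=> //; exact: filterT)
  ltac:(by exists (setT, B) => //=; split=> //; exact: filterT).
by exists y; split; [exact: Ax.2|exact: Bx.2].
Qed.

(** Let [d] be the infimum of the positive elements. If [d = 0], their multiples are dense;
    otherwise division with remainder shows that [d] generates [P], and [1] being a multiple of [d]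
    makes [d] the inverse of an integer. *)
Lemma closed_subgroup_R (R : realType) (P : set R) : closed P -> subgroup P -> P 1 ->
  P = setT \/ exists q : nat, [/\ (0 < q)%N, P q%:R^-1 &
    forall t, P t -> exists k : int, t = k%:~R / q%:R].
Proof.
move=> clP sP P1.
have PMz t (k : int) : P t -> P (k%:~R * t) by rewrite mulrzl; exact: subgroupMz.
have modP t d : 0 < d -> P d ->
    [/\ 0 <= t - (Num.floor (t / d))%:~R * d, t - (Num.floor (t / d))%:~R * d < d &
        P t -> P (t - (Num.floor (t / d))%:~R * d)].
  move=> d0 Pd; split.
  - by rewrite subr_ge0 -ler_pdivlMr// floor_le_tmp.
  - rewrite ltrBlDr -[X in X + _]mul1r -mulrDl -ltr_pdivrMr// addrC -intrD1.
    exact: floorD1_gt.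
  - by move=> Pt; apply: subgroupB => //; exact: PMz.
pose S := [set t | 0 < t /\ P t].
have Si : has_inf S by split; [exists 1; split|exists 0 => t [/ltW]].
pose d := inf S.
have d0 : 0 <= d by apply: lb_le_inf; [exact: Si.1|move=> t [/ltW]].
have [dz|dn0] := eqVneq d 0; [left|right].
  apply/seteqP; split=> // t _; apply: clP => V.
  rewrite -nbhs_ballE => -[e /= e0 eV].
  have [s [s0 Ps] se] := inf_adherent e0 Si.
  have [h1 h2 _] := modP t s s0 Ps.
  exists ((Num.floor (t / s))%:~R * s); split; first exact: PMz.
  apply: eV; rewrite -ball_normE /= ger0_norm//.
  by apply: lt_trans h2 _; move: se; rewrite -/d dz add0r.
have d_gt0 : 0 < d by rewrite lt0r dn0.
have Pd : P d.
  apply: clP => V; rewrite -nbhs_ballE => -[e /= e0 eV].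
  have [s Ss se] := inf_adherent e0 Si; have ds : d <= s by apply: ge_inf => //; exact: Si.2.
  exists s; split; first exact: Ss.2.
  apply: eV; rewrite -ball_normE /= distrC ger0_norm ?subr_ge0//.
  by rewrite ltrBlDl.
have PdP t : P t -> exists k : int, t = k%:~R * d.
  move=> Pt; have [s0 sd /(_ Pt) Ps] := modP t d d_gt0 Pd.
  exists (Num.floor (t / d)); apply/eqP; rewrite -subr_eq0.
  apply/negP => /negP sn0; have : d <= t - (Num.floor (t / d))%:~R * d.
    by apply: ge_inf; [exact: Si.2|split=> //; rewrite lt0r sn0].
  by rewrite leNgt sd.
have [[q|q] qd] := PdP 1 P1; last first.
  have : (0 : R) < 1 by [].
  by rewrite qd pmulr_lgt0// ltr0z.
have q0 : (0 < q)%N.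
  by rewrite lt0n; apply/eqP => q0; move/eqP: qd; rewrite q0 mul0r oner_eq0.
have qR : (q%:R : R) != 0 by rewrite pnatr_eq0 -lt0n.
have dE : d = q%:R^-1.
  by apply: (mulfI qR); rewrite mulfV// qd pmulrn.
by exists q; split; rewrite -?dE// => t /PdP[k ->]; exists k.
Qed.

Section Characters.
Variable G : topologicalZmodType.
Implicit Types (chi psi eta : G -> circ) (D : set G).

Record character chi : Prop := Character {
  charD : forall x y, chi (x + y) = chi x + chi y ;
  char_re : continuous (fun x => re (chi x)) ;
  char_im : continuous (fun x => im (chi x)) }.

Lemma char_cval chi : character chi -> continuous (fun x => cval (chi x)).
Proof.
move=> ch x; rewrite /continuous_at [cval (chi x)]surjective_pairing.
under eq_fun do rewrite [cval _]surjective_pairing.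
apply: (@cvg_pair _ _ _ _ (nbhs _) (nbhs _)); first exact: char_re.
exact: char_im.
Qed.

Lemma cst0_character : character (0 : G -> circ).
Proof. by split=> [x y||]; [rewrite [RHS]addr0|move=> x; exact: cvg_cst..]. Qed.

Lemma character_add chi psi : character chi -> character psi ->
  character (chi + psi).
Proof.
move=> [cD cr ci] [pD pr pi]; split=> [x y||].
- by change (chi (x + y) + psi (x + y) = (chi x + psi x) + (chi y + psi y));
    rewrite cD pD addrACA.
- have -> : (fun x => re ((chi + psi) x)) =
      fun x => re (chi x) * re (psi x) - im (chi x) * im (psi x) by [].
  by apply: (@continuous_sub RR); apply: (@continuous_mul RR).
- have -> : (fun x => im ((chi + psi) x)) =
      fun x => re (chi x) * im (psi x) + im (chi x) * re (psi x) by [].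
  by apply: (@continuous_add RR); apply: (@continuous_mul RR).
Qed.

Lemma character_opp chi : character chi -> character (- chi).
Proof.
move=> [cD cr ci]; split=> [x y|//|].
- by change (- chi (x + y) = - chi x - chi y); rewrite cD opprD.
- have -> : (fun x => im ((- chi) x)) = fun x => - im (chi x) by [].
  exact: (@continuous_neg RR).
Qed.

Lemma character_subgroup : subgroup [set chi : G -> circ | character chi].
Proof.
split=> [|chi psi cchi cpsi]; first exact: cst0_character.
by apply: character_add => //; exact: character_opp.
Qed.

Lemma fun_mulrz chi (k : int) x : (chi *~ k) x = chi x *~ k.
Proof.
have Mn n : (chi *+ n) x = chi x *+ n.
  by elim: n => [//|n IHn]; rewrite !mulrS -IHn.
case: k => n; first by rewrite -!pmulrn Mn.
by rewrite !NegzE !mulrNz -!pmulrn -Mn.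
Qed.

Section OneCharacter.
Variable chi : G -> circ.
Hypothesis cchi : character chi.

Lemma char0 : chi 0 = 0.
Proof.
by apply/(addrI (chi 0)); rewrite -(charD cchi) !addr0.
Qed.

Lemma charN x : chi (- x) = - chi x.
Proof. by apply/eqP; rewrite -addr_eq0 -(charD cchi) addNr char0. Qed.

Lemma charB x y : chi (x - y) = chi x - chi y.
Proof. by rewrite (charD cchi) charN. Qed.

Lemma charMn x n : chi (x *+ n) = chi x *+ n.
Proof. by elim: n => [|n IHn]; rewrite ?char0// !mulrS (charD cchi) IHn. Qed.

Lemma charMz x (k : int) : chi (x *~ k) = chi x *~ k.
Proof. by case: k => n; rewrite ?NegzE ?mulrNz ?charN -!pmulrn charMn. Qed.

Lemma char_nbhs (e : RR) : 0 < e -> nbhs 0 [set x | 1 - e < re (chi x)].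
Proof.
move=> e0; have := @continuous_near RR G _ 0 e (char_re cchi) e0.
by apply: filterS => x /=; rewrite char0 re0 ltr_norml => /andP[]; lra.
Qed.

Lemma char_ker_closed : closed [set x | chi x = 0].
Proof.
have -> : [set x | chi x = 0] = [set x | re (chi x) = 1].
  by apply/seteqP; split=> x /=; [move=> ->|exact: re1P].
exact: (@closed_eq_preimage RR G _ 1 (char_re cchi)).
Qed.

Lemma char_compact_image D : compact D -> closed [set cval (chi x) | x in D].
Proof.
move=> cD; apply: compact_closed.
  by apply: hausdorff_prod; exact: Rhausdorff.
apply: continuous_compact cD; apply: continuous_subspaceT.
exact: char_cval.
Qed.

End OneCharacter.

Lemma character_ker_subgroup D chi : character chi -> subgroup D ->
  subgroup (D `&` [set x | chi x = 0]).
Proof.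
move=> cchi sD; split; first by split; [exact: sD.1|exact: char0].
move=> x y [Dx /= cx] [Dy /= cy]; split; first exact: subgroupB.
by rewrite /= (charB cchi) cx cy subr0.
Qed.

(* Passing to angles reduces this to closed subgroups of the reals. *)
Lemma char_image chi D : character chi -> compact D -> subgroup D ->
  (forall z, exists2 x, D x & chi x = z) \/
  exists q : nat, [/\ (0 < q)%N, exists2 x, D x & chi x = angle q%:R^-1 &
    forall x, D x -> exists k : int, chi x = angle (k%:~R / q%:R)].
Proof.
move=> cchi cD sD.
pose P := [set t : RR | exists2 x, D x & chi x = angle t].
have clP : closed P.
  have -> : P = (fun t => cval (angle t)) @^-1` [set cval (chi x) | x in D].
    apply/seteqP; split=> t /= [x Dx]; first by move=> xt; exists x => //; rewrite xt.
    by move=> xt; exists x => //; exact: cval_inj.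
  apply: closed_comp; first by move=> t _; exact: angle_continuous.
  exact: char_compact_image.
have sP : subgroup P.
  split; first by exists 0; [exact: sD.1|rewrite char0// angle0].
  move=> s t [x Dx xs] [y Dy yt]; exists (x - y); first exact: subgroupB.
  by rewrite charB// xs yt -angleN -angleD.
have P1 : P 1 by exists 0; [exact: sD.1|rewrite char0// angle1].
have [PT|[q [q0 Pq PP]]] := closed_subgroup_R clP sP P1; [left|right].
  move=> z; have [t [_ _ ->]] := angle_surj z.
  by have : P t by rewrite PT.
exists q; split=> // x Dx; have [t [_ _ xt]] := angle_surj (chi x).
by have [|k tk] := PP t; [exists x|exists k; rewrite xt tk].
Qed.

(** On [D], [chi] factors through [psi]. If [psi] has finite image, a generator determines [k]. If
    [psi] is onto, [k] is read off as a slope at ever smaller angles, which determines [chi] on a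
    subgroup that [psi] still maps onto the circle. *)
Lemma char_ker_multiple chi psi D : character chi -> character psi ->
  compact D -> closed D -> subgroup D -> (forall x, D x -> psi x = 0 -> chi x = 0) ->
  exists k : int, forall x, D x -> chi x = psi x *~ k.
Proof.
move=> cchi cpsi cD clD sD ker.
have same x y : D x -> D y -> psi x = psi y -> chi x = chi y.
  move=> Dx Dy xy; apply/eqP; rewrite -subr_eq0 -charB//; apply/eqP/ker.
    exact: subgroupB.
  by rewrite charB// xy subrr.
have [onto|[q [q0 [g Dg gq] qP]]] := char_image cpsi cD sD; last first.
  have qR : (q%:R : RR) != 0 by rewrite pnatr_eq0 -lt0n.
  have [t [_ _ gt]] := angle_surj (chi g).
  have [k tk] : exists k : int, t *+ q = k%:~R.
    apply: angle_eq0; rewrite angleMn -gt -charMn//; apply: ker.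
      exact: subgroupMn.
    by rewrite charMn// gq -angleMn -[_ *+ q]mulr_natl mulfV// angle1.
  exists k => x Dx; have [j xj] := qP x Dx.
  have gk : chi g = psi g *~ k.
    rewrite gt gq -angleMz; congr angle; apply: (mulfI qR).
    by rewrite mulr_natl tk -[q%:R^-1 *~ k]mulrzl mulrCA mulfV// mulr1.
  have xg : psi x = psi (g *~ j) by rewrite xj charMz// gq -angleMz -[q%:R^-1 *~ j]mulrzl.
  rewrite (same x (g *~ j))//; last exact: subgroupMz.
  by rewrite xg !charMz// gk -!mulrzA mulrC.
(* With angles below 1/8 the difference [t j.+1 *+ 2 - t j] is below 3/8 in absolute value, so it
   vanishes as soon as it is an integer. *)
have [d [d0 dP]] := @angle_small 8^-1 ltac:(by rewrite invr_gt0 ltr0n).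
pose E := D `&` [set x | re (chi x) <= 1 - d].
have clE : closed [set cval (psi x) | x in E].
  apply: char_compact_image => //; apply: compact_closedI => //.
  exact: (@closed_le_preimage RR G _ (1 - d) (char_re cchi)).
(* The [psi]-image of the points where [chi] is far from 0 is closed and misses 0; hence a small
   angle of [psi] forces a small angle of [chi]. *)
have [e [e0 eP]] : exists e : RR, 0 < e /\
    forall s, `|s - 0| < e -> ~ [set cval (psi x) | x in E] (cval (angle s)).
  apply: (@nbhs_real RR 0 [set s | ~ [set cval (psi x) | x in E] (cval (angle s))]).
  apply: (@angle_continuous 0 (~` [set cval (psi x) | x in E])).
  apply: open_nbhs_nbhs; split.
    exact: closed_openC.
  move=> -[x [Dx xd] /cval_inj]; rewrite angle0 => /(ker _ Dx) cx.
  by move: xd; rewrite /= cx re0; lra.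
have [N Ne] := @inv_natr_small RR e e0.
pose a j : RR := N.+1%:R^-1 / 2 ^+ j.
have a0 j : 0 < a j by rewrite divr_gt0 ?invr_gt0 ?ltr0n ?exprn_gt0.
have aS j : a j.+1 *+ 2 = a j.
  by rewrite /a exprSr invfM mulrA -[_ / 2 *+ 2]mulr_natr -mulrA mulVf ?mulr1// pnatr_eq0.
have ale j : a j <= N.+1%:R^-1.
  by rewrite ler_piMr ?invr_ge0// invf_le1 ?exprn_gt0// exprn_ege1// ler1n.
have /choice[x xP] : forall j, exists x, D x /\ psi x = angle (a j).
  by move=> j; have [x Dx xj] := onto (angle (a j)); exists x.
have /choice[t tP] : forall j, exists t, `|t| < 8^-1 /\ chi (x j) = angle t.
  move=> j; have [Dx xj] := xP j; apply: dP; rewrite ltNge; apply/negP => le.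
  apply: (eP (a j)); last by exists (x j) => //; rewrite xj.
  by rewrite subr0 gtr0_norm//; apply: le_lt_trans (ale j) Ne.
have tS j : t j.+1 *+ 2 = t j.
  have /angle_eq0[k kP] : angle (t j.+1 *+ 2 - t j) = 0.
    rewrite angleD angleN angleMn -(tP j).2 -(tP j.+1).2 -charMn// -charB//.
    apply: ker; first by apply: subgroupB => //; [apply: subgroupMn => //|]; exact: (xP _).1.
    by rewrite charB// charMn// (xP j).2 (xP j.+1).2 -angleMn aS subrr.
  have k1 : `|k%:~R : RR| < 1%:~R.
    rewrite -kP; apply: le_lt_trans (ler_normB _ _) _.
    have := (tP j).1; have := (tP j.+1).1; rewrite normrMn; lra.
  apply/eqP; rewrite -subr_eq0 kP; move: k1; rewrite -intr_norm ltr_int.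
  by case: k {kP} => [[|k]|k].
(* The multiple [x 0 *+ N.+1] has [psi]-angle 1, so it lies in the kernel of both characters; the
   resulting integer is the slope [k]. *)
have [k kP] : exists k : int, t 0%N *+ N.+1 = k%:~R.
  apply: angle_eq0; rewrite angleMn -(tP 0%N).2 -charMn//; apply: ker.
    by apply: subgroupMn => //; exact: (xP _).1.
  rewrite charMn// (xP 0%N).2 -angleMn /a expr0 divr1 -[_ *+ N.+1]mulr_natl.
  by rewrite mulfV ?angle1// pnatr_eq0.
have tk j : t j = a j *~ k.
  have t0 : t 0%N = a 0%N *~ k.
    have NR : (N.+1%:R : RR) != 0 by rewrite pnatr_eq0.
    apply: (mulfI NR); rewrite mulr_natl kP /a expr0 divr1 -[_^-1 *~ k]mulrzl mulrCA.
    by rewrite mulfV ?mulr1.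
  elim: j => [//|j IHj]; move: IHj; rewrite -tS -aS => h.
  have : (t j.+1 - a j.+1 *~ k) *+ 2 = 0.
    by rewrite mulrnBl h [_ *~ k *+ 2]pmulrn [a _ *+ 2]pmulrn -!mulrzA [k * _]mulrC subrr.
  by move=> /eqP; rewrite mulrn_eq0 /= subr_eq0 => /eqP.
pose D' := D `&` [set y | (chi - psi *~ k) y = 0].
have cck : character (chi - psi *~ k).
  exact: (subgroupB character_subgroup cchi (subgroupMz character_subgroup k cpsi)).
have D'E y : D' y <-> D y /\ chi y = psi y *~ k.
  split=> -[Dy yk]; split=> //.
    move: yk; change (chi y - (psi *~ k) y = 0 -> chi y = psi y *~ k).
    rewrite fun_mulrz => /eqP.
    by rewrite subr_eq0 => /eqP.
  by change (chi y - (psi *~ k) y = 0); rewrite fun_mulrz yk subrr.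
have sD' : subgroup D' by exact: character_ker_subgroup.
have cD' : compact D' by apply: compact_closedI => //; exact: char_ker_closed.
have D'x j : D' (x j).
  by apply/D'E; rewrite (tP j).2 (xP j).2 -angleMz tk; split=> //; exact: (xP j).1.
(* A finite image of order [q] would make every [a i * q] an integer, although it is positive and
   below 1 for [i = q]. *)
have [onto'|[q [q0 _ qP]]] := char_image cpsi cD' sD'.
  exists k => y Dy; have [z /D'E[Dz zk] zy] := onto' (psi y).
  by rewrite (same y z)// zk zy.
have qR : (0 : RR) < q%:R by rewrite ltr0n.
have [i iP] : exists i, a i * q%:R < 1.
  exists q; rewrite /a -mulrA; apply: (@le_lt_trans _ _ (2 ^- q * q%:R)).
    rewrite ler_piMl ?mulr_ge0// ?invr_ge0 ?exprn_ge0//.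
    by rewrite invf_le1 ?ler1n// ltr0n.
  by rewrite mulrC ltr_pdivrMr ?exprn_gt0// mul1r -natrX ltr_nat ltn_expl.
have [l lP] := qP _ (D'x i); move: lP; rewrite (xP i).2 => lP.
have [n nP] : exists n : int, a i - l%:~R / q%:R = n%:~R.
  by apply: angle_eq0; rewrite angleD angleN lP subrr.
have E1 : a i * q%:R = (n * q%:Z + l)%:~R.
  by rewrite intrD intrM -nP mulrBl divfK ?gt_eqF// subrK.
have : 0 < a i * q%:R by rewrite mulr_gt0.
move: iP; rewrite E1 ltrz1 ltr0z.
by case: (n * q + l) => // -[].
Qed.

End Characters.

(** * Finite families of characters *)

Section CharacterFamilies.
Variable G : topologicalZmodType.
Implicit Types (chi : G -> circ) (D : set G).

Definition trivial_on D chi := forall x, D x -> chi x = 0.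

Definition common_ker r (psi : 'I_r -> G -> circ) : set G :=
  [set x | forall i, psi i x = 0].

Definition independent_on r D (psi : 'I_r -> G -> circ) :=
  forall k : 'I_r -> int, trivial_on D (\sum_i psi i *~ k i) -> forall i, k i = 0.

Lemma combE r (psi : 'I_r -> G -> circ) (k : 'I_r -> int) x :
  (\sum_i psi i *~ k i) x = \sum_i psi i x *~ k i.
Proof. by rewrite fct_sumE; apply: eq_bigr => i _; rewrite fun_mulrz. Qed.

Lemma comb_character r (psi : 'I_r -> G -> circ) (k : 'I_r -> int) :
  (forall i, character (psi i)) -> character (\sum_i psi i *~ k i).
Proof.
move=> cpsi; apply: (subgroup_sum (@character_subgroup G)) => i.
exact: (subgroupMz (@character_subgroup G)).
Qed.

Lemma common_ker_closed r (psi : 'I_r -> G -> circ) :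
  (forall i, character (psi i)) -> closed (common_ker psi).
Proof.
move=> cpsi; have -> : common_ker psi = \bigcap_i [set x | psi i x = 0].
  by apply/seteqP; split=> x px i; [move=> _|]; apply: px.
by apply: closed_bigI => i _; exact: char_ker_closed.
Qed.

Lemma common_ker_subgroup r (psi : 'I_r -> G -> circ) :
  (forall i, character (psi i)) -> subgroup (common_ker psi).
Proof.
move=> cpsi; split=> [i|x y px py i]; first exact: char0.
by rewrite charB// px py subr0.
Qed.

Lemma subgroupI (H : zmodType) (A B : set H) :
  subgroup A -> subgroup B -> subgroup (A `&` B).
Proof.
move=> [A0 AB] [B0 BB]; split=> // x y [Ax Bx] [Ay By].
by split; [exact: AB|exact: BB].
Qed.

(* The annihilator of the joint kernel of finitely many characters is the group
   they generate; restricting to the kernel of one of them allows induction. *)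
Lemma common_ker_comb r (psi : 'I_r -> G -> circ) chi D :
  (forall i, character (psi i)) -> character chi ->
  compact D -> closed D -> subgroup D -> trivial_on (D `&` common_ker psi) chi ->
  exists k : 'I_r -> int, forall x, D x -> chi x = \sum_i psi i x *~ k i.
Proof.
elim: r psi chi D => [|r IHr] psi chi D cpsi cchi cD clD sD tchi.
  exists (fun _ => 0) => x Dx; rewrite big_ord0; apply: tchi; split=> //.
  by case.
pose D0 := D `&` [set x | psi ord0 x = 0].
have clker := char_ker_closed (cpsi ord0).
have cD0 : compact D0 by exact: compact_closedI.
have clD0 : closed D0 by exact: closedI.
have sD0 : subgroup D0 by exact: character_ker_subgroup.
have [||k kP] := IHr (fun i => psi (lift ord0 i)) chi D0 _ cchi cD0 clD0 sD0.
- by move=> i; exact: cpsi.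
- move=> x [[Dx /= px] qx]; apply: tchi; split=> // i.
  by case: (unliftP ord0 i) => [j ->|->//]; exact: qx.
pose eta := chi - \sum_i psi (lift ord0 i) *~ k i.
have etaE x : eta x = chi x - \sum_i psi (lift ord0 i) x *~ k i.
  change (chi x - (\sum_i psi (lift ord0 i) *~ k i) x = chi x - \sum_i psi (lift ord0 i) x *~ k i).
  by rewrite combE.
have ceta : character eta.
  apply: (subgroupB (@character_subgroup G)) => //.
  by apply: comb_character => i; exact: cpsi.
have [|l lP] := char_ker_multiple ceta (cpsi ord0) cD clD sD.
  by move=> x Dx px; rewrite etaE (kP x) ?subrr.
exists (fun i => if unlift ord0 i is Some j then k j else l) => x Dx.
rewrite big_ord_recl unlift_none -lP// etaE.
rewrite [X in _ = _ + X](eq_bigr (fun i => psi (lift ord0 i) x *~ k i)) ?subrK//.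
by move=> i _; rewrite liftK.
Qed.

(** It is enough that the first character is onto on the joint kernel of the others. Otherwise its
    image there has some finite order [q], so its [q]-th multiple is an integer combination of the
    others, against independence. *)
Lemma independent_onto r (psi : 'I_r -> G -> circ) D :
  (forall i, character (psi i)) -> compact D -> closed D -> subgroup D ->
  independent_on D psi ->
  forall z : 'I_r -> circ, exists2 x, D x & forall i, psi i x = z i.
Proof.
elim: r psi => [|r IHr] psi cpsi cD clD sD indep z.
  by exists 0; [exact: sD.1|case].
pose phi i := psi (lift ord0 i).
have cphi i : character (phi i) by exact: cpsi.
pose ext (k : 'I_r -> int) l i := if unlift ord0 i is Some j then k j else l : int.
have extE k l x : (\sum_i psi i *~ ext k l i) x = psi ord0 x *~ l + \sum_i phi i x *~ k i.
  rewrite combE big_ord_recl /ext unlift_none.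
  by congr (_ + _); apply: eq_bigr => i _; rewrite liftK.
have iphi : independent_on D phi.
  move=> k tk i; have := indep (ext k 0) _ (lift ord0 i).
  rewrite /ext liftK; apply => x Dx.
  by rewrite extE mulr0z add0r -combE tk.
pose D0 := D `&` common_ker phi.
have clker := common_ker_closed cphi.
have cD0 : compact D0 by exact: compact_closedI.
have sD0 : subgroup D0 by apply: subgroupI => //; exact: common_ker_subgroup.
have [onto|[q [q0 _ qP]]] := char_image (cpsi ord0) cD0 sD0.
  have [x1 Dx1 x1P] := IHr phi cphi cD clD sD iphi (fun i => z (lift ord0 i)).
  have [x0 [Dx0 x0P] x0z] := onto (z ord0 - psi ord0 x1).
  exists (x0 + x1); first exact: subgroupD.
  move=> i; rewrite charD//; case: (unliftP ord0 i) => [j ->|->].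
    by rewrite -/(phi j) x0P x1P add0r.
  by rewrite x0z subrK.
have qR : (q%:R : RR) != 0 by rewrite pnatr_eq0 -lt0n.
have cq : character (psi ord0 *~ q).
  exact: (subgroupMz (@character_subgroup G)).
have [|k kP] := common_ker_comb cphi cq cD clD sD.
  move=> x Dx; have [l lP] := qP x Dx.
  rewrite fun_mulrz lP -angleMz -[_ *~ q]mulrzr divfK// angle_int//.
have := indep (ext (fun i => - k i) q%:Z) _ ord0.
rewrite /ext unlift_none => /(_ _)/eqP; rewrite -[_ == _]/(q == 0%N) => h.
suff : q == 0%N by rewrite eqn0Ngt q0.
apply: h => x Dx; rewrite extE -fun_mulrz kP// -big_split /=.
by rewrite big1// => i _; rewrite mulrNz subrr.
Qed.

(* Euclid's algorithm on the coefficients of a relation. *)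
Lemma independent_reduction r (psi : 'I_r -> G -> circ) D :
  (forall i, character (psi i)) ->
  (forall chi n, character chi -> (0 < n)%N -> trivial_on D (chi *+ n) ->
     trivial_on D chi) ->
  exists s (phi : 'I_s -> G -> circ), [/\ (forall i, character (phi i)),
    independent_on D phi &
    forall x, D x -> common_ker phi x <-> common_ker psi x].
Proof.
move=> + tf; elim: r psi => [|r IHr] psi cpsi.
  by exists 0%N, psi; split=> // k _ [].
have [ind|/existsNP[k /not_implyP[tk /existsNP[i0 ki0]]]] := pselect (independent_on D psi).
  by exists r.+1, psi.
have [N NP] := ubnP (\sum_i `|k i|%N).
elim: N psi cpsi k tk i0 ki0 NP => [//|N IHN] psi cpsi k tk i0 /eqP ki0 NP.
(* A relation with a single nonzero coefficient says that a multiple of [psi i0] is trivial on [D];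
   torsion-freeness makes [psi i0] itself trivial there, and it is dropped. *)
have [[j [jn kj]]|nj] := pselect (exists j, j != i0 /\ k j != 0); last first.
  have k0 j : j != i0 -> k j = 0.
    by move=> ji; apply/eqP; apply: contra_notT nj => kj; exists j.
  have t0 : trivial_on D (psi i0).
    have t1 x : D x -> psi i0 x *~ k i0 = 0.
      move=> /tk; rewrite combE (bigD1 i0)//= big1 ?addr0// => j ji.
      by rewrite k0.
    apply: (tf _ `|k i0|%N) => //; first by rewrite absz_gt0.
    move=> x /t1; rewrite pmulrn fun_mulrz abszEsg mulrC mulrzA => ->.
    by rewrite mul0rz.
  have [s [phi [cphi iphi kphi]]] := IHr (fun j => psi (lift i0 j)) (fun j => cpsi _).
  exists s, phi; split=> // x Dx; rewrite kphi//; split=> [px i|px i]; last exact: px.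
  by case: (unliftP i0 i) => [j ->|->]; [exact: px|exact: t0].
wlog le : i0 j jn ki0 kj / (`|k j| <= `|k i0|)%N.
  move=> wl; have [|/ltnW le] := leqP `|k j| `|k i0|; first exact: wl jn ki0 kj.
  by apply: (wl j i0) => //; rewrite eq_sym.
(* One Euclidean step: with this sign, [k i0 - s * k j] is smaller in absolute value than [k i0],
   and replacing [psi j] by [psi j + s psi i0] preserves both the relation and the joint kernel. *)
pose s : int := if (0 < k i0) == (0 < k j) then 1 else -1.
have lt_k : (`|(k i0 - s * k j)%R| < `|k i0|)%N.
  by move: (k i0) (k j) ki0 kj le @s => a b; case: ifP; lia.
pose psi' i := if i == j then psi j + psi i0 *~ s else psi i.
pose k' i := if i == i0 then k i0 - s * k j else k i.
have cpsi' i : character (psi' i).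
  rewrite /psi'; case: eqP => // _; apply: (subgroupD (@character_subgroup G)) => //.
  exact: (subgroupMz (@character_subgroup G)).
have i0j : (i0 == j) = false by rewrite eq_sym (negbTE jn).
have [|||t [phi [cphi iphi kphi]]] := IHN psi' cpsi' k' _ j.
- move=> x /tk; rewrite !combE => tkx; rewrite -[RHS]tkx.
  rewrite (bigD1 i0)//= (bigD1 j)//= [RHS](bigD1 i0)//= [in RHS](bigD1 j)//= !addrA.
  congr (_ + _); last first.
    by apply: eq_bigr => i /andP[ii ij]; rewrite /psi' /k' (negbTE ii) (negbTE ij).
  rewrite /psi' /k' eqxx i0j eqxx (negbTE jn).
  change (psi i0 x *~ (k i0 - s * k j) + (psi j x + (psi i0 *~ s) x) *~ k j =
    psi i0 x *~ k i0 + psi j x *~ k j).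
  by rewrite fun_mulrz mulrzBr mulrzDl -mulrzA [_ *~ k j + _]addrC addrA subrK.
- by apply/eqP; rewrite /k' (negbTE jn).
- move: NP; rewrite (bigD1 i0)//= ltnS => NP; apply: leq_trans NP.
  rewrite [ltnLHS](bigD1 i0)//= {1}/k' eqxx.
  rewrite (eq_bigr (fun i => `|k i|%N)) ?ltn_add2r// => i ii.
  by rewrite /k' (negbTE ii).
exists t, phi; split=> // x Dx; rewrite kphi//; split=> px i.
  have pi0 : psi i0 x = 0 by have := px i0; rewrite /psi' i0j.
  have [->|ij] := eqVneq i j; last by have := px i; rewrite /psi' (negbTE ij).
  have := px j; rewrite /psi' eqxx.
  by change (psi j x + (psi i0 *~ s) x = 0 -> psi j x = 0); rewrite fun_mulrz pi0 mul0rz addr0.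
rewrite /psi'; case: eqP => _; last exact: px.
by change (psi j x + (psi i0 *~ s) x = 0); rewrite fun_mulrz !px mul0rz addr0.
Qed.

End CharacterFamilies.

(** * Kuhn's lemma *)

Section Kuhn.

Lemma F2_addrr (x : 'F_2) : x + x = 0.
Proof. by case: x => [[|[|]]] // lt; apply/val_inj. Qed.

Lemma F2_oppr (x : 'F_2) : - x = x.
Proof. by apply/eqP; rewrite eq_sym -addr_eq0 F2_addrr. Qed.

(** Over the field with two elements its determinant is 1 exactly when the labels are a permutation
    of the colours below [n]: a repeated label repeats a row, and a label outside that range gives a
    zero row. Sums of determinants thus count parities. *)
Definition label_mx n (L : 'I_n -> nat) : 'M['F_2]_n :=
  \matrix_(t, c) (L t == c :> nat)%:R.

Lemma label_det_neq0 n (L : 'I_n -> nat) (c : 'I_n) :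
  \det (label_mx L) != 0 -> exists t, L t = c :> nat.
Proof.
move=> dL; apply: contrapT => /forallNP nL; case/eqP: dL.
rewrite (expand_det_col _ c) big1// => t _; rewrite mxE.
by case: eqP => [/nL//|_]; rewrite mul0r.
Qed.

(* All rows of the label matrix sum to [1], so the last column may be replaced
   by a column of ones before expanding. *)
Lemma label_det_faces n (L : 'I_n.+1 -> nat) : (forall t, (L t <= n)%N) ->
  \det (label_mx L) = \sum_t0 \det (label_mx (fun t => L (lift t0 t))).
Proof.
move=> Ln; set A := label_mx L.
transitivity (\sum_c (\adj A *m A) ord_max c).
  rewrite mul_adj_mx (bigD1 ord_max)//= big1 => [|c cm].
    by rewrite addr0 mxE eqxx mulr1n.
  by rewrite mxE eq_sym (negbTE cm) mulr0n.
under eq_bigr do rewrite mxE; rewrite exchange_big /=; apply: eq_bigr => t _.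
rewrite -mulr_sumr (_ : \sum_i A t i = 1) ?mulr1; last first.
  have Lt : (L t < n.+1)%N by rewrite ltnS.
  rewrite (bigD1 (Ordinal Lt))//= mxE eqxx big1 ?addr0// => c cL.
  by rewrite mxE; case: eqP => // e; case/eqP: cL; apply: val_inj.
rewrite mxE /cofactor.
have -> : (-1) ^+ (t + ord_max (n' := n)) = 1 :> 'F_2.
  by rewrite F2_oppr expr1n.
rewrite mul1r; congr (\det _); apply/matrixP => i j; rewrite !mxE.
by rewrite lift_max.
Qed.

Lemma sum_perm_tperm n (a b : 'I_n) (F : 'S_n -> 'F_2) : a != b ->
  (forall p, F (p * tperm a b)%g = F p) -> \sum_p F p = 0.
Proof.
move=> ab FT; rewrite (bigID (@odd_perm _)) /=.
rewrite (reindex_inj (mulIg (tperm a b))) /=.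
rewrite [X in X + _](eq_big (fun p => ~~ odd_perm p) F).
- exact: F2_addrr.
- by move=> p; rewrite odd_permM odd_tperm ab addbT.
- by move=> p _; exact: FT.
Qed.

(** The t-th vertex of a simplex of the Freudenthal triangulation of the unit cube with lowest
    corner [v]; [p i] is the moment after which coordinate [i] has been raised. *)
Definition path_vertex n (v : 'I_n -> nat) (p : 'S_n) (t : nat) : 'I_n -> nat :=
  fun i => (v i + (p i < t))%N.

Definition upd n (v : 'I_n -> nat) (s : 'I_n) (a : nat) : 'I_n -> nat :=
  fun i => if i == s then a else v i.

Lemma sum_telescope n M (s : 'I_n) (F : ('I_n -> nat) -> 'F_2) :
  \sum_(v : {ffun 'I_n -> 'I_M.+1})
     (F (upd (fun i => v i) s (v s).+1) - F (fun i => v i)) =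
  \sum_(v : {ffun 'I_n -> 'I_M.+1} | v s == ord0)
     (F (upd (fun i => v i) s M.+1) - F (fun i => v i)).
Proof.
pose up (v : {ffun 'I_n -> 'I_M.+1}) (a : 'I_M.+1) : {ffun 'I_n -> 'I_M.+1} :=
  [ffun i => if i == s then a else v i].
rewrite (partition_big (fun v => up v ord0) (fun v => v s == ord0)) /=; last first.
  by move=> v _; rewrite /up ffunE eqxx.
apply: eq_bigr => u /eqP us.
rewrite (reindex_onto (fun a => up u a) (fun v => v s)) /=; last first.
  move=> v /eqP <-; apply/ffunP => i; rewrite !ffunE.
  by case: eqP => [->//|_]; rewrite ?ffunE.
transitivity (\sum_(a < M.+1) (F (upd (fun i => u i) s a.+1) - F (upd (fun i => u i) s a))).
  apply: eq_big => [a|a _].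
    rewrite [up u a s]ffunE !eqxx andbT; apply/eqP/ffunP => i; rewrite !ffunE.
    by case: eqP => [->|//].
  by congr (F _ - F _); apply/funext => i; rewrite /upd !ffunE ?eqxx; case: eqP.
rewrite -(big_mkord xpredT (fun a => F (upd (fun i => u i) s a.+1) - F (upd (fun i => u i) s a))).
rewrite telescope_sumr//; congr (_ - F _); apply/funext => i.
by rewrite /upd; case: eqP => [->|//]; rewrite us.
Qed.

(** The boundary behaviour of the rule that takes the least [i] with some property which holds where
    coordinate [i] is 0 and fails where it is [M], and takes [n] if there is no such [i]. *)
Definition kuhn_labelling n M (l : ('I_n -> nat) -> nat) :=
  forall v, (forall i, v i <= M)%N ->
    [/\ (l v <= n)%N, (forall i, v i = 0%N -> (l v <= i)%N) &
        (forall i, v i = M -> l v != i)].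

(** The parity of the number of fully labelled simplices. Lowest corners run up to [M] and vertices
    up to [M.+1], whence the shift against [kuhn_labelling]. *)
Definition kuhn_sum n M (l : ('I_n -> nat) -> nat) : 'F_2 :=
  \sum_(v : {ffun 'I_n -> 'I_M.+1}) \sum_(p : 'S_n)
    \det (label_mx (fun t : 'I_n.+1 => l (path_vertex (fun i => v i) p t))).

(* Faces omitting an interior vertex cancel under an adjacent transposition of
   directions; the face omitting the first vertex is the face of a neighbouring
   simplex omitting its last vertex, so the sum telescopes to the side where the
   last coordinate vanishes. *)
Lemma kuhn_sum_eq1 n M (l : ('I_n -> nat) -> nat) :
  kuhn_labelling M.+1 l -> kuhn_sum M l = 1.
Proof.
elim: n l => [|n IHn] l ll.
  have bigI0 (I : finType) (F : I -> 'F_2) (i0 : I) : (forall i, i = i0) -> \sum_i F i = F i0.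
    by move=> I0; rewrite (bigD1 i0)//= big1 ?addr0// => i; rewrite (I0 i) eqxx.
  rewrite /kuhn_sum (bigI0 _ _ [ffun _ => ord0]); last first.
    by move=> v; apply/ffunP => -[].
  rewrite (bigI0 _ _ 1%g); last by move=> p; apply/permP => -[].
  rewrite det_mx11 mxE; set w := path_vertex _ _ _.
  by have [|] := ll w; [case|rewrite leqn0 => /eqP ->].
(* The face without the last vertex; on it the coordinate [last_dir p], the last to be raised, keeps
   the value it has in [w]. *)
pose B (w : 'I_n.+1 -> nat) (p : 'S_n.+1) : 'F_2 :=
  \det (label_mx (fun t : 'I_n.+1 => l (path_vertex w p t))).
(* Making the first direction the last one identifies the face without the first vertex with the
   face without the last vertex of the neighbour in that direction. *)
pose rot : 'S_n.+1 := perm (@ord_pred_inj n.+1).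
pose last_dir (p : 'S_n.+1) := (p^-1)%g ord_max.
have split_faces : kuhn_sum M l =
    \sum_(v : {ffun 'I_n.+1 -> 'I_M.+1}) \sum_(p : 'S_n.+1)
      (B (upd (fun i => v i) (last_dir p) (v (last_dir p)).+1) p - B (fun i => v i) p).
  rewrite /kuhn_sum; apply: eq_bigr => v _.
  under eq_bigr => p _.
    rewrite label_det_faces; last first.
      move=> t; have [|//] := ll (path_vertex (fun i => v i) p t).
      by move=> i; have := leq_add (leq_ord (v i)) (leq_b1 (p i < t)%N); rewrite addn1.
    over.
  rewrite exchange_big /= big_ord_recl big_ord_recr /= sumrB.
  rewrite [X in _ + (X + _)]big1 ?add0r; last first.
    move=> t0 _.
    apply: (@sum_perm_tperm _ (widen_ord (leqnSn n) t0) (lift ord0 t0)).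
      by rewrite -val_eqE /= /bump /= add1n neq_ltn ltnSn.
    move=> p; congr (\det (label_mx _)); apply/funext => t.
    congr l; apply/funext => i; rewrite /path_vertex permM; congr (_ + nat_of_bool _)%N.
    case: tpermP => [->|->|//] /=; rewrite /bump /= add1n; lia.
  rewrite [X in _ = _ - X](_ : _ = \sum_p B (fun i => v i) p)// F2_oppr.
  congr (_ + _).
    rewrite [RHS](reindex_inj (mulIg rot)) /=; apply: eq_bigr => p _.
    congr (\det (label_mx _)); apply/funext => t; congr l; apply/funext => i.
    rewrite /path_vertex /upd /last_dir.
    have pr : ((p * rot)%g i : nat) = ((p i + n) %% n.+1)%N.
      by rewrite permM permE /= addnS.
    have iE : (i == ((p * rot)^-1)%g ord_max) = (p i == ord0).
      have := inj_eq (@perm_inj _ (p * rot)%g) i ((p * rot)^-1 ord_max)%g.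
      rewrite permKV => <-; rewrite -[LHS]val_eqE -[RHS]val_eqE /= pr.
      have := ltn_ord (p i).
      case: (p i : nat) => [|k] kn; first by rewrite add0n modn_small ?eqxx.
      by rewrite addSnnS modnDr modn_small; [lia|exact: ltnW].
    have [pi0|pi0] := eqVneq (p i) ord0.
      have <- : i = ((p * rot)^-1)%g ord_max by apply/eqP; rewrite iE pi0.
      rewrite eqxx pr pi0 /= add0n modn_small// /bump /= ?add1n.
      by rewrite [(n < t)%N]ltnNge -ltnS ltn_ord addn0 addn1.
    rewrite iE (negbTE pi0) pr /bump /= ?add1n; congr (_ + nat_of_bool _)%N.
    have : (p i : nat) != 0%N by [].
    have := ltn_ord (p i); case: (p i : nat) => [//|k] kn _.
    by rewrite addSnnS modnDr modn_small//; exact: ltnW.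
  apply: eq_bigr => p _; congr (\det (label_mx _)); apply/funext => t; congr l.
  apply/funext => i; rewrite /path_vertex /= /bump.
  by rewrite leq0n add1n [(n < t)%N]leqNgt ltn_ord.
have Bz w p (c : 'I_n.+1) :
    (forall t : 'I_n.+1, l (path_vertex w p t) != c) -> B w p = 0.
  move=> nc; apply/eqP; apply: contraT => /label_det_neq0 - /(_ c)[t tc].
  by move: (nc t); rewrite tc eqxx.
have last_coord w p (t : 'I_n.+1) : path_vertex w p t (last_dir p) = w (last_dir p).
  by rewrite /path_vertex permKV /= ltnNge -ltnS ltn_ord addn0.
have path_le (v : {ffun 'I_n.+1 -> 'I_M.+1}) p t i :
    (path_vertex (fun i => v i) p t i <= M.+1)%N.
  by have := leq_add (leq_ord (v i)) (leq_b1 (p i < t)%N); rewrite addn1.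
(* On the upper side the colour [last_dir p] is missing. On a lower side other than the last one,
   the colour [ord_max] is missing. Only the side where the last coordinate is 0 remains, and there
   the labelling is of the same kind in one dimension less. *)
have Btop (v : {ffun 'I_n.+1 -> 'I_M.+1}) p :
    B (upd (fun i => v i) (last_dir p) M.+1) p = 0.
  set w := upd _ _ _; apply: (Bz _ _ (last_dir p)) => t.
  have [|_ _] := ll (path_vertex w p t).
    move=> i; have [->|ii] := eqVneq i (last_dir p).
      by rewrite last_coord /w /upd eqxx.
    by rewrite /path_vertex /w /upd (negbTE ii); exact: path_le.
  by apply; rewrite last_coord /w /upd eqxx.
have Bbot (v : {ffun 'I_n.+1 -> 'I_M.+1}) p : v (last_dir p) = ord0 ->
    last_dir p != ord_max -> B (fun i => v i) p = 0.
  move=> v0 pm; apply: (Bz _ _ ord_max) => t.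
  have [|_ low _] := ll (path_vertex (fun i => v i) p t); first exact: path_le.
  rewrite neq_ltn; apply/orP; left; apply: leq_ltn_trans (low (last_dir p) _) _.
    by rewrite last_coord v0.
  by rewrite ltn_neqAle -ltnS ltn_ord andbT; exact: pm.
rewrite split_faces exchange_big /=.
transitivity (\sum_(p : {perm 'I_n.+1} | p ord_max == ord_max)
    \sum_(v : {ffun 'I_n.+1 -> 'I_M.+1} | v ord_max == ord0) B (fun i => v i) p).
  rewrite [RHS]big_mkcond; apply: eq_bigr => p _.
  rewrite (sum_telescope M (last_dir p) (B ^~ p)).
  have lastE : (last_dir p == ord_max) = (p ord_max == ord_max).
    have := inj_eq (@perm_inj _ p) (last_dir p) ord_max.
    by rewrite permKV => <-; rewrite eq_sym.
  case: ifP => pm.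
    have/eqP pl : last_dir p == ord_max by rewrite lastE.
    rewrite pl; apply: eq_bigr => v _.
    by rewrite -pl Btop sub0r F2_oppr.
  rewrite big1// => v /eqP v0; rewrite Btop Bbot ?subrr//.
  by rewrite lastE pm.
pose ext (u : 'I_n -> nat) (i : 'I_n.+1) := if unlift ord_max i is Some j then u j else 0%N.
have ll' : kuhn_labelling M.+1 (fun u => l (ext u)).
  move=> u uM; have extM i : (ext u i <= M.+1)%N.
    by rewrite /ext; case: unliftP => [j _|//]; exact: uM.
  have [_ low high] := ll _ extM; split.
  - by apply: (low ord_max); rewrite /ext unlift_none.
  - by move=> i ui; have := low (lift ord_max i); rewrite lift_max; apply; rewrite /ext liftK.
  - by move=> i ui; have := high (lift ord_max i); rewrite lift_max; apply; rewrite /ext liftK.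
rewrite -(IHn _ ll') /kuhn_sum [RHS]exchange_big /=.
(* The inverse of [lift_perm] on permutations fixing [ord_max]; the default value is reached only
   outside these. *)
pose back (p : 'S_n.+1) : 'S_n :=
  odflt 1%g [pick q : 'S_n | lift_perm ord_max ord_max q == p].
have backK (p : 'S_n.+1) : p ord_max = ord_max -> lift_perm ord_max ord_max (back p) = p.
  move=> pm; rewrite /back; case: pickP => [q /eqP//|nq].
  pose f k := odflt k (unlift ord_max (p (lift ord_max k))).
  have fK k : lift ord_max (f k) = p (lift ord_max k).
    rewrite /f; case: unliftP => [j ->//|pk].
    have /perm_inj/eqP := etrans pk (esym pm).
    by rewrite eq_sym (negbTE (neq_lift _ _)).
  have fI : injective f.
    by move=> a b ab; apply: (@lift_inj _ ord_max); apply: (@perm_inj _ p); rewrite -!fK ab.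
  have /eqP := nq (perm fI); case; apply/permP => i.
  case: (unliftP ord_max i) => [j ->|->]; last by rewrite lift_perm_id pm.
  by rewrite lift_perm_lift permE fK.
rewrite (reindex_onto (lift_perm ord_max ord_max) back) /=; last first.
  by move=> p /eqP; exact: backK.
apply: eq_big => [q|q _].
  rewrite lift_perm_id eqxx /= /back; case: pickP => [r /eqP|/(_ q)]; last by rewrite eqxx.
  move=> /permP rq; suff -> : r = q by rewrite eqxx.
  apply/permP => k; apply: (@lift_inj _ ord_max).
  by have := rq (lift ord_max k); rewrite !lift_perm_lift.
rewrite (reindex_onto (fun u : {ffun 'I_n -> 'I_M.+1} =>
    [ffun i => if unlift ord_max i is Some j then u j else ord0])
  (fun v : {ffun 'I_n.+1 -> 'I_M.+1} => [ffun j => v (lift ord_max j)])) /=; last first.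
  move=> v /eqP v0; apply/ffunP => i; rewrite !ffunE.
  by case: unliftP => [j ->|->]; rewrite ?ffunE.
apply: eq_big => [u|u _].
  rewrite ffunE unlift_none eqxx /=; apply/eqP/ffunP => j.
  by rewrite !ffunE liftK.
congr (\det (label_mx _)); apply/funext => t; congr l; apply/funext => i.
rewrite /path_vertex /ext ffunE; case: unliftP => [j ->|->].
  by rewrite lift_perm_lift lift_max.
by rewrite lift_perm_id /= ltnNge -ltnS ltn_ord.
Qed.

Lemma kuhn n M (l : ('I_n -> nat) -> nat) : kuhn_labelling M.+1 l ->
  exists2 v : 'I_n -> nat, (forall i, (v i <= M)%N) &
    forall c, (c <= n)%N -> exists2 w : 'I_n -> nat,
      (forall i, (v i <= w i <= (v i).+1)%N) & l w = c.
Proof.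
move=> ll; have := kuhn_sum_eq1 ll.
have [[v [p vp]] _|/forallNP nvp] := pselect (exists v p, \det (label_mx
    (fun t : 'I_n.+1 => l (path_vertex (fun i => (v : {ffun 'I_n -> 'I_M.+1}) i) p t))) != 0).
  exists (fun i => v i) => [i|c cn]; first exact: leq_ord.
  have [t tc] := @label_det_neq0 _ _ (inord c) vp.
  exists (path_vertex (fun i => v i) p t); last by rewrite tc inordK.
  move=> i; rewrite /path_vertex leq_addr /=.
  by have := leq_add (leqnn (v i)) (leq_b1 (p i < t)%N); rewrite addn1.
rewrite /kuhn_sum big1 => [/eqP|v _]; first by rewrite eq_sym oner_eq0.
rewrite big1// => p _; apply/eqP; rewrite -[_ == _]negbK; apply/negP.
by have /forallNP := nvp v; apply.
Qed.

End Kuhn.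

(** * Independent characters and dimension *)

Section DimensionBound.
Variable G : topologicalZmodType.

Lemma nbhs0_sums r (U : set G) : nbhs 0 U -> exists W : set G, nbhs 0 W /\
  forall x : 'I_r -> G, (forall i, W (x i)) -> U (\sum_i x i).
Proof.
elim: r U => [|r IHr] U zU.
  by exists U; split=> // x _; rewrite big_ord0; exact: nbhs_singleton.
have [V [zV _ VU _]] := nbhs0_half zU; have [W [zW WV]] := IHr V zV.
exists (V `&` W); split; first exact: filterI.
move=> x xVW; rewrite big_ord_recl; apply: VU; first exact: (xVW _).1.
by apply: WV => i; exact: (xVW _).2.
Qed.

Hypothesis cG : compact [set: G].
Variables (n r : nat) (D : set G) (f : 'I_r -> G -> circ).
Hypotheses (dimG : covering_dim_le G n) (clD : closed D) (sD : subgroup D).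
Hypothesis f_add : forall i x y, D x -> D y -> f i (x + y) = f i x + f i y.
Hypothesis f_cont : forall i x (e : RR), D x -> 0 < e ->
  nbhs x [set y | D y -> `|re (f i y) - re (f i x)| < e].
Hypothesis f_open : forall U : set G, nbhs 0 U -> exists e : RR, 0 < e /\
  forall z : 'I_r -> circ, (forall i, 1 - e < re (z i)) ->
  exists x, [/\ D x, U x & forall i, f i x = z i].

(** The bound 1 is the difference between the real parts at angles 0 and 1/4, which are the opposite
    faces of the grid: a small set cannot meet both. *)
Let small (W : set G) := forall x y i, W x -> W y -> D x -> D y ->
  `|re (f i x) - re (f i y)| < 1.

Let small_cover : exists (J : finType) (V : J -> set G),
  [/\ forall j, open (V j), forall x, exists j, V j x, forall j, small (V j) &
      forall x, (#|[set j : J | `[< V j x >]]| <= n.+1)%N].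
Proof.
have /choice[W WP] : forall x, exists W : set G, [/\ open W, W x & small W].
  move=> x; have [Dx|nDx] := pselect (D x); last first.
    exists (~` D); split; [exact: closed_openC|by []|by move=> y z i nDy _ Dy; case: nDy].
  pose A := [set y | forall i, D y -> `|re (f i y) - re (f i x)| < 2^-1].
  have xA : nbhs x A.
    have h2 : 0 < 2^-1 :> RR by lra.
    by apply: filter_forall => i; exact: f_cont Dx h2.
  exists A^°; split; [exact: open_interior|exact: xA|].
  move=> y z i /interior_subset Ay /interior_subset Az Dy Dz.
  have := Ay i Dy; have := Az i Dz.
  rewrite !ltr_norml => /andP[h1 h2] /andP[h3 h4]; apply/andP; split; lra.
have [|s sP] := @compact_fin_cover G G [set: G] W cG.
  by move=> x _; exists x; apply: open_nbhs_nbhs; have [] := WP x.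
pose U (i : 'I_(size s)) := W (nth 0 s i).
have [||J [V [oV cV rV dV]]] := @dimG _ U.
- by move=> i; have [] := WP (nth 0 s i).
- apply/seteqP; split=> // x _; have [y ys Wy] := sP x Logic.I.
  have iy : (index y s < size s)%N by rewrite index_mem.
  by exists (Ordinal iy) => //; rewrite /U /= nth_index.
exists J, V; split=> // [x|j].
  by have : setT x by []; rewrite -cV => -[j _ Vx]; exists j.
have [i VU] := rV j; have [_ _ sW] := WP (nth 0 s i).
by move=> x y k /VU Vx /VU Vy; exact: sW.
Qed.

(** Kuhn's lemma yields [r.+1] differently labelled, hence distinct, cover elements with a common
    point. The [f i] are additive and continuous on [D] only, so that the bound serves both
    characters of the whole group and the coordinates of a quotient of [D]. *)
Lemma dimension_bound : (r <= n)%N.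
Proof.
have [J [V [oV cV sV dV]]] := small_cover.
have /choice[j0 j0P] := cV.
have [x _|N [zN NP]] := @compact_lebesgue G [set: G] (fun x => [set u | V (j0 x) (x + u)]) cG.
  by apply: nbhs_addl; apply: open_nbhs_nbhs; split=> //; exact: j0P.
have {}NP y : exists j, forall w, N w -> V j (y + w).
  have [x _ xP] := NP y Logic.I; exists (j0 x) => w /xP /=.
  by rewrite subrKC.
have /choice[jx jxP] := NP.
have [N' [zN' N'N _ NN']] := nbhs0_half zN.
have [W [zW WN]] := nbhs0_sums r zN'.
have [e [e0 eP]] := f_open zW.
have [e' [e'0 e'P]] : exists e' : RR, 0 < e' /\ forall t, `|t - 0| < e' -> 1 - e < re (angle t).
  apply: (@nbhs_real RR 0 [set t | 1 - e < re (angle t)]).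
  have cre : continuous (fun t : RR => re (angle t)).
    move=> t; apply: (continuous_comp (@angle_continuous t)).
    exact: cvg_fst.
  have := @continuous_near RR RR _ 0 e cre e0.
  by apply: filterS => t /=; rewrite angle0 re0 ltr_norml => /andP[+ _]; rewrite ltrBrDl.
have [M Me'] := @inv_natr_small RR e' e'0.
(* With this step, [M.+1] steps make a quarter turn, where the real part is 0. *)
pose t : RR := M.+1%:R^-1 / 4.
have tM : t *+ M.+1 = 4^-1.
  by rewrite -[_ *+ M.+1]mulr_natl /t mulrA mulfV ?mul1r// pnatr_eq0.
have re_t : 1 - e < re (angle t).
  apply: e'P; have M0 : (0 : RR) < M.+1%:R^-1 by rewrite invr_gt0 ltr0n.
  rewrite subr0 ger0_norm; last by rewrite /t divr_ge0// ltW.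
  by apply: lt_trans Me'; rewrite /t ltr_pdivrMr // ltr_pMr // ltr1n.
have /choice[x xP] : forall i, exists x, [/\ D x, W x &
    forall k, f k x = if k == i then angle t else 0].
  by move=> i; apply: eP => k; case: ifP => _//; rewrite re0; lra.
pose P (w : 'I_r -> nat) := \sum_i x i *+ w i.
have DP w : D (P w).
  by apply: (subgroup_sum sD) => i; have [Dx_ _ _] := xP i; exact: (subgroupMn sD).
have f0 k : f k 0 = 0.
  by apply: (addrI (f k 0)); rewrite -f_add ?addr0//; exact: sD.1.
have fP w k : f k (P w) = angle (t *+ w k).
  have fMn y m : D y -> f k (y *+ m) = f k y *+ m.
    move=> Dy; elim: m => [//|m IHm]; rewrite !mulrS f_add ?IHm//.
    exact: (subgroupMn sD).
  have fsum (s : seq 'I_r) : f k (\sum_(i <- s) x i *+ w i) = \sum_(i <- s) f k (x i) *+ w i.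
    elim: s => [|i s IHs]; first by rewrite !big_nil.
    have [Dx _ _] := xP i.
    rewrite !big_cons f_add ?IHs ?fMn//; first exact: (subgroupMn sD).
    by apply: (subgroup_sum sD) => j; have [Dx_ _ _] := xP j; exact: (subgroupMn sD).
  rewrite /P fsum (bigD1 k)//= big1 ?addr0 => [|i ik].
    by have [_ _ ->] := xP k; rewrite eqxx -angleMn.
  by have [_ _ ->] := xP i; rewrite eq_sym (negbTE ik) mul0rn.
(* A cover element is labelled by the first coordinate [i] for which it meets
   [f i = 0]; being small, it does not meet the opposite face. *)
pose meets j i := `[< exists y, [/\ V j y, D y & re (f i y) = 1] >].
pose lab j := find (meets j) (enum 'I_r).
pose l w := lab (jx (P w)).
have VP w u : N u -> V (jx (P w)) (P w + u) by exact: jxP.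
have VP0 w : V (jx (P w)) (P w).
  by rewrite -[X in V _ X]addr0; apply: VP; exact: nbhs_singleton.
have ll : kuhn_labelling M.+1 l.
  move=> w wM; split.
  - by rewrite /l /lab -[X in (_ <= X)%N](size_enum_ord r) find_size.
  - move=> i wi; rewrite leqNgt; apply/negP => /(before_find i).
    rewrite nth_ord_enum => /asboolP; apply; exists (P w); split=> //.
    by rewrite fP wi mulr0n angle0.
  - move=> i wi; apply/eqP => li.
    have hs : has (meets (jx (P w))) (enum 'I_r).
      by rewrite has_find size_enum_ord -/(lab _) -/(l w) li.
    have := nth_find i hs; rewrite -/(lab _) -/(l w) li nth_ord_enum.
    move=> /asboolP[y [Vy Dy fy]].
    have := sV _ y (P w) i Vy (VP0 w) Dy (DP w).
    rewrite fy fP wi tM /re /=.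
    have -> : pi * 2 * 4^-1 = pi / 2 :> RR by field.
    by rewrite cos_pihalf subr0 normr1 ltxx.
have [v _ vP] := kuhn ll.
have /choice[w wP] : forall c : 'I_r.+1, exists w : 'I_r -> nat,
    (forall i, (v i <= w i <= (v i).+1)%N) /\ l w = c.
  by move=> c; have [|w w1 w2] := vP c; [exact: leq_ord|exists w].
(* Each [F c] contains the whole translate of [P (w c)] by [N]; since [P v] differs from [P (w c)]
   by a sum of at most one lifted step per coordinate, it lies in all of them. *)
pose F c := jx (P (w c)).
have Finj : injective F.
  move=> a b ab; apply: val_inj; rewrite /= -(wP a).2 -(wP b).2.
  by rewrite /l -/(F a) ab.
have FV c : F c \in [set j : J | `[< V j (P v) >]].
  rewrite inE; apply/asboolP; have [vw _] := wP c.
  have -> : P v = P (w c) + - \sum_i x i *+ (w c i - v i).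
    rewrite /P -sumrB; apply: eq_bigr => i _; have /andP[vi _] := vw i.
    by rewrite mulrnBr// opprB addrC subrK.
  apply: VP; apply: NN'; apply: N'N; apply: WN => i; have [_ Wx _] := xP i.
  have /andP[vi wi] := vw i.
  have : (w c i - v i <= 1)%N by rewrite leq_subLR addn1.
  by case: (w c i - v i)%N => [_|[|//] _]; [exact: nbhs_singleton|].
have : (#|codom F| <= n.+1)%N.
  apply: leq_trans (dV (P v)); apply: subset_leq_card.
  by apply/fintype.subsetP => _ /codomP[c ->]; exact: FV.
by rewrite card_codom// card_ord ltnS.
Qed.

End DimensionBound.

(** * Separation of points *)

Lemma dalembert_character (G : topologicalZmodType) (c : G -> RR) :
  continuous c -> c 0 = 1 -> (forall x, c x ^+ 2 <= 1) ->
  (forall x y, c (x + y) + c (x - y) = 2 * c x * c y) ->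
  exists chi, character chi /\ forall x, re (chi x) = c x.
Proof.
move=> cc c0 c_le1 dA.
have cN x : c (- x) = c x by have := dA 0 x; rewrite add0r sub0r c0; lra.
have c2 x : c (x + x) = 2 * c x ^+ 2 - 1.
  by have := dA x x; rewrite subrr c0; lra.
suff [s [cs sE addc adds]] : exists s : G -> RR, [/\ continuous s,
    forall x, c x ^+ 2 + s x ^+ 2 = 1,
    forall x y, c (x + y) = c x * c y - s x * s y &
    forall x y, s (x + y) = c x * s y + s x * c y].
  exists (fun x => exist _ (c x, s x) (sE x) : circ); split=> //; split=> // x y.
  by apply: circ_eq; [exact: addc|exact: adds].
(* [s x] is to be the sine of an angle with cosine [c x], fixed by its value at
   a point [a] where it does not vanish. *)
have [[a ca]|/forallNP na] := pselect (exists a, c a ^+ 2 != 1); last first.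
  have csq x : c x ^+ 2 = 1 by apply: contrapT => /eqP; exact: na.
  exists (fun _ => 0); split=> [x|x|x y|x y]; first exact: cvg_cst.
  - by rewrite expr0n addr0.
  - by have := csq (x + y); have := csq (x - y); have := csq x; have := csq y;
      have := dA x y; nra.
  - by rewrite mulr0 mul0r addr0.
have ca1 : c a ^+ 2 < 1 by rewrite lt_neqAle ca c_le1.
pose g := Num.sqrt (1 - c a ^+ 2).
have g0 : 0 < g by rewrite sqrtr_gt0 subr_gt0.
have gg : g ^+ 2 = 1 - c a ^+ 2 by rewrite sqr_sqrtr// subr_ge0 ltW.
have gn0 : g != 0 by rewrite gt_eqF.
(* From [cos (u - v) - cos (u + v) = 2 sin u sin v], with [g] playing the sine at [a]. *)
pose s x := (c (x - a) - c (x + a)) / (2 * g).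
have s2 x : 2 * g * s x = c (x - a) - c (x + a) by rewrite /s; field.
have addc x y : c (x + y) = c x * c y - s x * s y.
  have h1 := dA (x - a) (y - a); have h2 := dA (x - a) (y + a).
  have h3 := dA (x + a) (y - a); have h4 := dA (x + a) (y + a).
  have h5 := dA (x + y) (a + a); have h6 := dA (x - y) (a + a); have h7 := dA x y.
  have ss : 2 * g * s x * (2 * g * s y) =
      (c (x - a) - c (x + a)) * (c (y - a) - c (y + a)) by rewrite !s2.
  rewrite (_ : x - a + (y - a) = x + y - (a + a)) in h1; last by rewrite addrACA opprD.
  rewrite (_ : x - a - (y - a) = x - y) in h1; last by rewrite opprB addrA subrK.
  rewrite (_ : x - a + (y + a) = x + y) in h2; last by rewrite addrACA addNr addr0.
  rewrite (_ : x - a - (y + a) = x - y - (a + a)) in h2; last by rewrite !opprD addrACA.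
  rewrite (_ : x + a + (y - a) = x + y) in h3; last by rewrite addrACA subrr addr0.
  rewrite (_ : x + a - (y - a) = x - y + (a + a)) in h3; last by rewrite opprB [a - y]addrC addrACA.
  rewrite (_ : x + a + (y + a) = x + y + (a + a)) in h4; last by rewrite addrACA.
  rewrite (_ : x + a - (y + a) = x - y) in h4; last by rewrite opprD addrACA subrr addr0.
  have ca2 : c (a + a) = 1 - 2 * g ^+ 2 by rewrite c2 gg; ring.
  rewrite ca2 in h5 h6.
  have g2 : g ^+ 2 != 0 by rewrite expf_neq0.
  apply: (mulfI g2).
  have E : 4 * (g ^+ 2 * (s x * s y)) = 2 * g ^+ 2 * (c (x - y) - c (x + y)).
    have -> : 4 * (g ^+ 2 * (s x * s y)) = 2 * g * s x * (2 * g * s y) by ring.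
    rewrite ss; lra.
  have h8 : c (x - y) = 2 * c x * c y - c (x + y) by lra.
  rewrite h8 in E; lra.
have adds x y : s (x + y) = c x * s y + s x * c y.
  have h1 := dA (x - a) y; have h2 := dA (x + a) y.
  have h3 := dA x (y - a); have h4 := dA x (y + a).
  rewrite [x - a + y]addrAC [x - a - y]addrAC in h1.
  rewrite [x + a + y]addrAC [x + a - y]addrAC in h2.
  rewrite addrA opprB [a - y]addrC addrA in h3.
  rewrite addrA opprD addrA in h4.
  apply: (mulfI gn0); have := s2 (x + y); have := s2 x; have := s2 y; nra.
exists s; split=> // [|x].
  have cs1 b : continuous (fun x => c (x + b)).
    move=> x; apply: (@continuous_comp _ _ _ (fun x => x + b) c); last exact: cc.
    exact: translation_continuous.
  have := @continuous_mul RR G _ (fun _ => (2 * g)^-1)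
    (@continuous_sub RR G _ _ (cs1 (- a)) (cs1 a)); apply.
  by move=> x; exact: cvg_cst.
have := addc x (- x); rewrite subrr c0 cN.
have -> : s (- x) = - s x; last by move=> ->; ring.
rewrite /s -mulNr opprB; congr (_ / _).
by rewrite -(cN (- x - a)) -(cN (- x + a)) !opprD !opprK.
Qed.

(** * Open maps and connected components *)

Lemma characters_separate (G : topologicalZmodType) (x : G) :
  hausdorff_space G -> compact [set: G] -> x != 0 ->
  exists chi, character chi /\ chi x != 0.
Proof.
move=> hG cG x0; have [m mP] := invariant_mean_exists G RR.
have [c [cc c0 cx c1 dA]] := dalembert_separate cG mP hG x0.
have [chi [cchi re_chi]] := dalembert_character cc c0 c1 dA.
exists chi; split=> //; apply/eqP => chix.
by move: cx; rewrite -re_chi chix re0 eqxx.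
Qed.

(** The fibres of [f] on [A] are orbits of the maps [g i], so the union of the preimages of [W]
    under them is an open saturated set. Its complement in [A] is compact and has a closed image,
    which is exactly what [f @] U[omits from]f @[A]. *)
Lemma orbit_map_open (S T : topologicalType) (I : Type) (A : set S) (f : S -> T)
    (g : I -> S -> S) : hausdorff_space T -> compact A -> {within A, continuous f} ->
  (forall i, continuous (g i)) -> (forall i x, A x -> A (g i x) /\ f (g i x) = f x) ->
  (forall x y, A x -> A y -> f x = f y -> exists i, y = g i x) ->
  forall U, ropen A U -> ropen (f @` A) (f @` U).
Proof.
move=> hT cA cf cg gA orb U [W [oW ->]].
pose O := \bigcup_i (g i @^-1` W).
have oO : open O by apply: bigcup_open => i _; apply: open_comp => // x _; exact: cg.
have clF : closed (f @` (A `&` ~` O)).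
  apply: compact_closed => //; apply: continuous_compact.
    by apply: continuous_subspaceW cf => x [].
  by apply: compact_closedI => //; exact: open_closedC.
exists (~` (f @` (A `&` ~` O))); split; first exact: closed_openC.
apply/seteqP; split=> [_ [x [Wx Ax] <-]|y [/= nF [x Ax xy]]].
  split; last by exists x.
  move=> [z [Az nOz] zx]; apply: nOz.
  by have [i ix] := orb z x Az Ax zx; exists i => //=; rewrite -ix.
have [i _ /= Wx] : O x by apply: contrapT => nO; apply: nF; exists x.
by exists (g i x); [split=> //; exact: (gA i x Ax).1|rewrite (gA i x Ax).2 xy].
Qed.

(** * Quasi-components of compact Hausdorff spaces *)

Section ClopenNeighbourhoods.
Variable T : topologicalType.
Hypotheses (hT : hausdorff_space T) (cT : compact [set: T]).
Variable x0 : T.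

Definition quasi_component : set T := [set x | forall P, clopen P -> P x0 -> P x].

Lemma quasi_component_clopen (O : set T) : open O -> quasi_component `<=` O ->
  exists P, [/\ clopen P, P x0 & P `<=` O].
Proof.
move=> oO QO.
have cO : compact (~` O).
  by rewrite -[X in compact X]setTI; apply: compact_closedI => //; exact: open_closedC.
have [|s sP] := @compact_fin_cover T (set T) (~` O)
    (fun P => [set x | [/\ clopen P, P x0 & ~ P x]]) cO.
  move=> x nOx; have /existsNP[P /not_implyP[cP /not_implyP[P0 nPx]]] :
      ~ quasi_component x by move/QO.
  exists P; apply: filterS (_ : nbhs x (~` P)) => [y //|].
  by apply: open_nbhs_nbhs; split=> //; exact: closed_openC cP.2.
pose good P := clopen P /\ P x0.
exists (\bigcap_(P in [set P | P \in s /\ good P]) P); split.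
- elim: s {sP} => [|P s IHs].
    rewrite (_ : [set _ | _] = set0) ?bigcap_set0; first exact: clopenT.
    by apply/seteqP; split=> // P [].
  have [gP|ngP] := pselect (good P); last first.
    rewrite (_ : [set _ | _] = [set P | P \in s /\ good P])//.
    apply/seteqP; split=> Q [Qs gQ]; split=> //; last by rewrite inE Qs orbT.
    by move: Qs; rewrite inE => /predU1P[QP|//]; case: ngP; rewrite -QP.
  rewrite (_ : \bigcap_(_ in _) _ = P `&` \bigcap_(Q in [set Q | Q \in s /\ good Q]) Q).
    by apply: clopenI => //; exact: gP.1.
  apply/seteqP; split=> [y yP|y [Py yP] Q [Qs gQ]].
    split; first by apply: yP; split=> //; rewrite inE eqxx.
    by move=> Q [Qs gQ]; apply: yP; split=> //; rewrite inE Qs orbT.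
  by move: Qs; rewrite inE => /predU1P[->//|Qs]; exact: yP.
- by move=> P [_ [_ P0]].
- move=> y yP; apply: contrapT => /sP[P Ps [cP P0 nPy]]; apply: nPy.
  by apply: yP; split.
Qed.

(** Normality puts two closed pieces into disjoint open sets, and compactness gives a clopen
    neighbourhood of [x0] inside their union. Its trace on the open set containing [x0] is again
    clopen, so it swallows the whole quasi-component. *)
Lemma quasi_component_connected : connected quasi_component.
Proof.
have Q0 : quasi_component x0 by [].
have clQ : closed quasi_component.
  rewrite (_ : quasi_component = \bigcap_(P in [set P | clopen P /\ P x0]) P).
    by apply: closed_bigI => P [[]].
  by apply/seteqP; split=> x Qx P; [move=> [cP P0]|move=> cP P0]; apply: Qx.
move=> B [b Bb] [ O oO BO] [F clF BF].
have clB : closed B by rewrite BF; exact: closedI.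
have clB' : closed (quasi_component `&` ~` O).
  by apply: closedI => //; exact: open_closedC.
have [|V1 [V2 [oV1 oV2 BV1 BV2 V12]]] := (@normal_openP RR T).1 (compact_normal hT cT)
    B (quasi_component `&` ~` O) clB clB'.
  by rewrite -subset0 => x [+ [_ nO]]; rewrite BO => -[].
have QV : quasi_component `<=` V1 `|` V2.
  move=> x Qx; have [Ox|nOx] := pselect (O x); [left|right].
    by apply: BV1; rewrite BO.
  by apply: BV2.
have [P [cP P0 PV]] := quasi_component_clopen (openU oV1 oV2) QV.
have disj x : V1 x -> V2 x -> False.
  by move=> v1 v2; have : (V1 `&` V2) x by []; rewrite V12.
have clop U V : open U -> open V -> (forall x, U x -> V x -> False) ->
    P `<=` U `|` V -> clopen (P `&` U).
  move=> oU oV UV PUV; split; first by apply: openI => //; exact: cP.1.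
  rewrite (_ : P `&` U = P `&` ~` V).
    by apply: closedI; [exact: cP.2|exact: open_closedC].
  apply/seteqP; split=> x [Px]; split=> //; first by move=> Vx; exact: UV Vx.
  by have [//|] := PUV x Px.
have [v1|v2] := QV _ Q0.
  have cPV := clop _ _ oV1 oV2 disj PV.
  apply/seteqP; split=> [x|x Qx]; first by rewrite BO => -[].
  rewrite BO; split=> //; apply: contrapT => nOx.
  have [_ v1x] := Qx _ cPV (conj P0 v1); apply: (disj x v1x).
  by apply: BV2.
have cPV := clop _ _ oV2 oV1 (fun x v w => disj x w v) ltac:(by rewrite setUC).
have Qb : quasi_component b by move: Bb; rewrite BO => -[].
by have [_ v2b] := Qb _ cPV (conj P0 v2); case: (disj b) => //; exact: BV1.
Qed.

End ClopenNeighbourhoods.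

(** * Characters and the component of the identity *)

Section IdentityComponent.
Variable K : topologicalZmodType.
Let C := conn0 K.

Lemma conn0_max (E : set K) : connected E -> E 0 -> E `<=` C.
Proof. by move=> cE E0; apply: connected_component_max. Qed.

Lemma conn0_id : C 0.
Proof. exact: connected_component_refl. Qed.

Lemma conn0_connected : connected C.
Proof. exact: component_connected. Qed.

Lemma conn0_closed : closed C.
Proof. by apply: component_closed; exact: closedT. Qed.

Lemma translate_connected (E : set K) x : connected E -> connected [set y - x | y in E].
Proof.
move=> cE; apply: connected_continuous_connected cE _.
by apply: continuous_subspaceT; exact: translation_continuous.
Qed.

Lemma conn0_subgroup : subgroup C.
Proof.
split; first exact: conn0_id.
move=> x y Cx Cy; apply: (conn0_max (translate_connected (x := y) conn0_connected)).
  by exists y; rewrite ?subrr.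
by exists x.
Qed.

Lemma char_torsion_open (chi : K -> circ) n : character chi ->
  nbhs 0 [set x | forall k : 'I_n, 0 < re (chi x *+ k)].
Proof.
move=> cchi; apply: filter_forall => k.
have := char_nbhs (subgroupMn (@character_subgroup K) k cchi) ltr01.
by apply: filterS => x; rewrite /= subrr pmulrn fun_mulrz -pmulrn.
Qed.

Lemma circ_torsion_small (z : circ) n : (0 < n)%N -> z *+ n = 0 ->
  (forall k : 'I_n, 0 < re (z *+ k)) -> z = 0.
Proof.
move=> n0 zn zk; apply: circ_NSS => m.
rewrite (divn_eq m n) mulrnDr mulnC mulrnA zn mul0rn add0r.
exact: (zk (Ordinal (ltn_pmod m n0))).
Qed.

(** The values of [chi] on [E] are n-torsion, so its kernel in [E], a closed set, is also cut out by
    the open conditions that the multiples of [chi] below [n] have positive real part. Connectedness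
    makes it all of [E]. *)
Lemma connected_torsion (E : set K) (chi : K -> circ) n : connected E -> E 0 ->
  character chi -> (0 < n)%N -> trivial_on E (chi *+ n) -> trivial_on E chi.
Proof.
move=> cE E0 cchi n0 tn.
pose B := E `&` [set x | chi x = 0].
have BE : B = E; last by move=> x; rewrite -BE => -[].
apply: cE; first by exists 0; split=> //; exact: char0.
- pose O := \bigcap_(k in [set: 'I_n]) [set x | 0 < re ((chi *+ k) x)].
  exists O; last first.
    apply/seteqP; split=> x [Ex xP]; split=> //.
      by move=> k _; rewrite /= pmulrn fun_mulrz xP mul0rz re0.
    apply: (circ_torsion_small n0).
      by have := tn x Ex; rewrite pmulrn fun_mulrz -pmulrn.
    by move=> k; have := xP k Logic.I; rewrite /= pmulrn fun_mulrz -pmulrn.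
  rewrite openE => x xO; have : nbhs x [set y | forall k : 'I_n, 0 < re ((chi *+ k) y)].
    apply: filter_forall => k; apply: open_nbhs_nbhs; split; last exact: xO.
    have ck := subgroupMn (@character_subgroup K) k cchi.
    apply: (@open_comp _ _ (fun y => re ((chi *+ k) y)) [set t : RR | 0 < t]).
      by move=> y _; exact: char_re.
    exact: open_gt.
  by apply: filterS => y yk k _; exact: yk.
- by exists [set x | chi x = 0] => //; exact: char_ker_closed.
Qed.

(** Some clopen [P] containing 0 lies where [re (chi x)] is positive. Being compact and open, [P]
    absorbs a neighbourhood [W] of 0, so all multiples of a point of [W] stay in [P], and the circle
    has no small subgroups. *)
Lemma char_trivial_conn0_open (chi : K -> circ) : hausdorff_space K ->
  compact [set: K] -> character chi -> trivial_on C chi -> nbhs 0 [set x | chi x = 0].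
Proof.
move=> hK cK cchi tC.
have QC : quasi_component 0 `<=` C.
  by apply: conn0_max => //; exact: quasi_component_connected.
pose O := [set x | 0 < re (chi x)].
have oO : open O.
  apply: (@open_comp _ _ (fun y => re (chi y)) [set t : RR | 0 < t]).
    by move=> y _; exact: char_re.
  exact: open_gt.
have QO : quasi_component 0 `<=` O by move=> x /QC/tC; rewrite /O /= => ->; rewrite re0.
have [P [cP P0 PO]] := quasi_component_clopen cK oO QO.
have cpP : compact P by rewrite -[P]setTI; apply: compact_closedI => //; exact: cP.2.
have [x Px|W [zW WP]] := @compact_lebesgue K P (fun x => [set u | P (x + u)]) cpP.
  by apply: nbhs_addl; apply: open_nbhs_nbhs; split=> //; exact: cP.1.
apply: filterS zW => w Ww; apply: circ_NSS => n; rewrite -charMn//; apply: PO.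
elim: n => [//|n IHn]; have [x _ xP] := WP _ IHn.
by have := xP w Ww; rewrite /= subrKC mulrSr.
Qed.

End IdentityComponent.

(** * Maximal independent families *)

(** Off the translates of [U] by the joint kernel, which form a neighbourhood of it, some coordinate
    stays away from 0 by a uniform amount, by compactness. A preimage of a point closer to 0 than
    that can be moved into [U] by an element of the kernel. *)
Lemma coordinates_open (G : topologicalZmodType) r (D : set G) (f : 'I_r -> G -> circ) :
  compact D -> subgroup D ->
  (forall i x y, D x -> D y -> f i (x + y) = f i x + f i y) ->
  (forall i x (e : RR), D x -> 0 < e ->
     nbhs x [set y | D y -> `|re (f i y) - re (f i x)| < e]) ->
  (forall z : 'I_r -> circ, exists2 x, D x & forall i, f i x = z i) ->
  forall U : set G, nbhs 0 U -> exists e : RR, 0 < e /\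
    forall z : 'I_r -> circ, (forall i, 1 - e < re (z i)) ->
    exists x, [/\ D x, U x & forall i, f i x = z i].
Proof.
move=> cD sD fD fc onto U zU.
pose ker k := D k /\ forall i, f i k = 0.
pose O := \bigcup_(k in ker) [set x | U° (x - k)].
have oO : open O.
  apply: bigcup_open => k _; apply: (@open_comp _ _ (fun x => x - k) U°).
    by move=> x _; exact: translation_continuous.
  exact: open_interior.
have cDO : compact (D `&` ~` O) by apply: compact_closedI => //; exact: open_closedC.
have [|s sP] := @compact_fin_cover G nat (D `&` ~` O)
    (fun n => [set y | D y -> exists i, n.+1%:R^-1 < 1 - re (f i y)]) cDO.
  move=> x [Dx nOx]; have [i xi] : exists i, f i x <> 0.
    apply: contrapT => /forallNP xk; apply: nOx; exists x.
      by split=> // i; apply: contrapT; exact: xk.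
    by rewrite /= subrr; exact: nbhs_singleton (nbhs_interior zU).
  have d0 : 0 < (1 - re (f i x)) / 2.
    rewrite divr_gt0// subr_gt0 lt_neqAle re_le1 andbT.
    by apply/eqP => /re1P.
  have [n nd] := @inv_natr_small RR _ d0; exists n.
  have := fc i x _ Dx d0; apply: filterS => y yP /yP; rewrite ltr_norml => /andP[_ h].
  exists i; apply: lt_le_trans nd _; move: h; clear; lra.
pose N := (\sum_(n <- s) n)%N; exists N.+1%:R^-1; split=> [|z zP].
  by rewrite invr_gt0 ltr0n.
have [x Dx xz] := onto z.
have [k [Dk k0] /= /interior_subset Uxk] : O x.
  apply: contrapT => nOx; have [n ns /(_ Dx)[i ni]] := sP x (conj Dx nOx).
  have nN : (n <= N)%N by rewrite /N (big_rem n)//= leq_addr.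
  have Nn : N.+1%:R^-1 <= n.+1%:R^-1 :> RR by rewrite lef_pV2 ?posrE ?ltr0n// ler_nat.
  move: (zP i); rewrite -xz ltrBlDr -ltrBlDl => zi.
  by have := lt_trans zi (le_lt_trans Nn ni); rewrite ltxx.
exists (x - k); split=> //; first exact: subgroupB.
move=> i; have := fD i (x - k) k (subgroupB sD Dx Dk) Dk.
by rewrite subrK k0 addr0 xz => ->.
Qed.

Lemma cval_continuous_family (G : topologicalType) r (psi : 'I_r -> G -> circ) :
  (forall i, continuous (fun x => cval (psi i x))) ->
  continuous (fun x => (fun i => cval (psi i x)) : {ptws 'I_r -> (RR * RR)%type}).
Proof.
move=> cpsi x; apply/cvg_sup => i V [B [[W oW <-] Wx] BV].
apply: filterS BV _; apply: (cpsi i x); apply: open_nbhs_nbhs; split=> //.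
Qed.

Lemma ptws_hausdorff (I : eqType) : hausdorff_space {ptws I -> (RR * RR)%type}.
Proof.
apply: (@hausdorff_product I (fun=> (RR * RR)%type)) => i.
by apply: hausdorff_prod; exact: Rhausdorff.
Qed.

Section SolenoidalKernels.
Variable K : topologicalZmodType.
Hypotheses (hK : hausdorff_space K) (cK : compact [set: K]).
Let C := conn0 K.

Lemma closed_compact (A : set K) : closed A -> compact A.
Proof. by move=> clA; rewrite -[A]setTI; exact: compact_closedI. Qed.

Lemma char_coordinates_open r (psi : 'I_r -> K -> circ) D :
  (forall i, character (psi i)) -> closed D -> subgroup D -> independent_on D psi ->
  forall U : set K, nbhs 0 U -> exists e : RR, 0 < e /\
    forall z : 'I_r -> circ, (forall i, 1 - e < re (z i)) ->
    exists x, [/\ D x, U x & forall i, psi i x = z i].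
Proof.
move=> cpsi clD sD ind; have cD := closed_compact clD.
apply: coordinates_open => //.
- by move=> i x y _ _; exact: charD.
- move=> i x e _ e0; have := @continuous_near RR K _ x e (char_re (cpsi i)) e0.
  by apply: filterS => y ? _.
- exact: independent_onto.
Qed.

Lemma independent_dim r (psi : 'I_r -> K -> circ) D n : covering_dim_le K n ->
  (forall i, character (psi i)) -> closed D -> subgroup D -> independent_on D psi ->
  (r <= n)%N.
Proof.
move=> dK cpsi clD sD ind; apply: (@dimension_bound K cK n r D psi) => //.
- by move=> i x y _ _; exact: charD.
- move=> i x e _ e0; have := @continuous_near RR K _ x e (char_re (cpsi i)) e0.
  by apply: filterS => y ? _.
- exact: char_coordinates_open.
Qed.

(** The dimension bounds the size of independent families, so one of largest size exists. Adjoining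
    [chi] to it creates a relation in which the coefficient of [chi] cannot vanish. *)
Lemma maximal_independent D : finite_dim K -> closed D -> subgroup D ->
  exists r (psi : 'I_r -> K -> circ), [/\ (forall i, character (psi i)),
    independent_on D psi &
    forall chi, character chi -> exists m (k : 'I_r -> int), (0 < m)%N /\
      trivial_on D (chi *+ m - \sum_i psi i *~ k i)].
Proof.
move=> [n dK] clD sD.
pose P r := `[< exists psi : 'I_r -> K -> circ, (forall i, character (psi i)) /\
  independent_on D psi >].
have Pn r : P r -> (r <= n)%N.
  by move=> /asboolP[psi [cpsi ind]]; exact: (independent_dim dK cpsi clD sD ind).
have P0 : exists r, P r.
  by exists 0%N; apply/asboolP; exists (fun _ => 0); split=> [[]|k _ []].
case: (ex_maxnP P0 Pn) => r /asboolP[psi [cpsi ind]] rmax.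
exists r, psi; split=> // chi cchi.
pose psi' i := if unlift (ord0 : 'I_r.+1) i is Some j then psi j else chi.
have cpsi' i : character (psi' i) by rewrite /psi'; case: unliftP.
have : ~ independent_on D psi'.
  move=> ind'; have : (r.+1 <= r)%N; last by rewrite ltnn.
  by apply: rmax; apply/asboolP; exists psi'.
move=> /existsNP[l /not_implyP[tl /existsNP[i0 li0]]].
have lE x : D x -> chi x *~ l ord0 + \sum_i psi i x *~ l (lift ord0 i) = 0.
  move=> /tl; rewrite combE big_ord_recl /psi' unlift_none.
  by under eq_bigr do rewrite liftK.
have l0 : l ord0 != 0.
  apply/eqP => l0; apply: li0.
  have lk : forall i, l (lift ord0 i) = 0.
    by apply: ind => x Dx; rewrite combE -[RHS](lE x Dx) l0 mulr0z add0r.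
  by case: (unliftP ord0 i0) => [j ->|->].
pose s : int := - sgz (l ord0).
exists `|l ord0|%N, (fun i => s * l (lift ord0 i)); split; first by rewrite absz_gt0.
move=> x Dx.
change ((chi *+ `|l ord0|%N) x - (\sum_i psi i *~ (s * l (lift ord0 i))) x = 0).
rewrite combE pmulrn fun_mulrz; apply/eqP; rewrite subr_eq0; apply/eqP.
under eq_bigr do rewrite [s * _]mulrC mulrzA.
rewrite -mulrz_suml abszEsg mulrC mulrzA.
have := lE x Dx; move=> /eqP; rewrite addr_eq0 => /eqP ->.
by rewrite /s mulrNz mulNrz.
Qed.

(** A component of [N], translated to contain 0, is a connected subset of [N] and [C]. Each
    character is torsion on it, hence trivial, and characters separate points. *)
Lemma torsion_kernel_totally_disconnected (N : set K) : subgroup N ->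
  (forall chi, character chi -> exists2 m, (0 < m)%N & trivial_on (N `&` C) (chi *+ m)) ->
  totally_disconnected N.
Proof.
move=> sN tN x Nx; apply/seteqP; split=> [y yx|_ ->]; last exact: connected_component_refl.
pose E := [set z - x | z in connected_component N x].
have cE : connected E by apply: translate_connected; exact: component_connected.
have E0 : E 0 by exists x; [exact: connected_component_refl|rewrite subrr].
have EN : E `<=` N.
  by move=> _ [z zx <-]; apply: subgroupB => //; exact: (connected_component_sub zx).
have EC : E `<=` C by exact: conn0_max.
apply: contrapT => /eqP; rewrite -subr_eq0 => yx0.
have [chi [cchi /eqP]] := characters_separate hK cK yx0; apply.
have [m m0 tm] := tN chi cchi.
apply: (connected_torsion cE E0 cchi m0); last by exists y.
by move=> z Ez; apply: tm; split; [exact: EN|exact: EC].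
Qed.

Lemma common_ker_delta r (psi : 'I_r -> K -> circ) D :
  (forall i, character (psi i)) -> closed D -> subgroup D -> independent_on D psi ->
  totally_disconnected (D `&` common_ker psi) ->
  delta_subgroup D (D `&` common_ker psi).
Proof.
move=> cpsi clD sD ind td; have cD := closed_compact clD.
split=> //.
- by apply: subgroupI => //; exact: common_ker_subgroup.
- by apply: closedI => //; exact: common_ker_closed.
exists 'I_r, (fun x i => cval (psi i x)).
have cpsif := cval_continuous_family (fun i => char_cval (cpsi i)).
have cont : {within D, continuous (fun x => (fun i => cval (psi i x)) :
    {ptws 'I_r -> (RR * RR)%type})} by exact: continuous_subspaceT.
have onto : (fun x => (fun i => cval (psi i x)) : {ptws 'I_r -> (RR * RR)%type}) @` D
    = circle_power 'I_r.
  apply/seteqP; split=> [_ [x Dx <-] i|g gP]; first exact: (svalP (psi i x)).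
  have [x Dx xg] := independent_onto cpsi cD clD sD ind
    (fun i => exist _ (g i) (gP i) : circ).
  by exists x => //; apply/funext => i; rewrite xg.
have kerE x : ((fun i => cval (psi i x)) = fun _ => cone) <-> common_ker psi x.
  split=> [px i|px]; first by apply: cval_inj; exact: (congr1 (fun g => g i) px).
  by apply/funext => i; rewrite px.
split=> //.
- split=> [x Dx i|x y _ _]; first exact: (svalP (psi i x)).
  by apply/funext => i; rewrite charD.
- by move=> x Dx; rewrite kerE; split=> [|[]].
move=> U oU; rewrite -onto.
apply: (orbit_map_open (I := {k | D k /\ common_ker psi k})
  (g := fun k x => x + sval k)) oU => //.
- exact: ptws_hausdorff.
- by move=> k; exact: translation_continuous.
- move=> [k [Dk kk]] x Dx /=; split; first exact: subgroupD.
  by apply/funext => i; rewrite charD// kk addr0.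
- move=> x y Dx Dy xy.
  have kyx : common_ker psi (y - x).
    move=> i; rewrite charB//; apply/eqP; rewrite subr_eq0; apply/eqP/cval_inj.
    exact: (congr1 (fun g => g i) (esym xy)).
  exists (exist _ (y - x) (conj (subgroupB sD Dy Dx) kyx)).
  by rewrite /= subrKC.
Qed.

End SolenoidalKernels.

(** * From quotients to local essentiality *)

(** The default 0 is not reached for the coordinates of points of [D], which the quotient map sends
    into the circle. *)
Definition to_circ (z : RR * RR) : circ :=
  if pselect (circle z) is left zP then exist _ z zP else 0.

Lemma to_circK z : circle z -> cval (to_circ z) = z.
Proof. by rewrite /to_circ; case: pselect. Qed.

Section DeltaQuotient.
Variables (K : topologicalZmodType) (D N : set K) (I : Type).
Variable f : K -> {ptws I -> (RR * RR)%type}.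
Hypotheses (cK : compact [set: K]) (clD : closed D) (sD : subgroup D).
Hypothesis qf : quotient_iso_circle_power D N I f.

Definition coord i x : circ := to_circ (f x i).

Lemma cval_coord i x : D x -> cval (coord i x) = f x i.
Proof. by move=> Dx; apply: to_circK; have [[fc _] _ _ _ _] := qf; exact: fc. Qed.

Lemma coordD i x y : D x -> D y -> coord i (x + y) = coord i x + coord i y.
Proof.
move=> Dx Dy; apply: cval_inj; rewrite cval_coord; last exact: subgroupD.
have [[_ fD] _ _ _ _] := qf.
by rewrite fD// -!cval_coord.
Qed.

Lemma coord0 i : coord i 0 = 0.
Proof. by apply: (addrI (coord i 0)); rewrite -coordD ?addr0//; exact: sD.1. Qed.

Lemma coord_continuous i x (e : RR) : D x -> 0 < e ->
  nbhs x [set y | D y -> `|re (coord i y) - re (coord i x)| < e].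
Proof.
move=> Dx e0; have [_ /subspace_continuousP/(_ x Dx) fc _ _ _] := qf.
have cp : continuous (fun g : {ptws I -> (RR * RR)%type} => (g i).1).
  move=> g; apply: (@continuous_comp _ _ _ (fun g : {ptws I -> (RR * RR)%type} => g i) fst).
    exact: (@proj_continuous {classic I} (fun=> (RR * RR)%type) i).
  exact: cvg_fst.
have near_x : nbhs x [set y | D y -> `|(f y i).1 - (f x i).1| < e].
  exact: fc _ (@continuous_near RR _ _ (f x) e cp e0).
apply: filterS near_x => y yP Dy.
by rewrite /re !cval_coord//; exact: yP.
Qed.

Lemma coord_onto r (h : 'I_r -> I) : injective h -> forall z : 'I_r -> circ,
  exists2 x, D x & forall k, coord (h k) x = z k.
Proof.
move=> hI z; have [_ _ fD _ _] := qf.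
pose g i : RR * RR := if pselect (exists k, h k = i) is left e then
  cval (z (projT1 (cid e))) else cone.
have gP : circle_power I g.
  by move=> i; rewrite /g; case: pselect => [e|_]; [exact: (svalP (z _))|exact: cone_circle].
have [x Dx xg] : (f @` D) g by rewrite fD.
exists x => // k; apply: cval_inj; rewrite cval_coord// xg /g.
by case: pselect => [e|[]]; [case: cid => k' /= /hI ->|exists k].
Qed.

(** The power of the circle in a delta-subgroup may have any index type; distinct coordinates
    satisfy the hypotheses of [dimension_bound], so there are at most [n] of them. *)
Lemma delta_index_finite n : covering_dim_le K n ->
  exists r (h : 'I_r -> I), forall i, exists k, h k = i.
Proof.
move=> dK; pose P r := `[< exists h : 'I_r -> I, injective h >].
have Pn r : P r -> (r <= n)%N.
  move=> /asboolP[h hI].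
  apply: (@dimension_bound K cK n r D (fun k => coord (h k))) => //.
  - by move=> k x y; exact: coordD.
  - by move=> k x e; exact: coord_continuous.
  - apply: coordinates_open => //.
    + exact: closed_compact.
    + by move=> k x y; exact: coordD.
    + by move=> k x e; exact: coord_continuous.
    + exact: coord_onto.
have P0 : exists r, P r.
  have h0 : 'I_0 -> I by case.
  by exists 0%N; apply/asboolP; exists h0 => -[].
case: (ex_maxnP P0 Pn) => r /asboolP[h hI] rmax; exists r, h => i.
apply: contrapT => ni; have : (r.+1 <= r)%N; last by rewrite ltnn.
apply: rmax; apply/asboolP.
exists (fun k => if unlift ord0 k is Some j then h j else i) => a b.
case: (unliftP ord0 a) => [a' ->|->]; case: (unliftP ord0 b) => [b' ->|->]//.
- by move=> /hI ->.
- by move=> e; case: ni; exists a'.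
- by move=> e; case: ni; exists b'.
Qed.

Lemma coord_ker x : D x -> (forall i, coord i x = 0) -> N x.
Proof.
move=> Dx x0; have [_ _ _ fN _] := qf; apply/(fN x Dx)/funext => i.
by rewrite -cval_coord// x0.
Qed.

Lemma ker_coord x y : D x -> D y -> N (x - y) -> forall i, coord i x = coord i y.
Proof.
move=> Dx Dy Nxy i; have [_ _ _ fN _] := qf.
have Dxy := subgroupB sD Dx Dy.
have := coordD i Dxy Dy; rewrite subrK => ->.
suff -> : coord i (x - y) = 0 by rewrite add0r.
by apply: cval_inj; rewrite cval_coord//; have /(fN _ Dxy) -> := Nxy.
Qed.

(* [D / N] has no small subgroups; [x m] stands for [x 1 *+ m] modulo [N]. *)
Lemma delta_no_small n : covering_dim_le K n -> exists W, [/\ open W, W 0 &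
  forall x : nat -> K, (forall m, D (x m) /\ W (x m)) ->
    (forall m i, coord i (x m) = coord i (x 1%N) *+ m) -> N (x 1%N)].
Proof.
move=> dK; have [r [h hs]] := delta_index_finite dK.
exists ([set y | forall k, D y -> `|re (coord (h k) y) - re (coord (h k) 0)| < 1]°); split.
- exact: open_interior.
- by apply: filter_forall => k; apply: coord_continuous => //; exact: sD.1.
move=> x xP xM; apply: coord_ker => [|i]; first exact: (xP 1%N).1.
have [k <-] := hs i; apply: circ_NSS => m; rewrite -xM.
have [Dx /interior_subset/(_ k Dx)] := xP m.
by rewrite coord0 re0 ltr_norml => /andP[+ _]; rewrite ltrBrDl subrr.
Qed.

End DeltaQuotient.

Lemma delta_locally_essential (K : topologicalZmodType) :
  compact [set: K] -> finite_dim K ->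
  (exists N : set K, delta_subgroup setT N /\ locally_essential_in (N `&` conn0 K) N) ->
  locally_essential_in (conn0 K) setT.
Proof.
move=> cK [n dK] [N [[_ sN clN _ [I [f qf]]] [V [zV VP]]]].
have sT : subgroup [set: K] by [].
have [W [oW W0 WP]] := delta_no_small cK closedT sT qf dK.
exists (V `&` W); split; first by apply: filterI => //; exact: open_nbhs_nbhs.
move=> X _ XVW sX clX X0.
have XN : X `<=` N.
  move=> x Xx; have := WP (fun m => x *+ m); rewrite mulr1n; apply=> [m|m i].
    by split=> //; exact: (XVW _ (subgroupMn sX m Xx)).2.
  elim: m => [|m IHm].
    exact: (coord0 sT qf).
  by rewrite !mulrS (coordD sT qf)// IHm.
have [|x [Xx [_ Cx] x0]] := VP X XN _ sX clX X0; first by move=> x /XVW[].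
by exists x.
Qed.

(** A small subgroup of [K] comes from the factor [N] alone, where essentiality of [L] applies; on
    [L] the graph relation exchanges a point [(m, 0)] for [- (0, j m)], whose image lies in the
    component. *)
Lemma quotient_locally_essential (K N : topologicalZmodType) (H : set K) (L : set N)
    (j : N -> K) (U : set K) (phi : N * K -> K) :
  hausdorff_space K -> compact [set: K] -> finite_dim K ->
  delta_subgroup (conn0 K) H ->
  compact [set: N] -> subgroup L -> closed L -> essential_in L setT ->
  top_iso_on L H j -> open U -> subgroup U ->
  quotient_iso_prod [set p | conn0 K p.2] (graph_on L j) U phi ->
  locally_essential_in (conn0 K) setT.
Proof.
set C := conn0 K => hK cK [n dK] [sHC sH _ _ [I [f qf]]] cN sL clL eL.
move=> [jD jI jL _ _] oU sU [phiD phic phiU phik phio].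
have clC : closed C := @conn0_closed K.
have sC : subgroup C := @conn0_subgroup K.
have [W [oW W0 WP]] := delta_no_small cK clC sC qf dK.
pose A := [set p : N * K | C p.2].
have A0 : A 0 by exact: sC.1.
have phi0 : phi 0 = 0.
  by apply: (addrI (phi 0)); rewrite -phiD ?addr0.
have AB p q : A p -> A q -> A (p - q) by move=> Ap Aq; exact: (subgroupB sC).
have phiB p q : A p -> A q -> phi (p - q) = phi p - phi q.
  move=> Ap Aq; apply/eqP; rewrite eq_sym subr_eq -phiD ?subrK//; exact: AB.
have phi_eq p q : A p -> A q -> phi p = phi q -> graph_on L j (p - q).
  move=> Ap Aq pq; apply/(phik _ (AB _ _ Ap Aq)).
  by rewrite phiB// pq subrr.
have graphH q : graph_on L j q -> H q.2.
  by move=> [Lq ->]; rewrite -jL; exists q.1.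
pose A' := A `&` [set p | W p.2].
have oA' : open (phi @` A').
  have [|O [oO ->]] := phio A'; last exact: openI.
  exists [set p : N * K | W p.2]; split; last by rewrite setIC.
  by apply: (@open_comp _ _ snd) => // p _; exact: cvg_snd.
have zA' : nbhs 0 (phi @` A').
  by apply: open_nbhs_nbhs; split=> //; exists 0 => //; split.
exists (phi @` A'); split=> // X _ XA' sX clX X0.
(* The multiples of [x] lift to pairs whose second components lie in [W] and are multiples of the
   first one modulo [H]. So the first one lies in [H], is some [j l], and subtracting [(l, j l)]
   removes it. *)
have XN x : X x -> exists m, x = phi (m, 0).
  move=> Xx.
  have /choice[p pP] : forall k, exists p, A' p /\ phi p = x *+ k.
    by move=> k; have [p A'p px] := XA' _ (subgroupMn sX k Xx); exists p.
  have Ap k : A (p k) := (pP k).1.1.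
  have Hp1 : H (p 1%N).2.
    apply: (WP (fun k => (p k).2)) => [k|k i]; first exact: (pP k).1.
    elim: k => [|k IHk].
      rewrite mulr0n -(coord0 sC qf i); apply: (ker_coord sC qf (Ap _) sC.1).
      apply: (graphH (p 0%N - 0)); apply: phi_eq => //.
      by rewrite (pP _).2 phi0.
    rewrite mulrS -IHk -(coordD sC qf i (Ap _) (Ap _)).
    apply: (ker_coord sC qf (Ap _)); first exact: (subgroupD sC (Ap _) (Ap _)).
    apply: (graphH (p k.+1 - (p 1%N + p k))); apply: phi_eq => //.
      exact: (subgroupD sC (Ap _) (Ap _)).
    rewrite (phiD (p 1%N) (p k) (Ap _) (Ap _)).
    by rewrite !(pP _).2 mulr1n mulrS.
  have [l Ll lp] : (j @` L) (p 1%N).2 by rewrite jL.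
  exists ((p 1%N).1 - l).
  have Al : A (l, j l) by rewrite /A /= lp; exact: Ap.
  have := phiB (p 1%N) (l, j l) (Ap _) Al.
  have -> : phi (l, j l) = 0 by apply/(phik _ Al).
  rewrite subr0 (pP _).2 mulr1n => <-; congr phi.
  by rewrite [p 1%N]surjective_pairing /= lp; congr pair; rewrite /= subrr.
pose X' := [set m | X (phi (m, 0))].
have AN m : A (m, 0) by [].
have sX' : subgroup X'.
  split; first by rewrite /X' /= phi0; exact: sX.1.
  move=> a b Xa Xb; rewrite /X' /=.
  have -> : (a - b, 0) = (a, 0) - (b, 0) :> N * K by congr pair; rewrite /= subrr.
  by rewrite phiB//; exact: subgroupB.
have clX' : closed X'.
  apply: (@closed_comp _ _ (fun m => phi (m, 0)) X) => // m _.
  move: phic => /subspace_continuousP/(_ (m, 0) (AN m)) phim V /phim.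
  rewrite /within /= => mV.
  have cN0 : continuous (fun m : N => (m, 0 : K)).
    by move=> a; apply: (@cvg_pair _ _ _ _ (nbhs _) (nbhs _)); [exact: cvg_id|exact: cvg_cst].
  have nm : nbhs m [set a | A (a, 0) -> V (phi (a, 0))] by exact: cN0 m _ mV.
  by apply: filterS nm => a; apply; exact: AN.
have [|m [Xm Lm m0]] := eL X' (fun _ _ => Logic.I) sX' clX'.
  move=> X'0; apply: X0; apply/seteqP; split=> [x Xx|_ ->]; last exact: sX.1.
  have [m xm] := XN x Xx; have : X' m by rewrite /X' /= -xm.
  by rewrite X'0 => /= m0; rewrite xm m0 phi0.
exists (phi (m, 0)); split=> //.
- have jm : phi (m, j m) = 0.
    by apply/phik; [apply: sHC; rewrite -jL; exists m|split].
  have -> : (m, 0) = (m, j m) - (0, j m) :> N * K by congr pair; rewrite /= ?subr0 ?subrr.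
  have Cjm : C (j m) by apply: sHC; rewrite -jL; exists m.
  rewrite phiB// jm sub0r; apply: (subgroupN sC).
  (* The image of [C] is connected and contains 0, so it lies in [C], although [phi] need not be the
     identity on the second factor. *)
  have cE : connected ((fun c => phi (0, c)) @` C).
    apply: connected_continuous_connected; first exact: conn0_connected.
    apply/subspace_continuousP => c Cc V pV.
    move: phic => /subspace_continuousP/(_ (0, c) Cc)/(_ V pV).
    rewrite /within /= => cV.
    have c0K : continuous (fun c : K => (0 : N, c)).
      by move=> a; apply: (@cvg_pair _ _ _ _ (nbhs _) (nbhs _)); [exact: cvg_cst|exact: cvg_id].
    exact: (c0K c _ cV).
  apply: (conn0_max cE); last by exists (j m).
  by exists 0; [exact: sC.1|rewrite -[(0, 0)]/(0 : N * K) phi0].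
- apply: contra_neq m0 => pm.
  have [_ /= j0] : graph_on L j (m, 0) by apply/phik.
  apply: (jI m 0); rewrite ?inE//; first exact: sL.1.
  by rewrite -j0; apply: (addrI (j 0)); rewrite -jD ?addr0//; exact: sL.1.
Qed.

(** * Construction of delta-subgroups *)

Section SubgroupType.
Variables (G : topologicalZmodType) (A : set G).

(** The proof [sA] is a parameter so that the group structure can be inferred from the type
    alone. *)
Definition subgroup_type (sA : subgroup A) : Type := {x : G | A x}.

Variable sA : subgroup A.
Local Notation T := (subgroup_type sA).

HB.instance Definition _ := gen_eqMixin T.
HB.instance Definition _ := gen_choiceMixin T.

Definition incl (x : T) : G := sval x.

Lemma incl_inj : injective incl.
Proof. by move=> [x Ax] [y Ay] /= xy; apply/eq_exist. Qed.

Definition sub0 : T := exist _ 0 sA.1.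
Definition sub_add (x y : T) : T := exist _ _ (subgroupD sA (svalP x) (svalP y)).
Definition sub_opp (x : T) : T := exist _ _ (subgroupN sA (svalP x)).

Lemma sub_addA : associative sub_add.
Proof. by move=> x y z; apply: incl_inj; exact: addrA. Qed.
Lemma sub_addC : commutative sub_add.
Proof. by move=> x y; apply: incl_inj; exact: addrC. Qed.
Lemma sub_add0 : left_id sub0 sub_add.
Proof. by move=> x; apply: incl_inj; exact: add0r. Qed.
Lemma sub_addN : left_inverse sub0 sub_opp sub_add.
Proof. by move=> x; apply: incl_inj; exact: addNr. Qed.

HB.instance Definition _ := GRing.isZmodule.Build T sub_addA sub_addC sub_add0 sub_addN.
HB.instance Definition _ := Topological.copy T (initial_topology incl).

Lemma incl_continuous : continuous incl.
Proof. exact: initial_continuous. Qed.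

Lemma nbhs_incl (x : T) (V : set T) : nbhs x V <->
  exists2 W, nbhs (incl x) W & incl @^-1` W `<=` V.
Proof.
split=> [[B [[W oW <-] Wx] BV]|[W xW WV]].
  by exists W => //; apply: open_nbhs_nbhs.
by apply: filterS WV _; exact: incl_continuous.
Qed.

Lemma sub_sub_continuous : continuous (fun p : T * T => p.1 - p.2).
Proof.
move=> [x y] V /nbhs_incl[W xyW WV].
have [[P Q] /= [xP yQ] PQ] := @sub_continuous G (incl x, incl y) W xyW.
exists (incl @^-1` P, incl @^-1` Q) => /=.
  by split; exact: incl_continuous.
by move=> [a b] /= [Pa Qb]; apply: WV; exact: (PQ (incl a, incl b)).
Qed.

HB.instance Definition _ :=
  PreTopologicalNmodule_isTopologicalZmodule.Build T sub_sub_continuous.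

Lemma subgroup_type_hausdorff : hausdorff_space G -> hausdorff_space T.
Proof.
move=> hG p q pq; apply: incl_inj; apply: hG => P Q pP qQ.
have [x [Px Qx]] := pq _ _ (@incl_continuous p _ pP) (@incl_continuous q _ qQ).
by exists (incl x).
Qed.

Lemma subgroup_type_compact : compact A -> compact [set: T].
Proof.
move=> cA F FF _.
have FA : F (incl @^-1` A).
  by apply: filterS (@filterT _ F _) => y _; exact: (svalP y).
have [x [Ax Fx]] := cA (incl @ F) _ FA.
exists (exist _ x Ax); split=> // P Q FP /nbhs_incl[W xW WQ].
have FiP : F (incl @^-1` (incl @` P)) by apply: filterS FP => y Py; exists y.
have [_ [[y Py <-] Wy]] := Fx (incl @` P) W FiP xW.
by exists y; split=> //; exact: WQ.
Qed.

Lemma subgroup_type_totally_disconnected :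
  totally_disconnected A -> totally_disconnected [set: T].
Proof.
move=> tdA x _; apply/seteqP; split=> [y yx|_ ->]; last exact: connected_component_refl.
apply: incl_inj; have := tdA (incl x) (svalP x) => tdx.
suff : connected_component A (incl x) (incl y) by rewrite tdx.
apply: (@connected_component_max _ A (incl @` connected_component setT x)).
- by exists x => //; exact: connected_component_refl.
- by move=> _ [z _ <-]; exact: (svalP z).
- apply: connected_continuous_connected; first exact: component_connected.
  by apply: continuous_subspaceT; exact: incl_continuous.
- by exists y.
Qed.

End SubgroupType.
Arguments incl {G A sA} x : simpl never.

(** * Joint kernels of families of characters *)

Section Construction.
Variable K : topologicalZmodType.
Hypotheses (hK : hausdorff_space K) (cK : compact [set: K]) (dK : finite_dim K).
Let C := conn0 K.
Let clC : closed C := @conn0_closed K.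
Let sC : subgroup C := @conn0_subgroup K.

Let torsion_free chi n : character chi -> (0 < n)%N -> trivial_on C (chi *+ n) ->
  trivial_on C chi.
Proof. exact: connected_torsion (@conn0_connected K) (@conn0_id K). Qed.

Lemma trivial_common_ker r (psi : 'I_r -> K -> circ) (k : 'I_r -> int) chi m D :
  trivial_on D (chi *+ m - \sum_i psi i *~ k i) ->
  trivial_on (common_ker psi `&` D) (chi *+ m).
Proof.
move=> td x [kx Dx]; have := td x Dx.
change ((chi *+ m) x - (\sum_i psi i *~ k i) x = 0 -> (chi *+ m) x = 0).
by rewrite combE big1 ?subr0// => i _; rewrite kx mul0rz.
Qed.

Lemma exists_delta_subgroup : exists N, delta_subgroup [set: K] N.
Proof.
have [r [psi [cpsi ind max]]] := maximal_independent cK dK clC sC.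
have indT : independent_on setT psi.
  by move=> k tk; apply: ind => x _; exact: tk.
have sT : subgroup [set: K] by [].
exists (setT `&` common_ker psi); apply: (common_ker_delta cK cpsi closedT sT indT).
apply: (torsion_kernel_totally_disconnected hK cK).
  by rewrite setTI; exact: common_ker_subgroup.
move=> chi cchi; have [m [k [m0 tm]]] := max chi cchi; exists m => //.
by rewrite setTI; exact: trivial_common_ker tm.
Qed.

(* [N0] is the joint kernel of a maximal independent family and of finitely many
   characters whose joint kernel lies in [V]. *)
Lemma small_kernel (V : set K) : nbhs 0 V -> exists N0 : set K,
  [/\ [/\ subgroup N0, closed N0, totally_disconnected N0 & N0 `<=` V],
      delta_subgroup C (C `&` N0) &
      open [set x | exists y, C y /\ N0 (x + y)]].
Proof.
move=> zV.
have [r [psi [cpsi ind max]]] := maximal_independent cK dK clC sC.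
have cV : compact (~` V°).
  by apply: closed_compact => //; apply: open_closedC; exact: open_interior.
have [|s sP] := @compact_fin_cover K (K -> circ) (~` V°)
    (fun chi => [set x | character chi /\ chi x != 0]) cV.
  move=> x nVx; have x0 : x != 0 by apply/eqP => x0; apply: nVx; rewrite x0.
  have [chi [cchi chix]] := characters_separate hK cK x0; exists chi.
  apply: filterS (_ : nbhs x (~` [set y | chi y = 0])).
    by move=> y /eqP.
  apply: open_nbhs_nbhs; split; last exact/eqP.
  by apply: closed_openC; exact: char_ker_closed.
pose t := codom psi ++ [seq chi <- s | `[< character chi >]].
pose gam (i : 'I_(size t)) := nth 0 t i.
have tP chi : chi \in t -> exists i, gam i = chi.
  move=> ct; have it : (index chi t < size t)%N by rewrite index_mem.
  by exists (Ordinal it); rewrite /gam /= nth_index.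
have cgam i : character (gam i).
  have := mem_nth 0 (ltn_ord i); rewrite -/(gam i) mem_cat => /orP[/codomP[k ->]//|].
  by rewrite mem_filter => /andP[/asboolP].
pose N0 := common_ker gam.
have N0psi : N0 `<=` common_ker psi.
  move=> x Nx k; have [|i <-] := tP (psi k); last exact: Nx.
  by rewrite mem_cat codom_f.
have sN0 : subgroup N0 by exact: common_ker_subgroup.
have tdN0 (D : set K) : D `<=` N0 -> subgroup D -> totally_disconnected D.
  move=> DN sD; apply: (torsion_kernel_totally_disconnected hK cK) => // chi cchi.
  have [m [k [m0 tm]]] := max chi cchi; exists m => // x [Dx Cx].
  by apply: (trivial_common_ker tm); split=> //; apply: N0psi; exact: DN.
exists N0; split.
- split=> //; [exact: common_ker_closed|exact: tdN0|].
  move=> x Nx; apply: contrapT => nVx.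
  have [|chi cs [cchi /eqP]] := sP x; first by move=> /interior_subset.
  apply; have [|i <-] := tP chi; last exact: Nx.
  by rewrite mem_cat mem_filter cs andbT; apply/orP; right; apply/asboolP.
(* The enlarged family may be dependent on [C], and a delta-subgroup needs a map onto a full torus;
   the reduced family has the same joint kernel in [C]. *)
- have [q [phi [cphi iphi kphi]]] := independent_reduction cgam torsion_free.
  have E : C `&` N0 = C `&` common_ker phi.
    by apply/seteqP; split=> x [Cx Nx]; split=> //; apply/(kphi x Cx).
  rewrite E; apply: (common_ker_delta cK cphi clC sC iphi); rewrite -E.
  by apply: tdN0 => [x []//|]; exact: subgroupI.
have sU : subgroup [set x | exists y, C y /\ N0 (x + y)].
  split; first by exists 0; rewrite addr0; split; [exact: sC.1|exact: sN0.1].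
  move=> x y [a [Ca Na]] [b [Cb Nb]]; exists (a - b); split; first exact: (subgroupB sC Ca Cb).
  by rewrite addrACA -opprD; exact: (subgroupB sN0 Na Nb).
have /choice[m /choice[k mk]] : forall i, exists m (k : 'I_r -> int),
    (0 < m)%N /\ trivial_on C (gam i *+ m - \sum_j psi j *~ k j).
  by move=> i; exact: max.
have ceta i : character (gam i *+ m i - \sum_j psi j *~ k i j).
  apply: (subgroupB (@character_subgroup K)).
    exact: (subgroupMn (@character_subgroup K)).
  exact: comb_character.
(* For [x] near 0, openness of [psi] on [C] gives a small [c] in [C] with the same [psi]-values. On
   [x - c] each [gam i] is then killed by [m i]; membership in [W1] makes it 0, and so [x - c] lies
   in [N0]. *)
pose W1 := [set x | forall i, forall l : 'I_(m i), 0 < re (gam i x *+ l)].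
have zW1 : nbhs 0 W1 by apply: filter_forall => i; exact: char_torsion_open (cgam i).
have [W2 [zW2 W2N W2D _]] := nbhs0_half zW1.
have [e [e0 eP]] := char_coordinates_open cK cpsi clC sC ind zW2.
pose W := [set x | [/\ W2 x, (forall i, 1 - e < re (psi i x)) &
  forall i, (gam i *+ m i - \sum_j psi j *~ k i j) x = 0]].
have zW : nbhs 0 W.
  have z1 : nbhs 0 [set x | forall i, 1 - e < re (psi i x)].
    by apply: filter_forall => i; exact: (char_nbhs (cpsi i) e0).
  have z2 : nbhs 0 [set x | forall i, (gam i *+ m i - \sum_j psi j *~ k i j) x = 0].
    apply: filter_forall => i; apply: (char_trivial_conn0_open hK cK) => //.
    exact: (mk i).2.
  by apply: filterS (filterI zW2 (filterI z1 z2)) => x [? [? ?]].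
have WU x : W x -> exists y, C y /\ N0 (x + y).
  move=> [W2x ex etax].
  have [c [Cc W2c psic]] := eP (fun i => psi i x) ex.
  exists (- c); split; first exact: subgroupN.
  move=> i; apply: (circ_torsion_small (mk i).1); last exact: (W2D _ _ W2x (W2N _ W2c)).
  have tor : trivial_on (common_ker psi `&` [set x - c]) (gam i *+ m i).
    apply: (trivial_common_ker (k := k i)) => y ->.
    by rewrite charB// etax (mk i).2 ?subrr.
  have := tor (x - c) (conj _ erefl); rewrite pmulrn fun_mulrz -pmulrn; apply.
  by move=> j; rewrite charB// psic subrr.
rewrite openE => x Ux /=; rewrite /interior nbhs_addlE.
apply: filterS zW => w /WU Uw; exact: (subgroupD sU Ux Uw).
Qed.

End Construction.

(** * The theorem *)

Lemma locally_essential_delta (K : topologicalZmodType) :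
  hausdorff_space K -> compact [set: K] -> finite_dim K ->
  locally_essential_in (conn0 K) setT ->
  exists N : set K, delta_subgroup setT N /\ locally_essential_in (N `&` conn0 K) N.
Proof.
move=> hK cK dK [V [zV VP]]; have [N dN] := exists_delta_subgroup hK cK dK.
exists N; split=> //; exists V; split=> // X XN XV sX clX X0.
have [//|x [Xx Cx x0]] := VP X _ XV sX clX X0.
by exists x; split=> //; split=> //; exact: XN.
Qed.

Lemma locally_essential_quotient (K : topologicalZmodType) :
  hausdorff_space K -> compact [set: K] -> finite_dim K ->
  locally_essential_in (conn0 K) setT ->
  exists H : set K, delta_subgroup (conn0 K) H /\
    exists (N : topologicalZmodType),
      [/\ hausdorff_space N, compact [set: N] & totally_disconnected [set: N]] /\
    exists L : set N, [/\ subgroup L, closed L & essential_in L setT] /\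
    exists j : N -> K, top_iso_on L H j /\
    exists (U : set K) (phi : (N * K)%type -> K),
      [/\ open U, subgroup U &
        quotient_iso_prod [set p | conn0 K p.2] (graph_on L j) U phi].
Proof.
move=> hK cK dK [V [zV VP]].
have [N0 [[sN0 clN0 tdN0 N0V] dC oU]] := small_kernel hK cK dK zV.
set C := conn0 K in VP dC oU *.
have clC : closed C := @conn0_closed K.
have sC : subgroup C := @conn0_subgroup K.
have cN0 : compact N0 by exact: closed_compact.
pose T : topologicalZmodType := subgroup_type sN0.
have inclD (u v : T) : incl (u + v) = incl u + incl v by [].
have inclB (u v : T) : incl (u - v) = incl u - incl v by [].
have incl0 : incl (0 : T) = 0 by [].
have N0incl (u : T) : N0 (incl u) by exact: (svalP u).
have cT : compact [set: T] by exact: subgroup_type_compact.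
exists (C `&` N0); split=> //; exists T; split.
  split=> //; [exact: subgroup_type_hausdorff|exact: subgroup_type_totally_disconnected].
pose L := [set u : T | C (incl u)].
have sL : subgroup L.
  by split=> [|u v Lu Lv]; [exact: sC.1|exact: (subgroupB sC Lu Lv)].
exists L; split.
  split=> //.
    by apply: closed_comp => // u _; exact: incl_continuous.
  (* Local essentiality becomes essentiality, since [N0] lies inside the neighbourhood [V]: every
     closed subgroup of [N0] is small. *)
  move=> X _ sX clX X0.
  have clX' : closed (incl @` X).
    apply: compact_closed => //; apply: continuous_compact.
      by apply: continuous_subspaceT; exact: incl_continuous.
    by rewrite -[X]setTI; exact: compact_closedI.
  have XV : incl @` X `<=` V by move=> _ [u _ <-]; exact: N0V.
  have sX' : subgroup (incl @` X).
    split; first by exists 0; rewrite ?incl0//; exact: sX.1.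
    by move=> _ _ [u Xu <-] [v Xv <-]; exists (u - v) => //; exact: (subgroupB sX).
  have X'0 : incl @` X <> [set 0].
    move=> X'0; apply: X0; apply/seteqP; split=> [u Xu|_ ->]; last exact: sX.1.
    have : (incl @` X) (incl u) by exists u.
    by rewrite X'0 => /= u0; apply: incl_inj.
  have [_ [[u Xu <-] Cu u0]] := VP _ (fun _ _ => Logic.I) XV sX' clX' X'0.
  by exists u; split=> //; apply: contra_neq u0 => ->.
exists incl; split.
  split=> //.
  - by move=> u v _ _; exact: incl_inj.
  - apply/seteqP; split=> [_ [u Lu <-]|x [Cx Nx]]; first by split.
    by exists (exist _ x Nx).
  - by apply: continuous_subspaceT; exact: incl_continuous.
  - move=> _ [W [[W' oW' <-] ->]]; exists W'; split=> //.
    apply/seteqP; split=> [_ [u [/= Wu Lu] <-]|x [Wx [Cx Nx]]]; first by split.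
    by exists (exist _ x Nx).
pose U := [set x | exists y, C y /\ N0 (x + y)].
(* The difference, rather than the sum, has the graph of the inclusion as its kernel. *)
pose phi (p : T * K) := incl p.1 - p.2.
exists U, phi; split=> //.
  split; first by exists 0; rewrite addr0; split; [exact: sC.1|exact: sN0.1].
  move=> x y [a [Ca Na]] [b [Cb Nb]]; exists (a - b); split.
    exact: (subgroupB sC Ca Cb).
  by rewrite addrACA -opprD; exact: (subgroupB sN0 Na Nb).
have phic : continuous phi.
  move=> p; apply: (@continuous_comp _ _ _ (fun p : T * K => (incl p.1, p.2))
    (fun q : K * K => q.1 - q.2)); last exact: sub_continuous.
  apply: (@cvg_pair _ _ _ _ (nbhs _) (nbhs _)); last exact: cvg_snd.
  by apply: continuous_comp; [exact: cvg_fst|exact: incl_continuous].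
have phiU : phi @` [set p | C p.2] = U.
  apply/seteqP; split=> [_ [p Cp <-]|x [y [Cy Nxy]]].
    by exists p.2; rewrite /phi subrK.
  by exists (exist _ (x + y) Nxy, y); rewrite // /phi /= addrK.
have phiker p : C p.2 -> phi p = 0 <-> graph_on L incl p.
  move=> Cp; rewrite /phi /graph_on /L /=; split=> [/eqP|[_ ->]].
    by rewrite subr_eq0 => /eqP pE; rewrite pE.
  by rewrite subrr.
split=> //.
- by move=> p q _ _; rewrite /phi /= inclD opprD addrACA.
- exact: continuous_subspaceT.
- move=> W oW; rewrite -phiU.
  apply: (orbit_map_open (I := {u | L u})
    (g := fun u p => (p.1 + sval u, p.2 + incl (sval u)))) oW => //.
  + rewrite (_ : [set p | _] = setT `*` C); last first.
      by apply/seteqP; split=> -[a b] //= [].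
    by apply: compact_setX => //; exact: closed_compact.
  + exact: continuous_subspaceT.
  + move=> u p; apply: (@cvg_pair _ _ _ _ (nbhs _) (nbhs _)).
      apply: (@continuous_comp _ _ _ fst (fun a : T => a + sval u)); first exact: cvg_fst.
      exact: translation_continuous.
    apply: (@continuous_comp _ _ _ snd (fun a : K => a + incl (sval u))); first exact: cvg_snd.
    exact: translation_continuous.
  + move=> [u Lu] p Cp; split; first exact: (subgroupD sC).
    by rewrite /phi /= inclD opprD addrACA subrr addr0.
  + move=> p q Cp Cq pq.
    have [Lu uE] : graph_on L incl (q - p).
      apply/phiker; first exact: (subgroupB sC).
      have -> : phi (q - p) = phi q - phi p by rewrite /phi /= inclB !opprD addrACA.
      by rewrite pq subrr.
    exists (exist _ (q.1 - p.1) Lu); rewrite /= [LHS]surjective_pairing; congr pair.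
      by rewrite subrKC.
    by move: uE => /= <-; rewrite subrKC.
Qed.
Theorem theorem5p7 (K : topologicalZmodType)
  (hK : hausdorff_space K) (cK : compact [set: K]) (dK : finite_dim K) :
  let C := conn0 K in
  [/\ (* (a) <-> (b) *)
      locally_essential_in C setT <->
        (exists N : set K, delta_subgroup setT N /\
           locally_essential_in (N `&` C) N),
      (* (a) <-> (c) *)
      locally_essential_in C setT <->
        (exists H : set K, delta_subgroup C H /\
         exists (N : topologicalZmodType),
           [/\ hausdorff_space N, compact [set: N] &
               totally_disconnected [set: N]] /\
         exists L : set N,
           [/\ subgroup L, closed L & essential_in L setT] /\
         exists j : N -> K,
           top_iso_on L H j /\
           exists (U : set K) (phi : (N * K)%type -> K),
             [/\ open U, subgroup U &
                 quotient_iso_prod [set p | C p.2] (graph_on L j) U phi])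
    & (* (b) <-> (c) *)
      (exists N : set K, delta_subgroup setT N /\
           locally_essential_in (N `&` C) N) <->
        (exists H : set K, delta_subgroup C H /\
         exists (N : topologicalZmodType),
           [/\ hausdorff_space N, compact [set: N] &
               totally_disconnected [set: N]] /\
         exists L : set N,
           [/\ subgroup L, closed L & essential_in L setT] /\
         exists j : N -> K,
           top_iso_on L H j /\
           exists (U : set K) (phi : (N * K)%type -> K),
             [/\ open U, subgroup U &
                 quotient_iso_prod [set p | C p.2] (graph_on L j) U phi])].
Proof.
move=> C.
have ab := locally_essential_delta hK cK dK.
have ba := delta_locally_essential cK dK.
have ac := locally_essential_quotient hK cK dK.
have ca : (exists H : set K, delta_subgroup C H /\
    exists (N : topologicalZmodType),
      [/\ hausdorff_space N, compact [set: N] & totally_disconnected [set: N]] /\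
    exists L : set N, [/\ subgroup L, closed L & essential_in L setT] /\
    exists j : N -> K, top_iso_on L H j /\
    exists (U : set K) (phi : (N * K)%type -> K),
      [/\ open U, subgroup U &
        quotient_iso_prod [set p | C p.2] (graph_on L j) U phi]) ->
    locally_essential_in C setT.
  move=> [H [dH [N [[_ cN _] [L [[sL clL eL] [j [jL [U [phi [oU sU q]]]]]]]]]]].
  exact: (quotient_locally_essential hK cK dK dH cN sL clL eL jL oU sU q).
split; [by split|by split|split=> [/ba/ac//|/ca/ab//]].
Qed.
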